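(* Let $p>1$ and let $u$ be a finite-energy solution to the defocusing wave equation $u_{tt}-u_{xx}=-|u|^{p-1}u$ on $\mathbb{R}_x\times\mathbb{R}_t$ with compactly supported and even initial data $(u_0,u_1)$ (i.e. both $u_0$ and $u_1$ are even functions of $x$). Let \[ e_+(x,t)=\frac14|u_x(x,t)-u_t(x,t)|^2+\frac{1}{2(p+1)}|u(x,t)|^{p+1}. \] Then \[ \liminf_{t\to+\infty}\iint_{\mathbb{R}^2}|x_1-x_2|\,e_+(x_1,t)\,e_+(x_2,t)\,dx_1\,dx_2>0. \]
   Context: A finite-energy solution to the defocusing equation $u_{tt}-u_{xx}=-|u|^{p-1}u$ with initial data $(u(\cdot,0),u_t(\cdot,0))=(u_0,u_1)\in(\dot H^1(\mathbb{R})\cap L^{p+1}(\mathbb{R}))\times L^2(\mathbb{R})$ means the unique global solution $u\in C(\mathbb{R}_x\times\mathbb{R}_t)$ with $(u(\cdot,t),u_t(\cdot,t))\in C(\mathbb{R}_t;(\dot H^1\cap L^{p+1})\times L^2)$ satisfying D'Alembert's formula \[ u(x,t)=\tfrac12\Big[u_0(x-t)+u_0(x+t)+\int_{x-t}^{x+t}u_1(x')\,dx'\Big]-\tfrac12\int_0^t\int_{x-t+t'}^{x+t-t'}|u|^{p-1}u(x',t')\,dx'\,dt'. \] The function $e_+$ is called the right-going energy density.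
   Formalization: The formal statement adds the hypothesis that u is not identically zero; for u = 0, which has compactly supported even data, e_+ vanishes and the liminf equals 0, so the claim fails in exactly that case. *)

(* Defs.v *)
From HB Require Import structures.
From mathcomp Require Import all_boot all_order all_algebra.
From mathcomp Require Import all_classical all_reals all_analysis.
Set Implicit Arguments.
Unset Strict Implicit.
Unset Printing Implicit Defensive.
Import Order.TTheory GRing.Theory Num.Theory.
Import numFieldNormedType.Exports.
Local Open Scope classical_set_scope.
Local Open Scope ring_scope.

(* Solutions are real-valued functions u : R -> R -> R,
   written u x t (space variable first, time variable second). *)

(* \int_a^b f with the usual sign convention when b < a; needed because the
   equation is solved for all t, negative times included. *)
Definition oriented_integral (R : realType) (a b : R) (f : R -> R) : R :=
  if a <= b then \int[lebesgue_measure]_(x in `[a, b]) f x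
  else - \int[lebesgue_measure]_(x in `[b, a]) f x.

Definition compactly_supported (R : realType) (f : R -> R) : Prop :=
  exists2 K : set R, compact K & forall x, ~ K x -> f x = 0.

(* The same notion for functions defined up to a null set. *)
Definition ae_compactly_supported (R : realType) (f : R -> R) : Prop :=
  exists2 K : set R, compact K &
    {ae lebesgue_measure, forall x, ~ K x -> f x = 0}.

(* C^1_c(R). Using C^1_c instead of C^oo_c test functions below gives the same
   weak derivatives, by density. *)
Definition test_function (R : realType) (phi : R -> R) : Prop :=
  [/\ forall x, derivable phi x 1, continuous (derive1 phi) &
      compactly_supported phi].

Definition weak_derivative (R : realType) (f g : R -> R) : Prop :=
  forall phi : R -> R, test_function phi ->
    \int[lebesgue_measure]_x (f x * derive1 phi x) =
    - \int[lebesgue_measure]_x (g x * phi x).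

Definition homogeneous_H1 (R : realType) (f : R -> R) : Prop :=
  exists2 g : R -> R, g \in Lfun (@lebesgue_measure R) 2%:E &
    weak_derivative f g.

(* t |-> f(., t) belongs to C(R_t; L^q(R_x)). *)
Definition continuous_in_Lq (R : realType) (q : R) (f : R -> R -> R) : Prop :=
  (forall t, f^~ t \in Lfun (@lebesgue_measure R) q%:E) /\
  (forall t, Lnorm (@lebesgue_measure R) q%:E (fun x => (f x s - f x t)%:E)
               @[s --> t] --> 0%E).

(* ut(., t) is the derivative in time of the curve t |-> u(., t), in the sense
   of distributions in x. When t |-> ut(., t) is continuous with values in L^2
   and u is continuous, this is the same as ut = du/dt in D'(R_x * R_t), but it
   determines ut(., t) at every time t. *)
Definition weak_time_derivative (R : realType) (u ut : R -> R -> R) : Prop :=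
  forall phi : R -> R, test_function phi -> forall t : R,
    is_derive t (1 : R) (fun s : R => \int[lebesgue_measure]_x (u x s * phi x))
      (\int[lebesgue_measure]_x (ut x t * phi x)).

Definition nonlinearity (R : realType) (p y : R) : R := `|y| `^ (p - 1) * y.

(* u is the finite-energy solution with data (u0, u1); ux and ut are
   representatives of its partial derivatives u_x and u_t, which are elements
   of L^2(R_x) at each time. *)
Record finite_energy_solution (R : realType) (p : R) (u0 u1 : R -> R)
    (u ux ut : R -> R -> R) : Prop := FiniteEnergySolution {
  data_position : homogeneous_H1 u0 /\ u0 \in Lfun (@lebesgue_measure R) (p + 1)%:E ;
  data_velocity : u1 \in Lfun (@lebesgue_measure R) 2%:E ;
  sol_continuous : continuous (fun z : R * R => u z.1 z.2) ;
  sol_ux : forall t, weak_derivative (u^~ t) (ux^~ t) ;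
  sol_ut : weak_time_derivative u ut ;
  sol_ux_L2 : continuous_in_Lq 2 ux ;
  sol_u_Lp1 : continuous_in_Lq (p + 1) u ;
  sol_ut_L2 : continuous_in_Lq 2 ut ;
  sol_init_position : forall x, u x 0 = u0 x ;
  sol_init_velocity : {ae lebesgue_measure, forall x, ut x 0 = u1 x} ;
  sol_dalembert : forall x t,
    u x t =
      2^-1 * (u0 (x - t) + u0 (x + t) + oriented_integral (x - t) (x + t) u1)
      - 2^-1 * oriented_integral 0 t (fun t' =>
          oriented_integral (x - t + t') (x + t - t') (fun x' =>
            nonlinearity p (u x' t')))
}.

Definition right_energy_density (R : realType) (p : R) (u ux ut : R -> R -> R)
    (x t : R) : R :=
  4^-1 * `|ux x t - ut x t| ^+ 2
  + (2 * (p + 1))^-1 * `|u x t| `^ (p + 1).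

(* Main.v *)
Require Import Defs.
From HB Require Import structures.
From mathcomp Require Import all_boot all_order all_algebra.
From mathcomp Require Import all_classical all_reals all_analysis.
From mathcomp Require Import measurable_realfun ring lra.
Set Implicit Arguments.
Unset Strict Implicit.
Unset Printing Implicit Defensive.
Import Order.TTheory GRing.Theory Num.Theory.
Import numFieldNormedType.Exports.
Local Open Scope classical_set_scope.
Local Open Scope ring_scope.

(** Put v = u_x - u_t and N(y) = |y|^(p-1) y.  In the coordinates (s, r) of
    the point x = s + r at time r, the equation says that v changes along a
    right-going characteristic only through the force, dv/dr = N(u), and the
    definition of v says that u has derivative v/2 in s along a left-going
    characteristic, where s + 2 r is constant.  The record [char_solution]
    collects these two integrated relations, the evenness of u and the support
    of the data; [solution_char] derives them from d'Alembert's formula, and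
    [right_derivative_ae] shows that v really is u_x - u_t at every later time.

    Let P(y) = |y|^(p+1) / (p+1), let A(s, t) be the right-going energy to the
    right of s + t at time t ([tail]), and let E be its total.  Then E is
    conserved, and A(s, t) = A(s, 0) - \int_0^t P(u(s + r, r)) dr
    ([tail_evol]): energy falls behind a right-going characteristic only at the
    rate P(u).  By Fubini, the integral of (x1 - x2)^+ e_+(x1) e_+(x2) equals
    Q(t) = \int A (E - A) ds ([interaction], compared with the double integral
    in [interaction_le_pair]), so a positive lower bound on Q suffices.

    Differentiating, Q' = \int (2 A - E) P ds.  Since P(u) is even in x, the
    weights at x and -x may be averaged; their sum is at least -2 D, where
    D = E - A(-t, t) is the right-going energy found on the half-line x <= 0,
    and this gives Q' >= -4 D^2 ([interaction_rate_lower]).  Also D is small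
    when Q is: D q <= Q with q(t) = \int_(s >= -t) A(s, t) ds
    ([drop_mass_le]).  Finally q grows linearly ([tail_mass_growth]).  Indeed
    q(t) >= E t - \int\int P - const, and the virial inequality [virial] for
    the moment \int u v ds, which again uses evenness, bounds
    (p + 3) \int\int P by 4 E t up to small multiples of t; the coefficients
    leave a gain because p + 3 > 4.

    Consequently (1/Q)' <= 4 D^2 / Q^2 <= 4 / (c t)^2, which is integrable at
    infinity, so 1/Q stays bounded ([interaction_lower]).  The energy E is
    positive because u is not identically zero ([solution_energy_gt0]). *)

(** * Continuity, local integrability and oriented integrals *)

Section continuity.
Context {R : realType} {T : topologicalType}.
Implicit Types f g : T -> R.

Lemma cont_pair (U V : topologicalType) (f : T -> U) (g : T -> V) :
  continuous f -> continuous g -> continuous (fun t => (f t, g t)).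
Proof. by move=> cf cg t; apply: cvg_pair; [exact: cf|exact: cg]. Qed.

Lemma cont_comp (U V : topologicalType) (f : T -> U) (k : U -> V) :
  continuous k -> continuous f -> continuous (fun t => k (f t)).
Proof. by move=> ck cf t; apply: continuous_comp; [exact: cf|exact: ck]. Qed.

Lemma contD f g : continuous f -> continuous g -> continuous (fun t => f t + g t).
Proof. by move=> cf cg t; apply: cvgD; [exact: cf|exact: cg]. Qed.

Lemma contN f : continuous f -> continuous (fun t => - f t).
Proof. by move=> cf t; apply: cvgN; exact: cf. Qed.

Lemma contB f g : continuous f -> continuous g -> continuous (fun t => f t - g t).
Proof. by move=> cf cg; apply: contD => //; exact: contN. Qed.

Lemma contM f g : continuous f -> continuous g -> continuous (fun t => f t * g t).
Proof. by move=> cf cg t; apply: cvgM; [exact: cf|exact: cg]. Qed.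

Lemma contX f n : continuous f -> continuous (fun t => f t ^+ n).
Proof.
move=> cf; elim: n => [|n IH]; first exact: cst_continuous.
by under eq_fun do rewrite exprS; exact: contM.
Qed.

Lemma cont_norm f : continuous f -> continuous (fun t => `|f t|).
Proof. by move=> cf t; apply: cvg_norm; exact: cf. Qed.

Lemma cont_cst (U : topologicalType) (c : U) : continuous (fun _ : T => c).
Proof. exact: cst_continuous. Qed.

Lemma cont_id : continuous (fun t : T => t).
Proof. by move=> t; exact: cvg_id. Qed.

End continuity.

Lemma cont_fst (T U V : topologicalType) (f : T -> U * V) : continuous f ->
  continuous (fun t => (f t).1).
Proof. by move=> cf t; apply: (continuous_comp (cf t)); exact: cvg_fst. Qed.

Lemma cont_snd (T U V : topologicalType) (f : T -> U * V) : continuous f ->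
  continuous (fun t => (f t).2).
Proof. by move=> cf t; apply: (continuous_comp (cf t)); exact: cvg_snd. Qed.

Ltac cont_fold := lazymatch goal with
  | |- forall x, continuous_at x ?f => change (continuous f)
  | |- _ => idtac
  end.

(** The cases of partially applied operations are eta-reduced forms, which
    unification produces, of the others. *)
Ltac cont := repeat (cont_fold; lazymatch goal with
  | |- continuous (fun t => t) => exact: cont_id
  | |- continuous (fun t => (@?f t + @?g t)%R) => apply: (@contD _ _ f g)
  | |- continuous (fun t => (- (@?f t))%R) => apply: (@contN _ _ f)
  | |- continuous (fun t => (@?f t * @?g t)%R) => apply: (@contM _ _ f g)
  | |- continuous (fun t => ((@?f t) ^+ ?n)%R) => apply: (@contX _ _ f n)
  | |- continuous (fun t => `|@?f t|%R) => apply: (@cont_norm _ _ f)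
  | |- continuous (fun t => (@?f t, @?g t)) => apply: (@cont_pair _ _ _ f g)
  | |- continuous (fun t => (@?f t).1) => apply: (@cont_fst _ _ _ f)
  | |- continuous (fun t => (@?f t).2) => apply: (@cont_snd _ _ _ f)
  | |- continuous fst => apply: (@cont_fst _ _ _ (fun t => t))
  | |- continuous snd => apply: (@cont_snd _ _ _ (fun t => t))
  | |- continuous (pair ?c) => apply: (@cont_pair _ _ _ (fun=> c) (fun t => t))
  | |- continuous (+%R ?c) => apply: (@contD _ _ (fun=> c) (fun t => t))
  | |- continuous ( *%R ?c) => apply: (@contM _ _ (fun=> c) (fun t => t))
  | |- continuous -%R => apply: (@contN _ _ (fun t => t))
  | |- _ => first [assumption | exact: cont_cst]
  end).

(** Discards hypotheses about integrals and functions, which only slow down the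
    decision procedure for linear inequalities. *)
Ltac keep_order := repeat match goal with
  | H : ?T |- _ => lazymatch T with
     | is_true (_ <= _)%R => fail
     | is_true (_ < _)%R => fail
     | is_true (_ <= _ <= _)%R => fail
     | _ = _ => fail
     | Real.sort _ => fail
     | realType => fail
     | _ => clear H
     end
  end.
Ltac slra := keep_order; lra.

Section oriented_integrals.
Context {R : realType}.
Notation mu := (@lebesgue_measure R).

(** The plane carries the product sigma-algebra; the boxes with rational corners
    contained in an open set are countably many and cover it. *)
Lemma open_measurable2 (U : set (R * R)) : open U -> measurable U.
Proof.
move=> oU.
pose box (q : (rat * rat) * (rat * rat)) : set (R * R) :=
  `]ratr q.1.1, ratr q.1.2[ `*` `]ratr q.2.1, ratr q.2.2[.
have -> : U = \bigcup_(q in setT)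
    (if `[< box q `<=` U >] then box q else set0).
  apply/seteqP; split=> [[x y] Uxy|z [q _]]; last first.
    by case: asboolP => // + bz; exact.
  have [e e0 eU] : exists2 e : R, 0 < e & ball (x, y) e `<=` U.
    by apply/nbhs_ballP; move: oU; rewrite openE; exact.
  have ratI (a : R) : exists p : rat * rat,
      [/\ a - e < ratr p.1, ratr p.1 < a, a < ratr p.2 & ratr p.2 < a + e].
    have [p] : exists q : rat, ratr q \in `]a - e, a[.
      by apply: rat_in_itvoo; rewrite ltrBlDr ltrDl.
    rewrite in_itv/= => /andP[p1 p2].
    have [q] : exists q : rat, ratr q \in `]a, a + e[.
      by apply: rat_in_itvoo; rewrite ltrDl.
    by rewrite in_itv/= => /andP[q1 q2]; exists (p, q).
  have [[p1 p2] [/= p11 p12 p21 p22]] := ratI x.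
  have [[q1 q2] [/= q11 q12 q21 q22]] := ratI y.
  exists ((p1, p2), (q1, q2)) => //.
  case: asboolP => [_|]; first by rewrite /box/= !in_itv/= p12 p21 q12 q21.
  case; move=> [a b] /=; rewrite /box/= !in_itv/= => -[/andP[a1 a2] /andP[b1 b2]].
  by apply: eU; split; rewrite /ball/= ltr_norml; apply/andP; split; lra.
apply: countable_bigcupT_measurable => [|q]; first exact: countableP.
by case: asboolP => // _; exact: measurableX.
Qed.

Lemma continuous_measurable_fun2 (f : R * R -> R) :
  continuous f -> measurable_fun setT f.
Proof.
move=> cf; apply: (measurability _ (RGenOInfty.measurableE R)).
move=> _ [_ [x ->] <-]; rewrite setTI; apply: open_measurable2.
by apply: open_comp => // z _; exact: cf.
Qed.

(** The tube lemma: a neighbourhood of c0 that serves one x also serves nearby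
    points, and finitely many of those cover the compact interval. *)
Lemma near_uniform_itv (U : topologicalType) (k : R * U -> R) (a b e : R) (c0 : U) :
  continuous k -> 0 < e ->
  \forall c \near c0, forall x, x \in `[a, b] -> `|k (x, c) - k (x, c0)| < e.
Proof.
move=> ck e0.
have e20 : 0 < e / 2 by rewrite divr_gt0.
have := @segment_compact R a b => /compact_near_coveringP.
move=> /(_ U (nbhs c0) (fun c x => `|k (x, c) - k (x, c0)| < e) _) H.
suff : \forall c \near c0, `[a, b] `<=` (fun x => `|k (x, c) - k (x, c0)| < e).
  by apply: filterS => c sub x xab; exact: sub.
apply: H => x _.
have /cvgr_dist_lt /(_ _ e20) [[A B] /= [Ax Bc] dk] := ck (x, c0).
exists (A, B) => //.
move=> [y c] [/= Ay Bc'].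
have h1 : `|k (x, c0) - k (y, c)| < e / 2 by apply: dk; split.
have h2 : `|k (x, c0) - k (y, c0)| < e / 2.
  by apply: dk; split => //=; exact: nbhs_singleton.
by rewrite (_ : _ - _ = (k (x, c0) - k (y, c0)) - (k (x, c0) - k (y, c)));
  [rewrite (le_lt_trans (ler_normB _ _))//; lra|ring].
Qed.

Lemma uniform_continuous_itv (f : R -> R) (a b e : R) :
  (forall x, x \in `[a, b] -> {for x, continuous f}) -> 0 < e ->
  exists2 d, 0 < d & forall x y, x \in `[a, b] -> y \in `[a, b] ->
    `|x - y| < d -> `|f x - f y| < e.
Proof.
move=> cf e0.
have e20 : 0 < e / 2 by rewrite divr_gt0.
have := @segment_compact R a b => /compact_near_coveringP.
move=> /(_ R (0 : R)^'+
  (fun d x => forall y, `|x - y| < d -> `|f x - f y| < e) _) H.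
suff : \forall d \near 0^'+, `[a, b] `<=`
    (fun x => forall y, `|x - y| < d -> `|f x - f y| < e).
  move=> h; have [d [d0 hd]] : exists d : R, 0 < d /\ `[a, b] `<=`
      (fun x => forall y, `|x - y| < d -> `|f x - f y| < e).
    near (0:R)^'+ => d; exists d; split; near: d => //.
    exact: nbhs_right_gt.
  by exists d => // x y xab yab; exact: hd.
apply: H => x xab.
have /cvgr_dist_lt /(_ _ e20) /nbhs_ballP[d /= d0 dk] := cf _ xab.
have d20 : 0 < d / 2 by rewrite divr_gt0.
exists (ball x (d / 2), [set r | 0 < r < d / 2]) => /=.
  split; first exact: nbhsx_ballx.
  near=> r; rewrite /mkset; apply/andP; split; near: r.
    exact: nbhs_right_gt.
  exact: nbhs_right_lt.
move=> [y c] [/= yx /andP[c0 cd]] z yz.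
have h1 : `|f x - f y| < e / 2.
  by apply: dk; move: yx; rewrite /ball/= => /lt_le_trans; apply; lra.
have h2 : `|f x - f z| < e / 2.
  apply: dk; rewrite /ball/= (_ : x - z = (x - y) + (y - z)); last by ring.
  by rewrite (le_lt_trans (ler_normD _ _))//; move: yx; rewrite /ball/=; lra.
by rewrite (_ : _ - _ = (f x - f z) - (f x - f y));
  [rewrite (le_lt_trans (ler_normB _ _))//; lra|ring].
Unshelve. all: by end_near. Qed.

Lemma bounded_continuous_itv (f : R -> R) (a b : R) :
  (forall x, x \in `[a, b] -> {for x, continuous f}) ->
  exists2 M, 0 < M & forall x, x \in `[a, b] -> `|f x| <= M.
Proof.
move=> cf; have [ab|ba] := leP a b; last first.
  by exists 1 => // x; rewrite in_itv/= => /andP[ax xb]; lra.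
have cnf : {within `[a, b], continuous (fun x => `|f x|)}.
  apply: continuous_in_subspaceT => x /set_mem xab.
  by apply: cvg_norm; exact: cf.
have [c cab cmax] := EVT_max ab cnf.
exists (`|f c| + 1); first by rewrite ltr_wpDl.
by move=> x /cmax h; rewrite (le_trans h)// lerDl.
Qed.

(** Primitives of such functions over any interval, in either orientation, obey
    the usual rules without further finiteness conditions. *)
Definition locint (f : R -> R) :=
  forall a b, mu.-integrable `[a, b] (EFin \o f).

Notation oint := oriented_integral.

Lemma locintD f g : locint f -> locint g -> locint (fun x => f x + g x).
Proof. by move=> lf lg a b; exact: (integrableD _ (lf a b) (lg a b)). Qed.

Lemma locintZ c f : locint f -> locint (fun x => c * f x).
Proof. by move=> lf a b; apply: (integrableZl _ c (lf a b)). Qed.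

Lemma locintN f : locint f -> locint (fun x => - f x).
Proof. by move=> lf a b; apply: (integrableN (lf a b)). Qed.

Lemma locintB f g : locint f -> locint g -> locint (fun x => f x - g x).
Proof. by move=> lf lg; apply: locintD => //; exact: locintN. Qed.

Lemma locint_norm f : locint f -> locint (fun x => `|f x|).
Proof. by move=> lf a b; apply: (integrable_norm (lf a b)). Qed.

Lemma locint_continuous f : continuous f -> locint f.
Proof.
move=> cf a b; apply: continuous_compact_integrable; first exact: segment_compact.
by apply: continuous_subspaceT.
Qed.

Lemma locint_integrable f : mu.-integrable setT (EFin \o f) -> locint f.
Proof. by move=> lf a b; apply: integrableS lf. Qed.

Lemma locint_measurable f : locint f -> measurable_fun setT f.
Proof.
move=> lf.
have -> : [set: R] = \bigcup_n `[(- n%:R : R), (n%:R : R)]%classic.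
  apply/esym/seteqP; split=> // x _.
  have [n xn] : exists n : nat, `|x| < n%:R.
    by exists (Num.truncn `|x|).+1; rewrite truncnS_gt.
  by exists n => //=; rewrite in_itv/= -ler_norml ltW.
apply/measurable_fun_bigcup => // n.
by apply/measurable_EFinP; exact: measurable_int (lf _ _).
Qed.

Lemma locintMl (k f : R -> R) : continuous k -> locint f -> locint (fun x => k x * f x).
Proof.
move=> ck lf a b.
have [M M0 kM] := @bounded_continuous_itv k a b (fun x _ => ck x).
apply: le_integrable (locintZ M lf a b) => //.
- apply/measurable_EFinP; apply: measurable_funM.
    by apply: measurable_funTS; exact: continuous_measurable_fun.
  by apply: measurable_funTS; exact: locint_measurable.
- move=> x xab; rewrite /= lee_fin !normrM; apply: ler_pM => //=.
  by rewrite (gtr0_norm M0); exact: kM.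
Qed.

Lemma locint_le (f g : R -> R) : measurable_fun setT f -> locint g ->
  (forall x, `|f x| <= g x) -> locint f.
Proof.
move=> mf lg fg a b; apply: le_integrable (lg a b) => //.
  by apply/measurable_EFinP; exact: measurable_funTS.
by move=> x _ /=; rewrite lee_fin (le_trans (fg x))// ler_norm.
Qed.

Lemma ointE (f : R -> R) a b : a <= b -> oint a b f = \int[mu]_(x in `[a, b]) f x.
Proof. by rewrite /oriented_integral => ->. Qed.

Lemma oint_refl (f : R -> R) a : oint a a f = 0.
Proof. by rewrite ointE// set_itv1 Rintegral_set1. Qed.

Lemma oint_swap (f : R -> R) a b : oint a b f = - oint b a f.
Proof.
have [->|ab] := eqVneq a b; first by rewrite oint_refl oppr0.
rewrite /oriented_integral; case: (leP a b) => h1; case: (leP b a) => h2.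
- by move: ab; rewrite (@le_anti _ _ a b) ?eqxx// h1 h2.
- by rewrite opprK.
- by [].
- by move: (lt_trans h1 h2); rewrite ltxx.
Qed.

Let ch0 f a b c : locint f -> a <= b -> b <= c ->
  oint a b f + oint b c f = oint a c f.
Proof.
move=> lf ab bc; rewrite !ointE//; last exact: le_trans bc.
have := @Rintegral_itvB R f (BLeft a) (BRight c) b (lf _ _).
rewrite !bnd_simp => /(_ ab bc) h.
rewrite -(@Rintegral_itv_obnd_cbnd _ b).
  by rewrite -h; ring.
by apply: integrableS (lf b c) => // x /=; rewrite !in_itv/= => /andP[/ltW -> ->].
Qed.

Lemma oint_chasles f a b c : locint f -> oint a b f + oint b c f = oint a c f.
Proof.
move=> lf.
have base m x y : m <= x -> m <= y -> oint x y f = oint m y f - oint m x f.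
  move=> mx my; have [xy|/ltW yx] := leP x y.
    by rewrite -(ch0 lf mx xy); ring.
  by rewrite oint_swap -(ch0 lf my yx); ring.
pose m := Num.min a (Num.min b c).
have ma : m <= a by rewrite ge_min lexx.
have mb : m <= b by rewrite !ge_min lexx orbT.
have mc : m <= c by rewrite !ge_min lexx !orbT.
by rewrite (base m a b)// (base m b c)// (base m a c)//; ring.
Qed.

Lemma eq_oint (f g : R -> R) a b : (forall x, Num.min a b <= x <= Num.max a b -> f x = g x) ->
  oint a b f = oint a b g.
Proof.
move=> fg; rewrite /oriented_integral; case: (leP a b) => ab.
  apply: eq_Rintegral => x /set_mem/=; rewrite in_itv/= => xab.
  by apply: fg; rewrite min_l// max_r.
congr (- _); apply: eq_Rintegral => x /set_mem/=; rewrite in_itv/= => xab.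
by apply: fg; rewrite min_r ?max_l// ltW.
Qed.

Lemma eq_oint_le (f g : R -> R) a b : a <= b -> (forall x, a <= x <= b -> f x = g x) ->
  oint a b f = oint a b g.
Proof. by move=> ab fg; apply: eq_oint; rewrite min_l// max_r. Qed.

Lemma ointD f g a b : locint f -> locint g ->
  oint a b (fun x => f x + g x) = oint a b f + oint a b g.
Proof.
move=> lf lg; rewrite /oriented_integral; case: (leP a b) => ab.
  by rewrite RintegralD.
by rewrite RintegralD// opprD.
Qed.

Lemma ointZ c f a b : locint f ->
  oint a b (fun x => c * f x) = c * oint a b f.
Proof.
move=> lf; rewrite /oriented_integral; case: (leP a b) => ab.
  by rewrite RintegralZl.
by rewrite RintegralZl// mulrN.
Qed.

Lemma ointN f a b : locint f -> oint a b (fun x => - f x) = - oint a b f.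
Proof.
move=> lf; rewrite -[RHS]mulN1r -ointZ//; apply: eq_oint => x _.
by rewrite mulN1r.
Qed.

Lemma ointB f g a b : locint f -> locint g ->
  oint a b (fun x => f x - g x) = oint a b f - oint a b g.
Proof. by move=> lf lg; rewrite ointD ?ointN//; exact: locintN. Qed.

Lemma oint_cst (c a b : R) : oint a b (fun=> c) = c * (b - a).
Proof.
rewrite /oriented_integral; case: (leP a b) => ab; rewrite Rintegral_cst//=
  lebesgue_measure_itv/= lte_fin.
- case: ltgtP ab => //=; first by move=> ->; rewrite subrr.
- by rewrite ab/=; ring.
Qed.

Lemma oint0 (a b : R) : oint a b (fun=> 0) = 0 :> R.
Proof. by rewrite oint_cst mul0r. Qed.

Lemma oint_ge0 (f : R -> R) a b : a <= b -> (forall x, a <= x <= b -> 0 <= f x) ->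
  0 <= oint a b f.
Proof.
by move=> ab f0; rewrite ointE//; apply: Rintegral_ge0 => x/=; rewrite in_itv; exact: f0.
Qed.

Lemma le_oint f g a b : locint f -> locint g -> a <= b ->
  (forall x, a <= x <= b -> f x <= g x) -> oint a b f <= oint a b g.
Proof.
by move=> lf lg ab fg; rewrite !ointE//; exact: le_Rintegral.
Qed.

Lemma le_norm_oint f a b : locint f -> a <= b ->
  `|oint a b f| <= oint a b (fun x => `|f x|).
Proof. by move=> lf ab; rewrite !ointE//; exact: le_normr_Rintegral. Qed.

Lemma oint_norm_le f M a b : locint f -> a <= b ->
  (forall x, a <= x <= b -> `|f x| <= M) -> `|oint a b f| <= M * (b - a).
Proof.
move=> lf ab fM; rewrite (le_trans (le_norm_oint lf ab))// -oint_cst.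
by apply: le_oint => //; [exact: locint_norm|exact/locint_continuous/cst_continuous].
Qed.

Lemma le_oint_sub f a b c d : locint f -> (forall x, 0 <= f x) ->
  a <= b -> c <= a -> b <= d -> oint a b f <= oint c d f.
Proof.
move=> lf f0 ab ca bd.
rewrite -(oint_chasles c a d lf) -(oint_chasles a b d lf).
have := @oint_ge0 f c a ca (fun x _ => f0 x).
by have := @oint_ge0 f b d bd (fun x _ => f0 x); lra.
Qed.

End oriented_integrals.

(** * Affine changes of variable *)

Section affine_substitution.
Context {R : realType}.
Notation mu := (@lebesgue_measure R).
Notation oint := oriented_integral.

Lemma measurable_affine (c d : R) : measurable_fun [set: R] (fun x => c * x + d).
Proof.
apply: continuous_measurable_fun => x.
by apply: cvgD; [apply: cvgM; [exact: cvg_cst|exact: cvg_id]|exact: cvg_cst].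
Qed.

(** The pushforward as a bundled measure, to which the uniqueness of Lebesgue
    measure applies. *)
Lemma pushforward_measure_affine (c d : R) :
  exists nu : {measure set (measurableTypeR R) -> \bar R},
    nu = pushforward mu (fun x : R => c * x + d : measurableTypeR R)
    :> (set _ -> \bar R).
Proof.
unshelve eexists; last reflexivity.
Unshelve. exact: measurable_affine.
Qed.

(** Both sides are measures in A, and they agree on half-open intervals. *)
Lemma lebesgue_measure_affine (c d : R) (A : set R) : c != 0 -> measurable A ->
  mu A = (`|c|%:E * mu ((fun x : R => c * x + d)%R @^-1` A))%E.
Proof.
move=> c0 mA.
pose phi : measurableTypeR R -> measurableTypeR R := fun x : R => c * x + d.
have [nu nuE] := pushforward_measure_affine c d.
pose k : {nonneg R} := NngNum (normr_ge0 c).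
transitivity (mscale k nu A); last by rewrite /mscale/= nuE.
apply: lebesgue_measure_unique => // _ [[a b] _ <-]/=.
rewrite /mscale/= nuE /pushforward/= -/phi.
have cE x : c * x + d = c * (x + d / c) by field.
move: (c0); rewrite neq_lt => /orP[cN|cP].
  have -> : phi @^-1` `]a, b] = `[(b - d) / c, (a - d) / c[%classic.
    apply/seteqP; split => x /=; rewrite ?/phi !in_itv/= ler_ndivrMr// ltr_ndivlMr//;
      by move=> /andP[? ?]; apply/andP; split; lra.
  rewrite !lebesgue_measure_itv/= !lte_fin ltr_ndivrMr// divfK ?lt_eqF//.
  rewrite ltrBrDr subrK; case: ltP => // ab; last by rewrite mule0.
  rewrite -!EFinB -EFinM (ltr0_norm cN); congr (_%:E); field.
  by rewrite lt_eqF.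
have -> : phi @^-1` `]a, b] = `](a - d) / c, (b - d) / c]%classic.
  apply/seteqP; split => x /=; rewrite ?/phi !in_itv/= ler_pdivlMr// ltr_pdivrMr//;
    by move=> /andP[? ?]; apply/andP; split; lra.
rewrite !lebesgue_measure_itv/= !lte_fin ltr_pdivrMr// divfK ?gt_eqF//.
rewrite ltrBrDr subrK; case: ltP => // ab; last by rewrite mule0.
rewrite -!EFinB -EFinM (gtr0_norm cP); congr (_%:E); field.
by rewrite gt_eqF.
Qed.

Lemma ge0_integral_affine (c d : R) (D : set R) (f : R -> \bar R) :
  c != 0 -> measurable D -> measurable_fun D f ->
  (forall x, D x -> (0 <= f x)%E) ->
  (\int[mu]_(x in D) f x =
   `|c|%:E * \int[mu]_(x in (fun x => (c * x + d)%R) @^-1` D) f (c * x + d)%R)%E.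
Proof.
move=> c0 mD mf f0.
pose phi : measurableTypeR R -> measurableTypeR R := fun x : R => c * x + d.
have [nu nuE] := pushforward_measure_affine c d.
pose k : {nonneg R} := NngNum (normr_ge0 c).
transitivity (\int[mscale k nu]_(x in D) f x)%E.
  apply: eq_measure_integral => A mA _.
  transitivity (`|c|%:E * nu A)%E; last by [].
  by rewrite nuE; exact: lebesgue_measure_affine.
rewrite ge0_integral_mscale//=; congr (_ * _)%E.
(* lets the pushforward by phi be recognized as a measure *)
pose mphi := measurable_affine c d.
transitivity (\int[pushforward mu phi]_(x in D) f x)%E.
  by apply: eq_measure_integral => A mA _; exact: (congr1 (@^~ A) nuE).
rewrite ge0_integral_pushforward//=.
by move=> y /set_mem; exact: f0.
Qed.

Lemma preimage_affine (c d a b : R) : c != 0 -> a <= b ->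
  (fun x => c * x + d) @^-1` (if 0 < c then `[c * a + d, c * b + d]
                              else `[c * b + d, c * a + d])%classic =
  `[a, b]%classic.
Proof.
move=> c0 ab; case: ifPn => [cP|]; last rewrite -leNgt le_eqVlt (negbTE c0)/= => cN.
  by apply/seteqP; split => x /=; rewrite ?/phi !in_itv/= !lerD2r !ler_pM2l.
by apply/seteqP; split => x /=; rewrite ?/phi !in_itv/= !lerD2r !ler_nM2l// andbC.
Qed.

Lemma locint_affine (c d : R) (f : R -> R) : c != 0 -> locint f ->
  locint (fun x => f (c * x + d)).
Proof.
move=> c0 lf a b.
have [ab|ba] := leP a b; last by rewrite set_itv_ge ?bnd_simp -?ltNge//; exact: integrable_set0.
have mf := locint_measurable lf.
apply/integrableP; split.
  apply/measurable_EFinP/measurable_funTS.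
  by apply: measurableT_comp => //; exact: measurable_affine.
rewrite -(preimage_affine d c0 ab).
set D := (X in _ @^-1` X).
have mD : measurable D by rewrite /D; case: ifP.
have iD : mu.-integrable D (EFin \o f) by rewrite /D; case: ifP => _; exact: lf.
have := @ge0_integral_affine c d D (fun x => `|(f x)%:E|%E) c0 mD _ _.
have [_ fin] := integrableP _ _ _ iD.
move=> h; move: fin; rewrite [X in (X < _)%E -> _]h//; last first.
  by apply/measurableT_comp => //; exact: measurable_int iD.
move=> fin; rewrite ltey; apply: contraTneq fin => ->.
by rewrite gt0_muley ?ltxx// lte_fin normr_gt0.
Qed.

(** The orientation absorbs the sign of c: for c < 0 the image interval is
    traversed backwards, which turns the Jacobian |c| into c. *)
Lemma oint_affine (c d : R) (f : R -> R) a b : c != 0 -> locint f ->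
  c * oint a b (fun x => f (c * x + d)) = oint (c * a + d) (c * b + d) f.
Proof.
move=> c0 lf.
suff H x y : x <= y ->
    c * oint x y (fun x => f (c * x + d)) = oint (c * x + d) (c * y + d) f.
  have [ab|/ltW ba] := leP a b; first exact: H.
  by rewrite oint_swap mulrN H// [RHS]oint_swap.
move=> xy.
rewrite (ointE _ xy) -(preimage_affine d c0 xy).
set D := (X in _ @^-1` X).
have mD : measurable D by rewrite /D; case: ifP.
have iD : mu.-integrable D (EFin \o f) by rewrite /D; case: ifP => _; exact: lf.
have iP : mu.-integrable ((fun x => c * x + d) @^-1` D)
    (EFin \o (fun x => f (c * x + d))).
  by rewrite (preimage_affine d c0 xy); exact: locint_affine.
have mf := measurable_int _ iD.
have key : \int[mu]_(x in D) f x =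
    `|c| * \int[mu]_(x in (fun x => c * x + d) @^-1` D) f (c * x + d).
  rewrite /Rintegral -[`|c|]/(fine `|c|%:E) -fineM//; last first.
    apply: integrable_fin_num => //.
    by rewrite (preimage_affine d c0 xy).
  congr fine; rewrite integralE.
  rewrite (@ge0_integral_affine c d D (fun x => (EFin \o f)^\+ x)%E)//; last exact: measurable_funepos.
  rewrite (@ge0_integral_affine c d D (fun x => (EFin \o f)^\- x)%E)//; last exact: measurable_funeneg.
  move: iP; set P := (_ @^-1` D).
  have mP : measurable P by rewrite /P (preimage_affine d c0 xy).
  pose g : R -> \bar R := fun x => (f (c * x + d))%:E.
  move=> iP.
  have -> : (\int[mu]_(x in P) ((EFin \o f)^\+ (c * x + d)%R) = \int[mu]_(x in P) (g^\+ x))%E.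
    by apply: eq_integral => z _; rewrite !funeposE.
  have -> : (\int[mu]_(x in P) ((EFin \o f)^\- (c * x + d)%R) = \int[mu]_(x in P) (g^\- x))%E.
    by apply: eq_integral => z _; rewrite !funenegE.
  rewrite -muleBr//; first by rewrite -integralE.
  apply: fin_num_adde_defl; rewrite fin_numN.
  exact: integrable_neg_fin_num iP.
move: key; rewrite /D; case: ifPn => [cP|nc] key.
  by rewrite [RHS]ointE ?lerD2r ?ler_pM2l// key gtr0_norm.
have cN : c < 0 by rewrite lt_neqAle c0 leNgt.
rewrite [RHS]oint_swap ointE ?lerD2r ?ler_nM2l// key (ltr0_norm cN).
by rewrite mulNr opprK.
Qed.

Lemma oint_opp (f : R -> R) (a b : R) : locint f ->
  oint a b (fun x => f (- x)) = oint (- b) (- a) f.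
Proof.
move=> lf; have n1 : (- 1 : R) != 0 by rewrite oppr_eq0.
have := @oint_affine (- 1) 0 f a b n1 lf.
rewrite !mulN1r !addr0 [in RHS]oint_swap => /eqP; rewrite eqr_opp => /eqP <-.
by apply: eq_oint => x _; rewrite mulN1r addr0.
Qed.

Lemma locint_opp (f : R -> R) : locint f -> locint (fun x => f (- x)).
Proof.
move=> lf; have n1 : (- 1 : R) != 0 by rewrite oppr_eq0.
by have := locint_affine 0 n1 lf; under eq_fun do rewrite mulN1r addr0.
Qed.

Lemma oint_fold (f : R -> R) (M : R) : locint f ->
  oint (- M) M f = oint 0 M (fun x => f x + f (- x)).
Proof.
move=> lf; have lfN := locint_opp lf.
rewrite (ointD _ _ lf lfN) oint_opp// oppr0 addrC.
by rewrite (oint_chasles (- M) 0 M lf).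
Qed.

End affine_substitution.

(** * Integrals with parameters and the chain rule for primitives *)

Local Opaque oriented_integral.

Section primitives.
Context {R : realType}.
Notation mu := (@lebesgue_measure R).
Notation oint := oriented_integral.

Lemma oint_continuous (a : R) (g : R -> R) : locint g ->
  continuous (fun x => oint a x g).
Proof.
move=> lg x0.
have lt1 : x0 - 1 < x0 + 1 by slra.
have c1 := @parameterized_integral_continuous R (x0 - 1) (x0 + 1) g (ltW lt1) (lg _ _).
have {}c1 : {for x0, continuous (fun x => parameterized_integral mu (x0 - 1) x g)}.
  have : {in `](x0 - 1), (x0 + 1)[%classic, continuous (fun x => parameterized_integral mu (x0 - 1) x g)}.
    rewrite -continuous_open_subspace; last exact: interval_open.
    by apply: continuous_subspaceW c1; exact: subset_itv_oo_cc.
  by apply; rewrite inE/= in_itv/=; apply/andP; split; slra.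
have c2 : {for x0, continuous (fun x => oint a (x0 - 1) g + parameterized_integral mu (x0 - 1) x g)}.
  by apply: cvgD => //; exact: cvg_cst.
rewrite /prop_for/continuous_at in c2 *.
have e x : x0 - 1 <= x -> oint a x g = oint a (x0 - 1) g + parameterized_integral mu (x0 - 1) x g.
  by move=> h; rewrite -(oint_chasles a (x0 - 1) x lg) (ointE _ h).
rewrite (e x0); last by slra.
apply: cvg_trans c2; apply: near_eq_cvg; near=> x; rewrite (e x)//.
by apply/ltW; near: x; apply: lt_nbhsr; slra.
Unshelve. all: by end_near. Qed.

Lemma norm_oint_le_sub (f : R -> R) a b c d : locint f ->
  c <= a <= d -> c <= b <= d -> `|oint a b f| <= oint c d (fun x => `|f x|).
Proof.
move=> lf /andP[ca ad] /andP[cb bd].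
have lnf := locint_norm lf.
have [ab|/ltW ba] := leP a b.
  by rewrite (le_trans (le_norm_oint lf ab))//; exact: le_oint_sub.
rewrite oint_swap normrN (le_trans (le_norm_oint lf ba))//; exact: le_oint_sub.
Qed.

Lemma le_eps_eq0 (D C : R) : 0 <= C -> (forall e, 0 < e -> `|D| <= e * C) -> D = 0.
Proof.
move=> C0 h; apply/eqP; rewrite -normr_eq0; apply: contraT => D0.
have D1 : 0 < `|D| by rewrite lt_neqAle eq_sym D0 normr_ge0.
have C1 : 0 < C + 1 by slra.
have := h (`|D| / (2 * (C + 1))) _.
rewrite divr_gt0//; last by slra.
move=> /(_ isT); rewrite mulrAC ler_pdivlMr; last by slra.
rewrite ler_pM2l//; slra.
Qed.

(** Two effects are estimated separately: the endpoints move the primitive of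
    the integrand with the parameter frozen, which is continuous, and the
    parameter moves k uniformly in x, which is integrated against |g|. *)
Lemma oint_param_continuous (U : topologicalType) (k : R * U -> R) (g : R -> R) :
  continuous k -> locint g ->
  continuous (fun z : R * R * U => oint z.1.1 z.1.2 (fun x => k (x, z.2) * g x)).
Proof.
move=> ck lg [[a0 b0] c0].
have ckc c : continuous (fun x => k (x, c)).
  by apply: (cont_comp ck); cont.
have lkg c : locint (fun x => k (x, c) * g x) by apply: locintMl.
pose lo := Num.min a0 b0 - 1; pose hi := Num.max a0 b0 + 1.
have loa : lo < a0 < hi.
  by rewrite /lo /hi; case: (leP a0 b0) => ?; apply/andP; split; slra.
have lob : lo < b0 < hi.
  by rewrite /lo /hi; case: (leP a0 b0) => ?; apply/andP; split; slra.
pose C := oint lo hi (fun x => `|g x|).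
have C0 : 0 <= C by apply: oint_ge0 => //; case/andP: loa => /ltW h1 /ltW h2; exact: le_trans h2.
pose H x := oint lo x (fun x => k (x, c0) * g x).
have cH : continuous H by exact: oint_continuous.
have HE a b : oint a b (fun x => k (x, c0) * g x) = H b - H a.
  by rewrite /H -(oint_chasles lo a b (lkg c0)); ring.
apply/cvgrPdist_lt => e e0.
have e30 : 0 < e / 3 by rewrite divr_gt0.
have eC : 0 < e / (3 * (C + 1)) by rewrite divr_gt0//; slra.
have cHa := cH a0; have cHb := cH b0.
have n1 : \forall a \near a0, lo < a < hi /\ `|H a0 - H a| < e / 3.
  near=> a; split; last by near: a; move/cvgrPdist_lt : cHa; exact.
  by apply/andP; split; near: a; [apply: lt_nbhsr|apply: lt_nbhsl]; case/andP: loa.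
have n2 : \forall b \near b0, lo < b < hi /\ `|H b0 - H b| < e / 3.
  near=> b; split; last by near: b; move/cvgrPdist_lt : cHb; exact.
  by apply/andP; split; near: b; [apply: lt_nbhsr|apply: lt_nbhsl]; case/andP: lob.
have n3 := @near_uniform_itv R U k lo hi _ c0 ck eC.
near=> z; rewrite /=.
have [/andP[/ltW z1l /ltW z1h] z1H] : lo < z.1.1 < hi /\ `|H a0 - H z.1.1| < e / 3.
  near: z; exists (([set a | lo < a < hi /\ `|H a0 - H a| < e / 3] `*` setT), setT) => /=; last by move=> [[a b] c] [[/= ? _] _].
  split; last exact: filterT.
  by exists ([set a | lo < a < hi /\ `|H a0 - H a| < e / 3], setT) => //=; split => //; exact: filterT.
have [/andP[/ltW z2l /ltW z2h] z2H] : lo < z.1.2 < hi /\ `|H b0 - H z.1.2| < e / 3.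
  near: z; exists ((setT `*` [set a | lo < a < hi /\ `|H b0 - H a| < e / 3]), setT) => /=; last by move=> [[a b] c] [[/= _ ?] _].
  split; last exact: filterT.
  by exists (setT, [set a | lo < a < hi /\ `|H b0 - H a| < e / 3]) => //=; split => //; exact: filterT.
have z3 : forall x, x \in `[lo, hi] -> `|k (x, z.2) - k (x, c0)| < e / (3 * (C + 1)).
  near: z; exists (setT, [set c | forall x, x \in `[lo, hi] -> `|k (x, c) - k (x, c0)| < e / (3 * (C + 1))]) => /=; last by move=> [[a b] c] [_ ].
  by split => //; exact: filterT.
have -> : oint a0 b0 (fun x => k (x, c0) * g x) - oint z.1.1 z.1.2 (fun x => k (x, z.2) * g x)
   = (H b0 - H z.1.2) - (H a0 - H z.1.1) -
     oint z.1.1 z.1.2 (fun x => k (x, z.2) * g x - k (x, c0) * g x).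
  by rewrite ointB// !HE; ring.
have lem : `|oint z.1.1 z.1.2 (fun x => k (x, z.2) * g x - k (x, c0) * g x)| <= e / (3 * (C + 1)) * C.
  rewrite (le_trans (@norm_oint_le_sub _ _ _ lo hi _ _ _))//; first exact: locintB.
  - by rewrite z1l.
  - by rewrite z2l.
  rewrite /C -ointZ; last exact: locint_norm.
  apply: le_oint; [by apply: locint_norm; exact: locintB|by apply: locintZ; exact: locint_norm|exact: le_trans z1h|].
  move=> x xlh; rewrite -mulrBl normrM ler_wpM2r//; apply/ltW/z3.
  by rewrite in_itv.
have : e / (3 * (C + 1)) * C <= e / 3.
  rewrite mulrAC ler_pdivrMr; last by slra.
  rewrite (_ : e / 3 * (3 * (C + 1)) = e * (C + 1)); last by field.
  by rewrite ler_pM2l//; slra.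
move=> lem2.
rewrite (le_lt_trans (ler_normB _ _))// (_ : e = e / 3 + e / 3 + e / 3); last by field.
rewrite ltr_leD//; last exact: le_trans lem2.
by rewrite (le_lt_trans (ler_normB _ _))// ltrD.
Unshelve. all: by end_near. Qed.

Lemma cont_ointM (T U : topologicalType) (a b : T -> R) (c : T -> U) (k : R * U -> R) (g : R -> R) :
  continuous a -> continuous b -> continuous c -> continuous k -> locint g ->
  continuous (fun t => oint (a t) (b t) (fun x => k (x, c t) * g x)).
Proof.
move=> ca cb cc ck lg.
apply: (@cont_comp _ _ _ (fun t => ((a t, b t), c t)) _ (oint_param_continuous ck lg)).
by cont.
Qed.

Lemma cont_oint (T U : topologicalType) (a b : T -> R) (c : T -> U) (k : R * U -> R) :
  continuous a -> continuous b -> continuous c -> continuous k ->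
  continuous (fun t => oint (a t) (b t) (fun x => k (x, c t))).
Proof.
move=> ca cb cc ck.
have := cont_ointM ca cb cc ck (locint_continuous (@cont_cst _ _ (1 : R))).
by under eq_fun do under eq_oint do rewrite mulr1.
Qed.

(** The primitive G of g is only absolutely continuous, so F o G need not be
    differentiable anywhere.  On a short interval [x, y] the mean value theorem
    for F and the intermediate value theorem for G give a point w of it with
    F(G y) - F(G x) = F'(G w) \int_x^y g, and uniform continuity of F' o G
    compares this with \int_x^y F'(G) g up to e \int_x^y |g|.  Over a fine
    subdivision these errors add up to e \int_a^b |g|.  The range [m, M] of G
    allows functions F with a singularity, such as the inverse. *)
Theorem oint_chain_rule (F F' g : R -> R) (a b c m M : R) :
  a <= b -> locint g -> continuous F' ->
  (forall x, a <= x <= b -> m <= c + oint a x g <= M) ->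
  (forall y, m <= y <= M -> is_derive y (1 : R) F (F' y)) ->
  oint a b (fun x => F' (c + oint a x g) * g x) = F (c + oint a b g) - F c.
Proof.
move=> ab lg cF' bnd dF.
pose G x := c + oint a x g.
have cG : continuous G.
  by move=> x; apply: cvgD; [exact: cvg_cst|exact: oint_continuous].
have cFG : continuous (F' \o G) by move=> x; apply: continuous_comp; [exact: cG|exact: cF'].
pose h x := F' (G x) * g x.
have lh : locint h by exact: locintMl.
pose C := oint a b (fun x => `|g x|).
have lng := locint_norm lg.
have C0 : 0 <= C by exact: oint_ge0.
suff : F (G b) - F (G a) - oint a b h = 0.
  by rewrite /G oint_refl addr0 => /eqP; rewrite subr_eq0 => /eqP ->.
apply: (le_eps_eq0 C0) => e e0.
have [d d0 dd] := @uniform_continuous_itv R (F' \o G) a b e (fun x _ => cFG x) e0.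
have local x y : a <= x -> x <= y -> y <= b -> y - x < d ->
    `|F (G y) - F (G x) - oint x y h| <= e * oint x y (fun x => `|g x|).
  move=> ax xy yb yx.
  have Gxy : G y - G x = oint x y g.
    by rewrite /G -(oint_chasles a x y lg); ring.
  have bx : m <= G x <= M by apply: bnd; slra.
  have bxy : m <= G y <= M by apply: bnd; rewrite yb andbT; exact: le_trans xy.
  have mvt p q : m <= p -> p <= q -> q <= M -> exists2 z, z \in `[p, q] & F q - F p = F' z * (q - p).
    move=> mp pq qM; apply: MVT_segment => //.
      by move=> z; rewrite in_itv/= => /andP[? ?]; apply: dF; apply/andP; split; slra.
    apply: derivable_within_continuous => z; rewrite in_itv/= => /andP[? ?].
    have : m <= z <= M by apply/andP; split; slra.
    by move=> /dF [].
  have [z zG zE] : exists2 z, Num.min (G x) (G y) <= z <= Num.max (G x) (G y) &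
      F (G y) - F (G x) = F' z * (G y - G x).
    case: (leP (G x) (G y)) => GG.
      have [z] := mvt _ _ (proj1 (andP bx)) GG (proj2 (andP bxy)).
      by rewrite in_itv/=; exists z.
    have [z] := mvt _ _ (proj1 (andP bxy)) (ltW GG) (proj2 (andP bx)).
    by rewrite in_itv/= => zz zE; exists z => //; rewrite -[LHS]opprB zE; ring.
  have [w wxy wE] := @IVT R G x y z xy (continuous_subspaceT cG) zG.
  rewrite zE -wE Gxy -ointZ// -ointB//; last exact: locintZ.
  rewrite (le_trans (le_norm_oint _ xy))//; first by apply: locintB => //; exact: locintZ.
  rewrite -ointZ//; apply: le_oint => //.
  - by apply: locint_norm; apply: locintB => //; exact: locintZ.
  - exact: locintZ.
  move=> t txy; rewrite /h -mulrBl normrM ler_wpM2r//; apply: ltW.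
  move: wxy; rewrite in_itv/= => /andP[xw wy]; case/andP: txy => xt ty.
  apply: dd; [by rewrite in_itv/= (le_trans ax xw) (le_trans wy yb)|by rewrite in_itv/= (le_trans ax xt) (le_trans ty yb)|].
  by move: xw wy xt ty yx; clear; rewrite ltr_norml => *; apply/andP; split; lra.
have [ab0|ab0] := leP (b - a) 0.
  have -> : b = a by apply/le_anti/andP; split; slra.
  by rewrite oint_refl !subrr normr0 mulr_ge0// ltW.
have [n nd] : exists n : nat, (b - a) / d < n%:R.
  by exists (Num.truncn ((b - a) / d)).+1; rewrite truncnS_gt.
have n0 : 0 < n%:R :> R by rewrite (lt_trans _ nd)// divr_gt0.
pose s : R := (b - a) / n%:R.
have s0 : 0 < s by rewrite divr_gt0.
have sd : s < d by rewrite ltr_pdivrMr// mulrC -ltr_pdivrMr.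
have sn : n%:R * s = b - a by rewrite mulrC divfK// gt_eqF.
have main i : (i <= n)%N -> `|F (G (a + i%:R * s)) - F (G a) - oint a (a + i%:R * s) h|
   <= e * oint a (a + i%:R * s) (fun x => `|g x|).
  elim: i => [_|i IH lin].
    by rewrite mul0r addr0 !oint_refl !subrr normr0 mulr0.
  have {IH} := IH (ltnW lin).
  set x := a + i%:R * s.
  have -> : a + i.+1%:R * s = x + s by rewrite /x -natr1; ring.
  have iis : i%:R * s + s <= n%:R * s.
    rewrite (_ : i%:R * s + s = (i%:R + 1) * s); last by ring.
    by rewrite ler_pM2r// natr1 ler_nat.
  have i0 : 0 <= i%:R * s by rewrite mulr_ge0// ltW.
  have := @local x (x + s) _ _ _ _.
  rewrite -(oint_chasles a x (x + s) lh) -(oint_chasles a x (x + s) lng).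
  move=> /(_ ltac:(rewrite /x; slra) ltac:(slra) ltac:(rewrite /x; slra) ltac:(slra)) l1 l2.
  rewrite mulrDr (_ : _ - _ - _ = (F (G x) - F (G a) - oint a x h) + (F (G (x + s)) - F (G x) - oint x (x + s) h)); last by ring.
  by rewrite (le_trans (ler_normD _ _))// lerD.
have := main n (leqnn n); rewrite sn (_ : a + (b - a) = b)//; ring.
Qed.

End primitives.

(** * Fubini's theorem for iterated oriented integrals *)

Section fubini_boxes.
Context {R : realType}.
Notation mu := (@lebesgue_measure R).
Notation oint := oriented_integral.

(** Functions on the plane whose two iterated integrals over every box exist and
    agree.  The last field is what Tonelli's theorem turns into integrability on
    the box; a dominating B is easier to produce than the integrability of the
    inner integral itself, and is stable under sums and comparison. *)
Record locint2 (F : R -> R -> R) : Prop := Locint2 {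
  locint2_measurable : measurable_fun setT (fun z : R * R => F z.1 z.2) ;
  locint2_l : forall x, locint (F x) ;
  locint2_r : forall y, locint (F^~ y) ;
  locint2_bound : forall a b c d, a <= b -> c <= d -> exists2 B, locint B &
    forall x, a <= x <= b -> oint c d (fun y => `|F x y|) <= B x
}.

Let restr (F : R -> R -> R) a b c d : R * R -> \bar R :=
  (fun z : R * R => (F z.1 z.2)%:E) \_ (`[a, b] `*` `[c, d]).

Let restr_measurable F a b c d : locint2 F -> measurable_fun setT (restr F a b c d).
Proof.
move=> lF; apply: (iffLR (measurable_restrictT _ _)).
  by apply: measurableX; exact: measurable_itv.
apply: measurable_funTS.
by apply: (iffRL (measurable_EFinP _ _)); exact: (locint2_measurable lF).
Qed.

Let restrE F a b c d x y : restr F a b c d (x, y) =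
  ((fun y => ((fun x => (F x y)%:E) \_ `[a, b]) x) \_ `[c, d]) y.
Proof.
rewrite /restr /patch in_setX/=.
by case: (x \in `[a, b]%classic); case: (y \in `[c, d]%classic).
Qed.

Let restrE' F a b c d x y : restr F a b c d (x, y) =
  ((fun x => ((fun y => (F x y)%:E) \_ `[c, d]) y) \_ `[a, b]) x.
Proof.
rewrite /restr /patch in_setX/=.
by case: (x \in `[a, b]%classic); case: (y \in `[c, d]%classic).
Qed.

Lemma EFin_oint (f : R -> R) a b : locint f -> a <= b ->
  (oint a b f)%:E = (\int[mu]_(x in `[a, b]) (f x)%:E)%E.
Proof.
by move=> lf ab; rewrite ointE// /Rintegral fineK//; exact: integrable_fin_num.
Qed.

Let int_y F a b c d x : locint2 F -> c <= d ->
  (\int[mu]_y restr F a b c d (x, y))%E =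
  (((fun x => (oint c d (F x))%:E) \_ `[a, b]) x).
Proof.
move=> lF cd; under eq_integral do rewrite restrE'.
rewrite /patch; case: ifPn => _; last by rewrite integral0.
rewrite EFin_oint//; last exact: locint2_l.
by rewrite [RHS]integral_mkcond.
Qed.

Let int_x F a b c d y : locint2 F -> a <= b ->
  (\int[mu]_x restr F a b c d (x, y))%E =
  (((fun y => (oint a b (F^~ y))%:E) \_ `[c, d]) y).
Proof.
move=> lF cd; under eq_integral do rewrite restrE.
rewrite /patch; case: ifPn => _; last by rewrite integral0.
rewrite EFin_oint//; last exact: locint2_r.
by rewrite [RHS]integral_mkcond.
Qed.

Lemma locint2_norm F : locint2 F -> locint2 (fun x y => `|F x y|).
Proof.
move=> [m l r B]; split.
- exact: measurableT_comp.
- by move=> x; exact: locint_norm.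
- by move=> y; exact: (locint_norm (r y)).
- move=> a b c d ab cd; have [b1 lb h] := B a b c d ab cd.
  by exists b1 => // x xab; under eq_oint do rewrite normr_id; exact: h.
Qed.

Let restr_integrable F a b c d : locint2 F -> a <= b -> c <= d ->
  (mu \x mu)%E.-integrable setT (restr F a b c d).
Proof.
move=> lF ab cd.
apply/integrable12ltyP; first exact: restr_measurable.
have [B lB FB] := locint2_bound lF ab cd.
apply: (@le_lt_trans _ _ (\int[mu]_(x in `[a, b]) (B x)%:E)%E); last first.
  by rewrite -EFin_oint// ltry.
rewrite [X in (_ <= X)%E]integral_mkcond.
have m0 : measurable_fun setT (fun z => `|restr F a b c d z|%E).
  exact: (measurableT_comp (@abse_measurable R setT) (restr_measurable a b c d lF)).
have mr := @measurable_fun_fubini_tonelli_F _ _ _ _ _ mu _ m0 (fun z => abse_ge0 _).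
apply: ge0_le_integral => //=.
- by move=> x _; exact: integral_ge0.
- apply: (iffLR (measurable_restrictT _ _)) => //; apply: measurable_funTS; apply: (iffRL (measurable_EFinP _ _)).
  exact: locint_measurable.
- move=> x _; rewrite (_ : (fun y => `|restr F a b c d (x, y)|%E) =
     (fun y => restr (fun x y => `|F x y|) a b c d (x, y))); last first.
    apply/funext => y; rewrite !restrE' /patch.
    by case: (x \in `[a, b]%classic); case: (y \in `[c, d]%classic); rewrite ?abse0.
  rewrite int_y//; last exact: locint2_norm.
  rewrite /patch; case: ifPn => // /set_mem/=; rewrite in_itv/= => xab.
  by rewrite lee_fin; exact: FB.
Qed.

Theorem oint_fubini F a b c d : locint2 F -> a <= b -> c <= d ->
  oint a b (fun x => oint c d (F x)) = oint c d (fun y => oint a b (F^~ y)).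
Proof.
move=> lF ab cd; have := Fubini (restr_integrable lF ab cd).
under eq_integral do rewrite int_y//.
under [X in _ = X -> _]eq_integral do rewrite int_x//.
rewrite -!integral_mkcond => h.
by rewrite (ointE _ ab) (ointE _ cd) /Rintegral h.
Qed.

Lemma locint_oint F c d : locint2 F -> c <= d -> locint (fun x => oint c d (F x)).
Proof.
move=> lF cd a b.
have [ab|ba] := leP a b; last by rewrite set_itv_ge ?bnd_simp -?ltNge//; exact: integrable_set0.
have := integrable_fubini_F (restr_integrable lF ab cd).
rewrite /fubini_F; under eq_fun do rewrite int_y//.
by move=> h; apply/integrable_mkcond.
Qed.

Lemma locint2_swap F a b c d : locint2 F -> a <= b -> c <= d ->
  mu.-integrable `[c, d] (EFin \o (fun y => oint a b (F^~ y))).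
Proof.
move=> lF ab cd.
have ri := restr_integrable lF ab cd.
have mri := restr_measurable a b c d lF.
have m0 : measurable_fun setT (fun z => `|restr F a b c d z|%E).
  exact: (measurableT_comp (@abse_measurable R setT) mri).
have mr := @measurable_fun_fubini_tonelli_G _ _ _ _ _ mu _ m0 (fun z => abse_ge0 _).
have mG := measurable_fubini_G ri.
have : mu.-integrable setT (fubini_G mu (restr F a b c d)).
  apply/integrableP; split => //.
  apply: le_lt_trans (iffLR (integrable21ltyP mu mu mri) ri).
  apply: ge0_le_integral => //=.
  - exact: (measurableT_comp (@abse_measurable R setT) mG).
  - move=> y _; rewrite /fubini_G; apply: le_abse_integral => //.
    exact: (measurable_fun_pair1 y mri).
rewrite /fubini_G; under eq_fun do rewrite int_x//.
by move=> h; apply/integrable_mkcond.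
Qed.

Lemma locint_oint' F a b : locint2 F -> a <= b -> locint (fun y => oint a b (F^~ y)).
Proof.
move=> lF ab c d.
have [cd|dc] := leP c d; last by rewrite set_itv_ge ?bnd_simp -?ltNge//; exact: integrable_set0.
exact: locint2_swap.
Qed.

Lemma locint2D F G : locint2 F -> locint2 G -> locint2 (fun x y => F x y + G x y).
Proof.
move=> lF lG; split.
- by apply: measurable_funD; exact: locint2_measurable.
- by move=> x; apply: locintD; exact: locint2_l.
- by move=> y; apply: (locintD (locint2_r lF y) (locint2_r lG y)).
- move=> a b c d ab cd.
  have [B lB FB] := locint2_bound lF ab cd.
  have [B' lB' GB] := locint2_bound lG ab cd.
  exists (fun x => B x + B' x); first exact: locintD.
  move=> x xab; apply: (le_trans _ (lerD (FB x xab) (GB x xab))).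
  have lFx := locint2_l lF x; have lGx := locint2_l lG x.
  rewrite -ointD; [|exact: locint_norm..].
  apply: le_oint => //.
  + by apply: locint_norm; exact: locintD.
  + by apply: locintD; exact: locint_norm.
  + by move=> y _; exact: ler_normD.
Qed.

Lemma locint2_le (F G : R -> R -> R) : measurable_fun setT (fun z : R * R => F z.1 z.2) ->
  locint2 G -> (forall x y, `|F x y| <= `|G x y|) -> locint2 F.
Proof.
move=> mF lG FG.
have l x : locint (F x).
  apply: (@locint_le _ _ (fun y => `|G x y|)) => //; last exact/locint_norm/locint2_l.
  exact: (measurable_fun_pair2 x mF).
split => //.
- move=> y; apply: (@locint_le _ _ (fun x => `|G x y|)) => //.
    exact: (measurable_fun_pair1 y mF).
  exact: (locint_norm (locint2_r lG y)).
- move=> a b c d ab cd; have [B lB GB] := locint2_bound lG ab cd.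
  exists B => // x xab; apply: le_trans (GB x xab).
  by apply: le_oint => //; [exact: locint_norm|exact/locint_norm/locint2_l].
Qed.

Lemma locint2Z (k : R) (F : R -> R -> R) : locint2 F -> locint2 (fun x y => k * F x y).
Proof.
move=> lF; split.
- by apply: measurable_funM => //; exact: locint2_measurable.
- by move=> x; apply: locintZ; exact: locint2_l.
- by move=> y; apply: (locintZ _ (locint2_r lF y)).
- move=> a b c d ab cd.
  have [B lB FB] := locint2_bound lF ab cd.
  exists (fun x => `|k| * B x); first exact: locintZ.
  move=> x xab; rewrite (eq_oint (g := fun y => `|k| * `|F x y|)); last first.
    by move=> y _; rewrite normrM.
  by rewrite ointZ ?ler_wpM2l ?FB//; exact/locint_norm/locint2_l.
Qed.

Lemma locint2_contMl (k : R * R -> R) (g : R -> R) : continuous k -> locint g ->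
  locint2 (fun x y => g x * k (x, y)).
Proof.
move=> ck lg.
have ckx x : continuous (fun y => k (x, y)) by apply: (cont_comp ck); cont.
have cky y : continuous (fun x => k (x, y)) by apply: (cont_comp ck); cont.
split.
- apply: measurable_funM.
    by apply: measurableT_comp => //; exact: locint_measurable.
  rewrite (_ : (fun x => _) = k); last by apply/funext => -[].
  exact: continuous_measurable_fun2.
- by move=> x; apply: locintZ; exact: locint_continuous.
- by move=> y; under eq_fun do rewrite mulrC; exact: locintMl.
- move=> a b c d ab cd.
  exists (fun x => oint c d (fun y => `|k (x, y)|) * `|g x|).
    apply: locintMl; last exact: locint_norm.
    have c1 : continuous (fun z : R * R => `|k (z.2, z.1)|).
      by apply: cont_norm; apply: (cont_comp ck); cont.
    by apply: (@cont_oint _ _ _ (fun=> c) (fun=> d) id (fun z => `|k (z.2, z.1)|)) => //; cont.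
  move=> x _; rewrite mulrC -ointZ//; last exact/locint_norm/locint_continuous.
  by apply: le_oint => //; [apply: locint_norm; apply: locintZ; exact: locint_continuous|apply: locintZ; apply/locint_norm/locint_continuous|move=> y _; rewrite normrM].
Qed.

Lemma locint2_cont (k : R * R -> R) : continuous k -> locint2 (fun x y => k (x, y)).
Proof.
move=> ck; have := @locint2_contMl k (fun=> 1) ck (locint_continuous (@cont_cst _ _ _)).
by under eq_fun do (under eq_fun do rewrite mul1r).
Qed.

(** Values of a rough function g read along lines of slope -2: the integral in y
    is half the integral of |g| over an interval that remains in a fixed one
    while x ranges over [a, b]. *)
Lemma locint2_affine (g : R -> R) (m q : R) : locint g -> m != 0 ->
  locint2 (fun x y => g (- 2 * y + (m * x + q))).
Proof.
move=> lg m0; pose k x := m * x + q.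
have ck : continuous k by rewrite /k; cont.
have n2 : (- 2 : R) != 0 by rewrite oppr_eq0.
have cm : continuous (fun z : R * R => - 2 * z.2 + k z.1).
  by apply: contD; [cont|apply: (cont_comp ck); cont].
split.
- apply: (@measurableT_comp _ _ _ _ _ _ g); first exact: locint_measurable.
  exact: continuous_measurable_fun2.
- by move=> x; exact: (locint_affine (k x) n2 lg).
- move=> y; have := locint_affine (- 2 * y + q) m0 lg.
  by under eq_fun do rewrite addrCA.
move=> a b c d ab cd.
have [M M0 kM] := @bounded_continuous_itv R k a b (fun x _ => ck x).
pose B := 2^-1 * oint (- 2 * d - M) (- 2 * c + M) (fun x => `|g x|).
exists (fun=> B); first by apply: locint_continuous; exact: cont_cst.
move=> x xab; have := kM x; rewrite in_itv => /(_ xab); rewrite ler_norml => /andP[k1 k2].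
have lng := locint_norm lg.
have := oint_affine (k x) c d n2 lng; rewrite [RHS]oint_swap => e.
have -> : oint c d (fun y => `|g (- 2 * y + k x)|) =
    2^-1 * oint (- 2 * d + k x) (- 2 * c + k x) (fun x => `|g x|).
  rewrite -[X in 2^-1 * X]opprK -e mulNr opprK mulrA mulVf ?mul1r//.
have dc : - 2 * d <= - 2 * c by rewrite !mulNr lerN2 ler_pM2l.
rewrite /B ler_pM2l ?invr_gt0//; apply: le_oint_sub => //; by rewrite ?lerD2r ?lerD2l.
Qed.

End fubini_boxes.

(** * The power nonlinearity and its potential *)

Section power_nonlinearity.
Context {R : realType}.

Lemma continuous_norm_powR (q : R) : 0 < q -> continuous (fun y : R => `|y| `^ q).
Proof.
move=> q0 y; have [->|y0] := eqVneq y 0.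
  apply/cvgrPdist_lt => e e0; rewrite normr0 powR0 ?gt_eqF//.
  have e20 : 0 < e / 2 by rewrite divr_gt0.
  have d0 : 0 < (e / 2) `^ q^-1 by rewrite powR_gt0.
  apply/nbhs_ballP; exists ((e / 2) `^ q^-1) => //= h.
  rewrite /ball/= !sub0r !normrN (ger0_norm (powR_ge0 _ _)) => he.
  have : `|h| `^ q <= ((e / 2) `^ q^-1) `^ q.
    by apply: ge0_ler_powR; rewrite ?nnegrE ?powR_ge0// ltW.
  rewrite -powRrM mulVf ?gt_eqF// powRr1 ?(ltW e20)// => /le_lt_trans; apply; lra.
apply: (@continuous_comp _ _ _ (fun y : R => `|y|) (fun y => y `^ q)).
  exact: norm_continuous.
apply: differentiable_continuous; apply/derivable1_diffP; apply: derivable_powR.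
by rewrite in_itv/= andbT normr_gt0.
Unshelve. all: by end_near. Qed.

(** At 0 the difference quotient is |y|^q, so Caratheodory's criterion applies;
    elsewhere the function is plus or minus a power of |y|. *)
Lemma is_derive_norm_powRM (q y : R) : 0 < q ->
  is_derive y (1 : R) (fun y => `|y| `^ q * y) ((q + 1) * `|y| `^ q).
Proof.
move=> q0.
have pos (x : R) : 0 < x -> is_derive x (1 : R) (fun y => y `^ (q + 1)) ((q + 1) * x `^ q).
  move=> x0; have xi : x \in `]0, +oo[ by rewrite in_itv/= x0.
  have := powR_derive1 (q + 1) xi; rewrite derive1E addrK => <-.
  by apply: derivableP; exact: derivable_powR.
have [->|] := eqVneq y 0.
  apply/is_derive1_caratheodory; exists (fun z => `|z| `^ q); split.
  - by move=> z; rewrite mulr0 !subr0.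
  - exact: continuous_norm_powR.
  - by rewrite normr0 powR0 ?mulr0// gt_eqF.
rewrite neq_lt => /orP[y0|y0].
  have ny0 : 0 < - y by rewrite oppr_gt0.
  have h1 : is_derive y (1:R) (fun z : R => - ((- z) `^ (q + 1))) ((q + 1) * `|y| `^ q).
    rewrite (ltr0_norm y0).
    have h : is_derive (- y) (1 : R) (fun y => y `^ (q + 1)) ((q + 1) * (- y) `^ q) by exact: pos.
    have hN : is_derive y (1:R) (fun z : R => - z) (-1) by exact: is_deriveN.
    apply: is_derive_eq; first (apply: is_deriveN; exact: (@is_derive1_comp R (fun y => y `^ (q + 1)) -%R y _ _ h hN)).
    by rewrite /GRing.scale/=; ring.
  apply: near_eq_is_derive h1; near=> z.
  have z0 : z < 0 by near: z; exact: lt_nbhsl.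
  rewrite (ltr0_norm z0) powRD; last by rewrite oppr_eq0 (lt_eqF z0) implybT.
  by rewrite powRr1 ?oppr_ge0 ?ltW//; ring.
rewrite gtr0_norm//; apply: near_eq_is_derive (pos _ y0); near=> z.
have z0 : 0 < z by near: z; exact: lt_nbhsr.
rewrite (gtr0_norm z0) powRD; last by rewrite (gt_eqF z0) implybT.
by rewrite powRr1// ltW.
Unshelve. all: by end_near. Qed.

Variable p : R.
Hypothesis p1 : 1 < p.
Let p10 : 0 < p - 1. Proof. by rewrite subr_gt0. Qed.
Let pp0 : 0 < p + 1. Proof. by have := p1; lra. Qed.

Lemma nonlinearity_mulE y : y * nonlinearity p y = `|y| `^ (p + 1).
Proof.
rewrite /nonlinearity mulrC -mulrA -expr2 -real_normK ?num_real//.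
have [->|y0] := eqVneq y 0.
  by rewrite normr0 expr0n/= mulr0 powR0// gt_eqF.
rewrite -powR_mulrn// -powRD; first by congr (_ `^ _); ring.
by rewrite normr_eq0 y0 implybT.
Qed.

Lemma nonlinearity0 : nonlinearity p 0 = 0 :> R.
Proof. by rewrite /nonlinearity mulr0. Qed.

Lemma continuous_nonlinearity : continuous (nonlinearity p : R -> R).
Proof.
rewrite /nonlinearity; apply: contM; last exact: cont_id.
exact: continuous_norm_powR.
Qed.

Lemma is_derive_potential y :
  is_derive y (1 : R) (fun y : R => (p + 1)^-1 * `|y| `^ (p + 1)) (nonlinearity p y).
Proof.
under eq_fun do rewrite -nonlinearity_mulE mulrC.
have h := @is_derive_norm_powRM (p - 1) y p10.
apply: is_derive_eq.
rewrite /GRing.scale/= /nonlinearity.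
set a := `|y| `^ _; field.
by rewrite gt_eqF.
Qed.

Lemma nonlinearity_lipschitz (M a b : R) : `|a| <= M -> `|b| <= M ->
  `|nonlinearity p a - nonlinearity p b| <= p * M `^ (p - 1) * `|a - b|.
Proof.
wlog ab : a b / b <= a.
  move=> H aM bM; have [|/ltW] := leP b a; first by move=> h; exact: H.
  by move=> h; rewrite distrC (distrC a); exact: H.
move=> aM bM.
have [c cab ->] := @MVT_segment R (nonlinearity p) (fun y => (p - 1 + 1) * `|y| `^ (p - 1)) b a ab
   (fun x _ => is_derive_norm_powRM x p10) (continuous_subspaceT continuous_nonlinearity).
rewrite normrM ler_wpM2r// subrK normrM ger0_norm; last by have := p1; lra.
rewrite ler_wpM2l//; first by have := p1; lra.
rewrite ger0_norm ?powR_ge0//; apply: ge0_ler_powR; [exact: ltW| | |].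
- by rewrite nnegrE.
- by rewrite nnegrE (le_trans _ aM).
move: cab; rewrite in_itv/= => /andP[bc ca].
by move: aM bM; rewrite !ler_norml => /andP[? ?] /andP[? ?]; apply/andP; split; lra.
Qed.

End power_nonlinearity.

(** * Weak derivatives of continuous functions *)

Section weak_derivatives.
Context {R : realType}.
Notation mu := (@lebesgue_measure R).
Notation oint := oriented_integral.

Lemma is_derive_oint (f : R -> R) (a x : R) : continuous f ->
  is_derive x (1 : R) (fun y => oint a y f) (f x).
Proof.
move=> cf; have lf := locint_continuous cf.
have h1 : x - 1 < x by lra.
have h2 : x < x + 1 by lra.
have [d e] := continuous_FTC1_closed h2 (lf (x - 1) (x + 1)) h1 (cf x).
have h : is_derive x (1 : R) (fun y => oint a (x - 1) f + \int[mu]_(t in `[x - 1, y]) f t) (f x).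
  apply: is_derive_eq; last exact: add0r.
  apply: is_deriveD; rewrite -e derive1E; exact: derivableP.
apply: near_eq_is_derive h; near=> y.
by rewrite -ointE ?oint_chasles//; apply: ltW; near: y; exact: lt_nbhsr.
Unshelve. all: by end_near. Qed.

Lemma oint_derive (F f : R -> R) (a b : R) : a <= b -> continuous f ->
  (forall x, a <= x <= b -> is_derive x (1 : R) F (f x)) ->
  oint a b f = F b - F a.
Proof.
move=> ab cf dF.
have lid := locint_continuous (@cont_cst _ _ (1 : R)).
have e x : a + oint a x (fun=> 1) = x by rewrite oint_cst; ring.
have := @oint_chain_rule R F f (fun=> 1) a b a a b ab lid cf _ dF.
rewrite e => <-; last by move=> x; rewrite e.
by apply: eq_oint => x _; rewrite e mulr1.
Qed.

Lemma Rintegral_oint (f : R -> R) a b : a <= b ->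
  (forall x, (x < a) || (b < x) -> f x = 0) -> \int[mu]_x f x = oint a b f.
Proof.
move=> ab f0; rewrite ointE// [RHS]Rintegral_mkcond; apply: eq_Rintegral => x _.
rewrite /patch; case: ifPn => //; rewrite notin_setE/= in_itv/= => /negP.
by rewrite negb_and -!ltNge; exact: f0.
Qed.

Lemma oint_eq0 (f : R -> R) a b :
  (forall x, Num.min a b <= x <= Num.max a b -> f x = 0) -> oint a b f = 0.
Proof. by move=> f0; rewrite (eq_oint f0) oint0. Qed.

(** A continuous bump of width d and mass 1, and its primitive, give the test
    functions that approximate indicators of intervals. *)
Section bump.
Variable d : R.
Hypothesis d0 : 0 < d.

(* the tent 2 max(d - |x|, 0) *)
Let raw (x : R) := (d - `|x|) + `|d - `|x| |.
Let c_raw : continuous raw. Proof. by rewrite /raw; cont. Qed.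
Let raw_ge0 x : 0 <= raw x.
Proof. by rewrite /raw; have := ler_norm (- (d - `|x|)); rewrite normrN; lra. Qed.
Let raw_out x : d <= `|x| -> raw x = 0.
Proof. by move=> h; rewrite /raw (@ler0_norm _ (d - _)) ?subr_le0//; ring. Qed.
Let mass := oint (- d) d raw.
Let mass_gt0 : 0 < mass.
Proof.
have l1 := locint_continuous c_raw.
have d2 : 0 < d / 2 by rewrite divr_gt0.
have h : oint (- (d / 2)) (d / 2) (fun=> d) <= mass.
  apply: (@le_trans _ _ (oint (- (d / 2)) (d / 2) raw)).
    apply: le_oint => //; first exact: (locint_continuous (@cont_cst _ _ _)).
      by lra.
    move=> x; rewrite -ler_norml /raw => xd; rewrite (@ger0_norm _ (d - _)); lra.
  by apply: le_oint_sub => //; lra.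
by rewrite (lt_le_trans _ h)// oint_cst mulr_gt0//; lra.
Qed.

Definition bump x := raw x / mass.

Lemma bump_continuous : continuous bump.
Proof. by rewrite /bump; cont. Qed.

Lemma bump_ge0 x : 0 <= bump x.
Proof. by rewrite divr_ge0// ltW. Qed.

Lemma bump_out x : d <= `|x| -> bump x = 0.
Proof. by move=> h; rewrite /bump raw_out// mul0r. Qed.

Lemma bump_mass : oint (- d) d bump = 1.
Proof.
rewrite /bump; under eq_oint do rewrite mulrC.
rewrite ointZ; last exact: locint_continuous.
by rewrite mulVf// gt_eqF.
Qed.

Definition step x := oint (- d) x bump.

Let l_bump : locint bump := locint_continuous bump_continuous.

Lemma step_derive x : is_derive x (1 : R) step (bump x).
Proof. exact: is_derive_oint bump_continuous. Qed.

Lemma step_left x : x <= - d -> step x = 0.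
Proof.
move=> xd; apply: oint_eq0 => y /andP[_]; rewrite max_l// => yd.
by have := d0 => ?; apply: bump_out; rewrite ler0_norm; lra.
Qed.

Lemma step_right x : d <= x -> step x = 1.
Proof.
move=> xd; rewrite /step -(oint_chasles (- d) d x l_bump) bump_mass.
rewrite (@oint_eq0 _ d x) ?addr0// => y; rewrite min_l// max_r// => /andP[dy _].
by have := d0 => ?; apply: bump_out; rewrite ger0_norm; lra.
Qed.

Lemma step_ge0_le1 x : 0 <= step x <= 1.
Proof.
have [h|h] := leP x (- d); first by rewrite step_left// lexx ler01.
have [h'|h'] := leP d x; first by rewrite step_right// lexx ler01.
rewrite /step oint_ge0 ?(ltW h)//=; last by move=> y _; exact: bump_ge0.
by rewrite -bump_mass; apply: le_oint_sub => //; [exact: bump_ge0|exact: ltW|exact: ltW].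
Qed.

Lemma bump_average (f : R -> R) (a w : R) : continuous f ->
  (forall x, `|x - a| <= d -> `|f x - f a| <= w) ->
  `|oint (a - d) (a + d) (fun x => f x * bump (x - a)) - f a| <= w.
Proof.
move=> cf fw.
have cba : continuous (fun x => bump (x - a)).
  by apply: (cont_comp bump_continuous); cont.
have m1 : oint (a - d) (a + d) (fun x => bump (x - a)) = 1.
  have := @oint_affine R 1 (- a) bump (a - d) (a + d) (oner_neq0 _) l_bump.
  rewrite !mul1r (_ : a - d - a = - d)//; last by ring.
  rewrite (_ : a + d - a = d)//; last by ring.
  by rewrite bump_mass => <-; apply: eq_oint => x _; rewrite mul1r.
have l2 := locint_continuous cba.
have l3 : locint (fun x => f x * bump (x - a)) by apply: locintMl.
have -> : f a = oint (a - d) (a + d) (fun x => f a * bump (x - a)).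
  by rewrite ointZ// m1 mulr1.
have l4 : locint (fun x => f a * bump (x - a)) by exact: locintZ.
have add : a - d <= a + d by have := d0; lra.
rewrite -ointB//; apply: (le_trans (le_norm_oint _ add)); first exact: locintB.
rewrite -[leRHS]mulr1 -m1 -ointZ//; apply: le_oint.
- by apply: locint_norm; exact: locintB.
- exact: locintZ.
- exact: add.
- move=> x /andP[h1 h2]; rewrite -mulrBl normrM (ger0_norm (bump_ge0 _)).
  rewrite ler_wpM2r ?bump_ge0// fw// ler_norml; lra.
Qed.

Lemma is_derive_stepB (a b x : R) :
  is_derive x (1 : R) (fun x => step (x - a) - step (x - b)) (bump (x - a) - bump (x - b)).
Proof.
have h c : is_derive x (1 : R) (fun x => step (x - c)) (bump (x - c)).
  have h1 : is_derive x (1 : R) (fun x => x - c) 1.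
    by apply: is_derive_eq; rewrite subr0.
  have := @is_derive1_comp R step (fun x => x - c) x _ _ (step_derive (x - c)) h1.
  by rewrite mulr1.
exact: is_deriveB.
Qed.

Lemma derive1_stepB (a b : R) :
  derive1 (fun x => step (x - a) - step (x - b)) = fun x => bump (x - a) - bump (x - b).
Proof.
by apply/funext => x; rewrite derive1E; have [] := is_derive_stepB a b x.
Qed.

Lemma test_function_stepB (a b : R) : a <= b ->
  test_function (fun x => step (x - a) - step (x - b)).
Proof.
move=> ab; split.
- by move=> x; have [] := is_derive_stepB a b x.
- rewrite derive1_stepB.
  by apply: contD; [|apply: contN]; apply: (cont_comp bump_continuous); cont.
- exists `[a - d, b + d]%classic; first exact: segment_compact.
  move=> x; rewrite /= in_itv/= => /negP; rewrite negb_and -!ltNge => /orP[h|h].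
    by rewrite !step_left ?subrr//; lra.
  by rewrite !step_right ?subrr//; lra.
Qed.

End bump.

(** Test against a smoothed indicator of [a, b] with transition layers of width
    d.  Its derivative is a bump at a minus a bump at b, so one side of the weak
    formulation tends to f a - f b and the other to - \int_a^b g. *)
Theorem weak_derivative_oint (f g : R -> R) a b : continuous f -> locint g ->
  weak_derivative f g -> a <= b -> f b - f a = oint a b g.
Proof.
move=> cf lg fg ab.
(* four transition-layer integrals of g cost e each, and the two averages of f
   cost e / 2 each *)
apply/eqP; rewrite -subr_eq0; apply/eqP; apply: (@le_eps_eq0 R _ 5) => // e e0.
have lng := locint_norm lg.
have near0 (G : R -> R) : continuous G -> forall x, \forall d \near (0 : R)^'+,
    forall y, `|y - x| <= d -> `|G y - G x| <= e / 2.
  move=> cG x.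
  have e20 : 0 < e / 2 by rewrite divr_gt0.
  have /cvgr_dist_lt/(_ _ e20)/nbhs_ballP[r /= r0 rG] := cG x.
  near=> d => y yx; apply: ltW; rewrite distrC; apply: rG; rewrite /ball/= distrC.
  by rewrite (le_lt_trans yx)//; near: d; exact: nbhs_right_lt.
have cI : continuous (fun x => oint a x (fun y => `|g y|)) by exact: oint_continuous.
have [d [d0 [fa fb ga gb]]] : exists d : R, 0 < d /\ [/\
    forall y, `|y - a| <= d -> `|f y - f a| <= e / 2,
    forall y, `|y - b| <= d -> `|f y - f b| <= e / 2,
    forall y, `|y - a| <= d -> `|oint a y (fun y => `|g y|) - oint a a (fun y => `|g y|)| <= e / 2 &
    forall y, `|y - b| <= d -> `|oint a y (fun y => `|g y|) - oint a b (fun y => `|g y|)| <= e / 2].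
  near (0 : R)^'+ => d; exists d; split.
    by near: d; exact: nbhs_right_gt.
  by split; near: d; exact: near0.
have tf := test_function_stepB d0 ab.
have := fg _ tf; rewrite derive1_stepB.
set phi := (fun x => step d (x - a) - step d (x - b)).
have abd : a - d <= b + d by lra.
have bc : forall c, continuous (fun x => bump d (x - c)).
  by move=> c; apply: (cont_comp (@bump_continuous d)); cont.
have lfb c : locint (fun x => f x * bump d (x - c)).
  by apply: locintMl => //; exact: locint_continuous.
have cphi : continuous phi.
  have cs : continuous (step d) by apply: oint_continuous; exact: locint_continuous (@bump_continuous d).
  by apply: contD; [|apply: contN]; apply: (cont_comp cs); cont.
have lgp : locint (fun x => g x * phi x).
  by under eq_fun do rewrite mulrC; exact: locintMl.
have loc c : a - d <= c - d -> c + d <= b + d ->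
    oint (a - d) (b + d) (fun x => f x * bump d (x - c)) = oint (c - d) (c + d) (fun x => f x * bump d (x - c)).
  move=> h1 h2.
  rewrite -(oint_chasles (a - d) (c - d) (b + d) (lfb c)) -(oint_chasles (c - d) (c + d) (b + d) (lfb c)).
  rewrite (@oint_eq0 _ (a - d)) ?(@oint_eq0 _ (c + d)) ?add0r ?addr0//.
    by move=> x; rewrite min_l// => /andP[? _]; rewrite bump_out ?mulr0//; rewrite ger0_norm; lra.
  by move=> x; rewrite max_r// => /andP[_ ?]; rewrite bump_out ?mulr0//; rewrite ler0_norm; lra.
rewrite (@Rintegral_oint _ (a - d) (b + d))//; last first.
  move=> x /orP[h|h].
    by rewrite !bump_out ?subrr ?mulr0//; rewrite ler0_norm; lra.
  by rewrite !bump_out ?subrr ?mulr0//; rewrite ger0_norm; lra.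
rewrite (@Rintegral_oint _ (a - d) (b + d))//; last first.
  move=> x /orP[h|h]; rewrite /phi.
    by rewrite !step_left ?subrr ?mulr0//; lra.
  by rewrite !step_right ?subrr ?mulr0//; lra.
under eq_oint do rewrite mulrBr.
rewrite (ointB _ _ (lfb a) (lfb b)) (loc a) ?(loc b) ?lerD2r//.
have := bump_average d0 cf fa; have := bump_average d0 cf fb.
set Ia := oint _ _ _; set Ib := oint _ _ _ => hb ha hI.
have cst c : continuous (fun x => step d (x - c)).
  have cs : continuous (step d) by apply: oint_continuous; exact: locint_continuous (@bump_continuous d).
  by apply: (cont_comp cs); cont.
have lgs c : locint (fun x => g x * step d (x - c)).
  by under eq_fun do rewrite mulrC; exact: locintMl.
have IE x y : oint x y (fun y => `|g y|) = oint a y (fun y => `|g y|) - oint a x (fun y => `|g y|).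
  by rewrite -(oint_chasles a x y lng); ring.
have X c : `|oint (c - d) (c + d) (fun x => g x * step d (x - c))| <= oint (c - d) (c + d) (fun y => `|g y|).
  have cd : c - d <= c + d by lra.
  apply: (le_trans (le_norm_oint (lgs c) cd)); apply: le_oint => //; first exact: locint_norm.
  move=> x _; rewrite normrM ler_piMr//.
  by have /andP[s0 s1] := step_ge0_le1 d0 (x - c); rewrite ger0_norm.
have gphi : oint (a - d) (b + d) (fun x => g x * phi x) =
    oint (a - d) (a + d) (fun x => g x * step d (x - a)) + oint (a + d) (b + d) g
    - oint (b - d) (b + d) (fun x => g x * step d (x - b)).
  rewrite /phi; under eq_oint do rewrite mulrBr.
  rewrite ointB//; congr (_ - _).
    rewrite -(oint_chasles (a - d) (a + d) (b + d) (lgs a)); congr (_ + _).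
    apply: eq_oint => x; rewrite min_l; last by lra.
    by move=> /andP[h _]; rewrite step_right ?mulr1//; lra.
  rewrite -(oint_chasles (a - d) (b - d) (b + d) (lgs b)) [X in X + _]oint_eq0 ?add0r//.
  move=> x; rewrite max_r; last by lra.
  by move=> /andP[_ h]; rewrite step_left ?mulr0//; lra.
have gab : oint a b g = oint a (a + d) g + oint (a + d) (b + d) g - oint b (b + d) g.
  by rewrite (oint_chasles a) // -(oint_chasles a b (b + d) lg); ring.
have dge := ltW d0.
have self c : c - d <= c <= c + d by rewrite gerBl lerDl dge.
have selfr c : c - d <= c + d <= c + d by rewrite lexx andbT (le_trans _ (proj2 (andP (self c))))// (proj1 (andP (self c))).
have n1 := norm_oint_le_sub lg (self a) (selfr a).
have n2 := norm_oint_le_sub lg (self b) (selfr b).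
have Xa := X a; have Xb := X b.
have sum2 (u v e' : R) : `|u| <= e' / 2 -> `|v| <= e' / 2 -> v - u <= e'.
  by clear; rewrite !ler_norml => /andP[? ?] /andP[? ?]; lra.
have da : oint (a - d) (a + d) (fun y => `|g y|) <= e.
  have am : `|a - d - a| <= d by rewrite addrAC subrr sub0r normrN gtr0_norm.
  have ap : `|a + d - a| <= d by rewrite addrAC subrr add0r gtr0_norm.
  have := sum2 _ _ _ (ga _ am) (ga _ ap); rewrite (IE (a - d)); clear; lra.
have db : oint (b - d) (b + d) (fun y => `|g y|) <= e.
  have am : `|b - d - b| <= d by rewrite addrAC subrr sub0r normrN gtr0_norm.
  have ap : `|b + d - b| <= d by rewrite addrAC subrr add0r gtr0_norm.
  have := sum2 _ _ _ (gb _ am) (gb _ ap); rewrite (IE (b - d)); clear; lra.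
rewrite gab; rewrite gphi in hI.
have fin (fa' fb' Ia' Ib' J ga' gb' Xa' Xb' : R) :
    `|ga'| <= e -> `|gb'| <= e -> `|Xa'| <= e -> `|Xb'| <= e ->
    `|Ia' - fa'| <= e / 2 -> `|Ib' - fb'| <= e / 2 -> Ia' - Ib' = - (Xa' + J - Xb') ->
    `|fb' - fa' - (ga' + J - gb')| <= e * 5.
  by clear; rewrite !ler_norml => /andP[? ?] /andP[? ?] /andP[? ?] /andP[? ?]
    /andP[? ?] /andP[? ?] ?; apply/andP; split; lra.
by apply: fin ha hb hI; [exact: le_trans n1 da|exact: le_trans n2 db|
  exact: le_trans Xa da|exact: le_trans Xb db].
Unshelve. all: by end_near. Qed.

End weak_derivatives.

Section null_functions.
Context {R : realType}.
Notation mu := (@lebesgue_measure R).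
Notation oint := oriented_integral.

(** By Lebesgue's differentiation theorem g is almost everywhere the derivative
    of its primitive, which is constant. *)
Lemma oint_eq0_ae (g : R -> R) : locint g ->
  (forall a b, a <= b -> oint a b g = 0) -> {ae mu, forall x, g x = 0}.
Proof.
move=> lg g0.
have key n : {ae mu, forall x : R, (- n%:R < x < n%:R) -> g x = 0}.
  set a : R := - n%:R; set b : R := n%:R.
  pose h := g \_ `[a, b].
  have mg := locint_measurable lg.
  have ih : mu.-integrable setT (EFin \o h).
    rewrite /h -restrict_EFin; exact: (iffLR (integrable_mkcond _ _)).
  have F1 := @FTC1 R h (BLeft a).
  have {}F1 := F1 _ (open_integrable_locally openT ih).
  have ihy y : mu.-integrable `[a, y] (EFin \o h) by exact: integrableS ih.
  have {}F1 := F1 ihy.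
  apply: (@filterS _ (almost_everywhere mu) _ _ _ _ F1) => x /= + /andP[ax xb].
  move=> /(_ ltac:(by rewrite lte_fin)) [_].
  have -> : derive1 (fun x : R => \int[mu]_(t in [set` Interval (BLeft a) (BRight x)]) h t) x = 0.
    rewrite derive1E.
    have : is_derive x (1 : R) (fun x : R => \int[mu]_(t in [set` Interval (BLeft a) (BRight x)]) h t) 0.
      have h0 : is_derive (x : R) (1 : R) (fun _ : R => 0 : R) 0 by exact: is_derive_cst.
      apply: near_eq_is_derive h0.
      near=> y.
      have ay : a <= y by apply: ltW; near: y; exact: lt_nbhsr.
      have yb : y <= b by apply: ltW; near: y; exact: lt_nbhsl.
      rewrite -(g0 _ _ ay) ointE//; apply: eq_Rintegral => z /set_mem/=.
      rewrite in_itv/= => /andP[az zy]; rewrite /h patchE mem_set//=.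
      by rewrite in_itv/= az (le_trans zy).
    by case.
  have xab : x \in `[a, b]%classic by rewrite inE/= in_itv/= (ltW ax) (ltW xb).
  by rewrite /h patchE xab => <-.
apply: (@filterS _ (almost_everywhere mu) _ _ _ _ (ae_foralln key)) => x hx.
have [n xn] : exists n : nat, `|x| < n%:R.
  by exists (Num.truncn `|x|).+1; rewrite truncnS_gt.
by apply: (hx n); rewrite -ltr_norml.
Unshelve. all: by end_near. Qed.

(** Such a g is a weak derivative of the zero function. *)
Lemma test_orthogonal_ae0 (g : R -> R) : locint g ->
  (forall phi, test_function phi -> \int[mu]_x (g x * phi x) = 0) ->
  {ae mu, forall x, g x = 0}.
Proof.
move=> lg h; apply: oint_eq0_ae => // a b ab.
rewrite -(@weak_derivative_oint R (fun=> 0) g a b)//; first by rewrite subrr.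
  exact: cont_cst.
move=> phi tphi; rewrite h// oppr0.
under eq_Rintegral do rewrite mul0r.
by rewrite Rintegral_cst// mul0r.
Qed.

End null_functions.

(** * Uniqueness and finite speed of propagation *)

Section finite_speed.
Context {R : realType}.
Notation oint := oriented_integral.

Lemma bounded_continuous_box (f : R * R -> R) (a b c d : R) : continuous f ->
  exists2 M, 0 < M & forall x y, a <= x <= b -> c <= y <= d -> `|f (x, y)| <= M.
Proof.
move=> cf.
have [ab|ba] := leP a b; last by exists 1 => // x y /andP[? ?]; lra.
have [cd|dc] := leP c d; last by exists 1 => // x y _ /andP[? ?]; lra.
have cnf : continuous (fun z => `|f z|) by exact: cont_norm.
have := @compact_EVT_max _ R (fun z => `|f z|) (`[a, b] `*` `[c, d]) _
   (compact_setX (@segment_compact R a b) (@segment_compact R c d)) (continuous_subspaceT cnf).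
move=> H; have [z _ zmax] : exists2 z, z \in `[a, b] `*` `[c, d] &
    forall t, t \in `[a, b] `*` `[c, d] -> `|f t| <= `|f z|.
  by apply: H; exists (a, c) => /=; rewrite !in_itv/= !lexx ab cd.
exists (`|f z| + 1); first by rewrite ltr_wpDl.
move=> x y xab ycd; rewrite (le_trans (zmax (x, y) _)) ?lerDl//.
by rewrite inE/= !in_itv.
Qed.

Lemma oint_expR (K t : R) : 0 <= t -> oint 0 t (fun x => expR (K * x) * K) = expR (K * t) - 1.
Proof.
move=> t0.
have e x : 0 + oint 0 x (fun=> K) = K * x by rewrite oint_cst; ring.
pose M := `|K| * t.
have := @oint_chain_rule R expR expR (fun=> K) 0 t 0 (- M) M t0
   (locint_continuous (@cont_cst _ _ _)) (@continuous_expR R) _ (fun y _ => is_derive_expR y).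
rewrite -[0 + _]/(0 + _) e expR0 => <-.
  by apply: eq_oint => x _; rewrite e.
move=> x /andP[x0 xt]; rewrite e -ler_norml normrM ler_wpM2l// ger0_norm//.
Qed.

(** Let S be the supremum of exp(- K t) |f(x, t)| over the backward light cone
    of (x0, t0).  The hypothesis gives |f(x, t)| <= 2 t0 L S exp(K t) / K on the
    cone, hence S <= S / 2 for the K chosen below. *)
Lemma gronwall_cone (f : R -> R -> R) (L x0 t0 : R) :
  continuous (fun z : R * R => f z.1 z.2) -> 0 <= L -> 0 <= t0 ->
  (forall x t, 0 <= t -> `|x - x0| <= t0 - t ->
     `|f x t| <= L * oint 0 t (fun r => oint (x - t + r) (x + t - r) (fun y => `|f y r|))) ->
  f x0 t0 = 0.
Proof.
move=> cf L0 t00 H.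
pose K := 4 * L * t0 + 1.
have K0 : 0 < K by rewrite ltr_wpDl// !mulr_ge0.
pose cone x t := 0 <= t /\ `|x - x0| <= t0 - t.
pose A := [set e | exists x t, cone x t /\ e = expR (- K * t) * `|f x t|].
have [M M0 fM] := @bounded_continuous_box (fun z => f z.1 z.2) (x0 - t0) (x0 + t0) 0 t0 cf.
have coneb x t : cone x t -> x0 - t0 <= x <= x0 + t0 /\ 0 <= t <= t0.
  move=> [t1]; rewrite ler_norml => /andP[h1 h2]; split; apply/andP; split; lra.
have fin : cone x0 t0 by split => //; rewrite !subrr normr0.
have supA : has_sup A.
  split; first by exists (expR (- K * t0) * `|f x0 t0|), x0, t0.
  exists M => _ [x [t [c ->]]]; have [bx bt] := coneb _ _ c.
  rewrite -[leRHS]mul1r ler_pM ?expR_ge0//; last exact: fM.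
  rewrite -expR0 ler_expR mulNr oppr_le0 mulr_ge0 ?(ltW K0)//.
  by case/andP: bt.
set S := sup A.
have fS x t : cone x t -> `|f x t| <= S * expR (K * t).
  move=> c; have : expR (- K * t) * `|f x t| <= S.
    by apply: ub_le_sup; [case: supA|exists x, t].
  by rewrite mulNr expRN mulrC ler_pdivrMr// expR_gt0.
have S0 : 0 <= S.
  have := fS _ _ fin; move=> /(le_trans (normr_ge0 _)).
  by rewrite pmulr_lge0// expR_gt0.
have caf : continuous (fun z : R * R => `|f z.1 z.2|) by exact: cont_norm.
have lafr r : locint (fun y => `|f y r|).
  apply: locint_continuous.
  by apply: (@cont_comp _ _ _ (fun y => (y, r)) _ caf); cont.
have half x t : cone x t -> expR (- K * t) * `|f x t| <= S / 2.
  move=> c; have [bx /andP[t1 t2]] := coneb _ _ c.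
  rewrite mulNr expRN mulrC ler_pdivrMr ?expR_gt0//.
  apply: (le_trans (H x t t1 (proj2 c))).
  have cin : continuous (fun r => oint (x - t + r) (x + t - r) (fun y => `|f y r|)).
    by apply: (@cont_oint _ _ _ _ _ id (fun z => `|f z.1 z.2|)) => //; cont.
  have inner r : 0 <= r <= t -> oint (x - t + r) (x + t - r) (fun y => `|f y r|)
      <= (2 * t0 * S / K) * (expR (K * r) * K).
    move=> /andP[r0 rt].
    have xr : x - t + r <= x + t - r by lra.
    apply: (@le_trans _ _ (oint (x - t + r) (x + t - r) (fun=> S * expR (K * r)))).
      apply: le_oint => //; first exact: (locint_continuous (@cont_cst _ _ _)).
      move=> y /andP[y1 y2]; apply: fS; split => //.
      case: c => _; rewrite !ler_norml => /andP[? ?]; apply/andP; split; lra.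
    rewrite oint_cst (_ : 2 * t0 * S / K * _ = S * expR (K * r) * (2 * t0)); last first.
      by field; rewrite gt_eqF.
    by rewrite ler_wpM2l ?mulr_ge0 ?expR_ge0//; lra.
  have cexp : continuous (fun r => expR (K * r) * K).
    apply: contM; last exact: cont_cst.
    by apply: (cont_comp (@continuous_expR R)); cont.
  have le1 : oint 0 t (fun r => oint (x - t + r) (x + t - r) (fun y => `|f y r|)) <=
      (2 * t0 * S / K) * (expR (K * t) - 1).
    rewrite -oint_expR// -ointZ; last exact: locint_continuous.
    apply: le_oint => //; first exact: locint_continuous.
    by apply: locintZ; exact: locint_continuous.
  apply: (le_trans (ler_wpM2l L0 le1)).
  apply: (@le_trans _ _ (L * (2 * t0 * S / K * expR (K * t)))).
    rewrite ler_wpM2l// ler_wpM2l// ?gerBl//.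
    by rewrite divr_ge0 ?(ltW K0)// !mulr_ge0.
  rewrite (_ : L * _ = S / 2 * expR (K * t) * (4 * L * t0 / K)); last first.
    by field; rewrite gt_eqF.
  rewrite ler_piMr ?mulr_ge0 ?expR_ge0// ler_pdivrMr// mul1r.
  by rewrite /K lerDl.
have SS : S <= S / 2.
  apply: ge_sup; first by case: supA.
  by move=> _ [x [t [c ->]]]; exact: half.
have {}S0 : S = 0 by apply/le_anti; rewrite S0 andbT; lra.
have := fS _ _ fin; rewrite S0 mul0r normr_le0 => /eqP; exact.
Qed.

Definition dalembert (p : R) (u0 u1 : R -> R) (u : R -> R -> R) :=
  forall x t, 0 <= t -> u x t =
    2^-1 * (u0 (x - t) + u0 (x + t) + oint (x - t) (x + t) u1)
    - 2^-1 * oint 0 t (fun r => oint (x - t + r) (x + t - r) (fun y => nonlinearity p (u y r))).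

(** Both solutions are bounded on the backward cone, where N is therefore
    Lipschitz, and the difference satisfies the hypothesis of [gronwall_cone]. *)
Lemma dalembert_unique (p : R) (u0 u1 w0 w1 : R -> R) (u w : R -> R -> R) (x0 t0 : R) :
  1 < p ->
  continuous (fun z : R * R => u z.1 z.2) -> continuous (fun z : R * R => w z.1 z.2) ->
  dalembert p u0 u1 u -> dalembert p w0 w1 w -> 0 <= t0 ->
  (forall y, x0 - t0 <= y <= x0 + t0 -> u0 y = w0 y) ->
  (forall a b, x0 - t0 <= a -> a <= b -> b <= x0 + t0 -> oint a b u1 = oint a b w1) ->
  u x0 t0 = w x0 t0.
Proof.
move=> p1 cu cw du dw t00 e0 e1.
have [M M0 uM] := @bounded_continuous_box (fun z => u z.1 z.2) (x0 - t0) (x0 + t0) 0 t0 cu.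
have [M' M'0 wM] := @bounded_continuous_box (fun z => w z.1 z.2) (x0 - t0) (x0 + t0) 0 t0 cw.
pose MM := Num.max M M'.
pose L := 2^-1 * (p * MM `^ (p - 1)).
have L0 : 0 <= L by rewrite !mulr_ge0 ?powR_ge0//; lra.
have cN := continuous_nonlinearity p1.
apply/eqP; rewrite -subr_eq0; apply/eqP.
have cNu : continuous (fun z : R * R => nonlinearity p (u z.1 z.2)) by exact: (cont_comp cN cu).
have cNw : continuous (fun z : R * R => nonlinearity p (w z.1 z.2)) by exact: (cont_comp cN cw).
have cuw : continuous (fun z : R * R => u z.1 z.2 - w z.1 z.2) by cont.
apply: (@gronwall_cone (fun x t => u x t - w x t) L x0 t0) => // x t t1 xt.
have [bx bt] : x0 - t0 <= x - t /\ x + t <= x0 + t0.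
  by move: xt; rewrite ler_norml => /andP[? ?]; split; lra.
rewrite du// dw// !e0; [|apply/andP; split; lra..].
rewrite (e1 (x - t) (x + t))//; last by lra.
set D := 2^-1 * (_ + _ + _).
have sec (k : R * R -> R) r : continuous k -> locint (fun y => k (y, r)).
  by move=> ck; apply: locint_continuous; apply: (cont_comp ck); cont.
have cin (k : R * R -> R) : continuous k ->
    continuous (fun r => oint (x - t + r) (x + t - r) (fun y => k (y, r))).
  by move=> ck; apply: (@cont_oint _ _ _ _ _ id k) => //; cont.
have lin (k : R * R -> R) : continuous k ->
    locint (fun r => oint (x - t + r) (x + t - r) (fun y => k (y, r))).
  by move=> ck; apply: locint_continuous; exact: cin.
have lu := lin _ cNu; have lw := lin _ cNw; have luw := lin _ (cont_norm cuw).
have comb (d a b : R) : d - 2^-1 * a - (d - 2^-1 * b) = 2^-1 * (b - a) by ring.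
rewrite comb.
rewrite -ointB// normrM ger0_norm ?invr_ge0// /L -[leRHS]mulrA ler_pM2l ?invr_gt0//.
rewrite -ointZ; last exact: luw.
apply: (le_trans (le_norm_oint (locintB lw lu) t1)).
apply: le_oint => //; [exact: locint_norm (locintB lw lu)|exact: locintZ|].
move=> r /andP[r0 rt].
have xr : x - t + r <= x + t - r by lra.
have su := sec _ r cNu; have sw := sec _ r cNw; have suw := sec _ r (cont_norm cuw).
rewrite -ointB// (le_trans (le_norm_oint (locintB sw su) xr))//.
rewrite -ointZ; last exact: suw.
apply: le_oint => //; [exact: locint_norm (locintB sw su)|exact: locintZ|].
move=> y /andP[y1 y2]; rewrite distrC; apply: nonlinearity_lipschitz => //.
  by rewrite le_max (uM y r)//; apply/andP; split; lra.
by rewrite le_max (wM y r) ?orbT//; apply/andP; split; lra.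
Qed.

End finite_speed.

(** * Characteristic coordinates and the energy identity *)

Section characteristics.
Context {R : realType}.
Notation oint := oriented_integral.

Lemma oint_chain_rule_everywhere (F F' g : R -> R) (a b c : R) :
  a <= b -> locint g -> continuous F' ->
  (forall y, is_derive y (1 : R) F (F' y)) ->
  oint a b (fun x => F' (c + oint a x g) * g x) = F (c + oint a b g) - F c.
Proof.
move=> ab lg cF' dF.
have cG : continuous (fun x => c + oint a x g).
  by apply: contD; [exact: cont_cst|exact: oint_continuous].
have [M M0 GM] := @bounded_continuous_itv R _ a b (fun x _ => cG x).
apply: (@oint_chain_rule R F F' g a b c (- M) M) => //.
by move=> x xab; rewrite -ler_norml; apply: GM; rewrite in_itv.
Qed.

Lemma oint_if (f : R -> R) (a b c d : R) : a <= c -> c <= d -> d <= b ->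
  oint a b (fun x => if (c <= x) && (x <= d) then f x else 0) = oint c d f.
Proof.
move=> ac cd db; rewrite !ointE//; last by rewrite (le_trans ac)// (le_trans cd).
have -> : `[c, d]%classic = `[a, b]%classic `&` `[c, d]%classic.
  apply/esym/setIidr => x /=; rewrite !in_itv/= => /andP[cx xd].
  by rewrite (le_trans ac cx) (le_trans xd db).
rewrite Rintegral_mkcondr; apply: eq_Rintegral => x _.
rewrite /patch; case: ifPn => h; first by rewrite mem_set//= in_itv.
by rewrite memNset//= in_itv/=; exact/negP.
Qed.

Definition potential (p y : R) : R := (p + 1)^-1 * `|y| `^ (p + 1).

Lemma energy_algebra (a b c d e : R) : 4^-1 * (a - b) = 2^-1 * c - d - 2^-1 * e ->
  4^-1 * a + 2^-1 * e = 4^-1 * b + 2^-1 * c - d.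
Proof. lra. Qed.

Section solution.
Variables (p : R) (u : R -> R -> R) (v0 : R -> R) (S : R).

(** The pair (s, r) stands for the point x = s + r at time r, so that s is
    constant along right-going characteristics.  In these coordinates [vel] is
    u_x - u_t, [density] is e_+ and [tail] is the right-going energy lying to
    the right of the characteristic s. *)
Definition force (s r : R) : R := nonlinearity p (u (s + r) r).
Definition vel (s r : R) : R := v0 s + oint 0 r (force s).
Definition pot (s r : R) : R := potential p (u (s + r) r).
Definition density (s r : R) : R := 4^-1 * vel s r ^+ 2 + 2^-1 * pot s r.
Definition tail (s r : R) : R := oint s S (fun x => density x r).

Lemma forceE s r : force s r = nonlinearity p (u (s + r) r).
Proof. by []. Qed.

Lemma velE s r : vel s r = v0 s + oint 0 r (force s).
Proof. by []. Qed.

Lemma potE s r : pot s r = potential p (u (s + r) r).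
Proof. by []. Qed.

(** The wave equation for t >= 0 in integrated form: the definition of [vel]
    integrates it along right-going characteristics, and [cs_left] integrates
    u_x - u_t along the left-going characteristic through (x, t), on which
    r = (x + t - s) / 2. *)
Record char_solution : Prop := CharSolution {
  cs_p1 : 1 < p ;
  cs_S : 0 < S ;
  cs_cont : continuous (fun z : R * R => u z.1 z.2) ;
  cs_even : forall x t, 0 <= t -> u (- x) t = u x t ;
  cs_supp : forall x t, 0 <= t -> S + t <= `|x| -> u x t = 0 ;
  cs_v0 : locint v0 ;
  cs_v02 : locint (fun x => v0 x ^+ 2) ;
  cs_v0_supp : forall x, S <= `|x| -> v0 x = 0 ;
  cs_left : forall x t, 0 <= t -> u x t =
    u (x + t) 0 - 2^-1 * oint (x - t) (x + t) (fun s => vel s ((x + t - s) / 2))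
}.

Hypothesis H : char_solution.

Let p1 := cs_p1 H.
Let cu := cs_cont H.
Let u_supp := cs_supp H.
Let lv0 := cs_v0 H.
Let lv02 := cs_v02 H.
Let v0_supp := cs_v0_supp H.
Let left_rep := cs_left H.

Let pp0 : 0 < p + 1. Proof. by have := p1; lra. Qed.

Lemma potential_ge0 y : 0 <= potential p y.
Proof. by rewrite mulr_ge0 ?powR_ge0// invr_ge0 ltW. Qed.

Lemma potential0 : potential p 0 = 0.
Proof. by rewrite /potential normr0 powR0 ?mulr0// gt_eqF. Qed.

Lemma continuous_potential : continuous (potential p).
Proof.
by apply: contM; [exact: cont_cst|exact: continuous_norm_powR].
Qed.

Lemma cont_force : continuous (fun z : R * R => force z.1 z.2).
Proof.
apply: (cont_comp (continuous_nonlinearity p1)).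
by apply: (@cont_comp _ _ _ (fun z : R * R => (z.1 + z.2, z.2)) _ cu); cont.
Qed.

Lemma cont_pot : continuous (fun z : R * R => pot z.1 z.2).
Proof.
apply: (cont_comp continuous_potential).
by apply: (@cont_comp _ _ _ (fun z : R * R => (z.1 + z.2, z.2)) _ cu); cont.
Qed.

Lemma cont_impulse : continuous (fun z : R * R => oint 0 z.2 (force z.1)).
Proof.
have cf : continuous (fun z : R * R => force z.2 z.1).
  by apply: (@cont_comp _ _ _ (fun z : R * R => (z.2, z.1)) _ cont_force); cont.
by apply: (@cont_oint _ _ _ _ _ _ (fun z : R * R => force z.2 z.1)) => //; cont.
Qed.

Lemma cont2l (k : R * R -> R) x : continuous k -> continuous (fun y => k (x, y)).
Proof. by move=> ck; apply: (cont_comp ck); cont. Qed.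

Lemma cont2r (k : R * R -> R) y : continuous k -> continuous (fun x => k (x, y)).
Proof. by move=> ck; apply: (cont_comp ck); cont. Qed.

Lemma pot_ge0 s r : 0 <= pot s r.
Proof. exact: potential_ge0. Qed.

Lemma density_ge0 s r : 0 <= density s r.
Proof. by apply: addr_ge0; apply: mulr_ge0 => //; [exact: sqr_ge0|exact: pot_ge0]. Qed.

Lemma locint_vel r : locint (vel^~ r).
Proof.
apply: locintD => //; apply: locint_continuous.
exact: (cont2r cont_impulse).
Qed.

Lemma locint_vel_sqr r : locint (fun s => vel s r ^+ 2).
Proof.
have cV : continuous (fun s => oint 0 r (force s)) by exact: (cont2r cont_impulse).
rewrite (_ : (fun s => _) = fun s => v0 s ^+ 2 + (2 * oint 0 r (force s) * v0 s + oint 0 r (force s) ^+ 2)).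
  apply: locintD => //; apply: locintD.
    by apply: locintMl => //; apply: contM; [exact: cont_cst|exact: cV].
  by apply: locint_continuous; exact: (contX cV).
by apply/funext => s; rewrite /vel; ring.
Qed.

Lemma locint_pot r : locint (pot^~ r).
Proof. by apply: locint_continuous; exact: (cont2r cont_pot). Qed.

Lemma locint_density r : locint (density^~ r).
Proof. by apply: locintD; apply: locintZ; [exact: locint_vel_sqr|exact: locint_pot]. Qed.

Lemma locint_tail r : locint (tail^~ r).
Proof.
rewrite /tail; under eq_fun do rewrite oint_swap.
by apply: locintN; apply/locint_continuous/oint_continuous; exact: locint_density.
Qed.

Lemma u_right_cone s r : 0 <= r -> S <= s -> u (s + r) r = 0.
Proof.
move=> r0 Ss; apply: u_supp => //; rewrite (le_trans _ (ler_norm _))//; lra.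
Qed.

Lemma u_left_cone s r : 0 <= r -> s <= - S - 2 * r -> u (s + r) r = 0.
Proof.
move=> r0 Ss; apply: u_supp => //; rewrite -normrN (le_trans _ (ler_norm _))//; lra.
Qed.

Lemma pot_right s r : 0 <= r -> S <= s -> pot s r = 0.
Proof. by move=> r0 Ss; rewrite /pot u_right_cone// potential0. Qed.

Lemma pot_left s r : 0 <= r -> s <= - S - 2 * r -> pot s r = 0.
Proof. by move=> r0 Ss; rewrite /pot u_left_cone// potential0. Qed.

Lemma vel_right s r : 0 <= r -> S <= s -> vel s r = 0.
Proof.
move=> r0 Ss; rewrite /vel v0_supp ?add0r; last by rewrite (le_trans Ss)// ler_norm.
apply: oint_eq0 => x; rewrite min_l// max_r// => /andP[x0 _].
by rewrite /force u_right_cone// nonlinearity0.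
Qed.

Lemma vel_left s r : 0 <= r -> s <= - S - 2 * r -> vel s r = 0.
Proof.
move=> r0 Ss; rewrite /vel v0_supp ?add0r; last first.
  by rewrite -normrN (le_trans _ (ler_norm _))//; lra.
apply: oint_eq0 => x; rewrite min_l// max_r// => /andP[x0 xr].
by rewrite /force u_left_cone ?nonlinearity0//; lra.
Qed.

Lemma density_right s r : 0 <= r -> S <= s -> density s r = 0.
Proof. by move=> r0 h; rewrite /density vel_right// pot_right// expr0n/=; ring. Qed.

Lemma density_left s r : 0 <= r -> s <= - S - 2 * r -> density s r = 0.
Proof. by move=> r0 h; rewrite /density vel_left// pot_left// expr0n/=; ring. Qed.

Lemma vel_sqr_evol s t : 0 <= t ->
  oint 0 t (fun r => 2 * vel s r * force s r) = vel s t ^+ 2 - v0 s ^+ 2.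
Proof.
move=> t0.
have lf : locint (force s) by apply: locint_continuous; exact: (cont2l cont_force).
have d2 (y : R) : is_derive y (1 : R) (fun y => y ^+ 2) (2 * y).
  by apply: is_derive_eq; rewrite /GRing.scale/=; ring.
have c2 : continuous (fun y : R => 2 * y) by cont.
exact: (@oint_chain_rule_everywhere _ _ (force s) 0 t (v0 s) t0 lf c2 d2).
Qed.

(* u_x - u_t on the left-going characteristic x + t = y *)
Let W (y s : R) := vel s ((y - s) / 2).

Let cont_Wimp : continuous (fun z : R * R => oint 0 ((z.2 - z.1) / 2) (force z.1)).
Proof.
by apply: (@cont_comp _ _ _ (fun z : R * R => (z.1, (z.2 - z.1) / 2)) _ cont_impulse); cont.
Qed.

Lemma locint_left y : locint (W y).
Proof.
by apply: locintD => //; apply: locint_continuous; exact: (cont2r cont_Wimp).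
Qed.

(** Along a left-going characteristic u has derivative v / 2 in s, so P(u) has
    derivative N(u) v / 2. *)
Lemma left_potential y a b : a <= b -> b <= y ->
  oint a b (fun s => 2^-1 * (force s ((y - s) / 2) * W y s)) = pot b ((y - b) / 2) - pot a ((y - a) / 2).
Proof.
move=> ab bY.
have lW := locint_left y.
have rep s : s <= y -> u (s + (y - s) / 2) ((y - s) / 2) = u y 0 - 2^-1 * oint s y (W y).
  move=> sy; rewrite left_rep; last by rewrite divr_ge0// subr_ge0.
  have e1 : s + (y - s) / 2 + (y - s) / 2 = y by field.
  have e2 : s + (y - s) / 2 - (y - s) / 2 = s by ring.
  by rewrite e1 e2.
pose c := u y 0 - 2^-1 * oint a y (W y).
have lg : locint (fun s => 2^-1 * W y s) by exact: locintZ.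
have G x : x <= y -> c + oint a x (fun s => 2^-1 * W y s) = u (x + (y - x) / 2) ((y - x) / 2).
  move=> xy; rewrite rep// /c ointZ// -(oint_chasles a x y lW); ring.
have := @oint_chain_rule_everywhere (potential p) _ _ a b c ab lg
  (continuous_nonlinearity p1) (is_derive_potential p1).
rewrite (G b)// -{2}(addr0 c) -(oint_refl (fun s => 2^-1 * W y s) a) (G a); last exact: le_trans bY.
move=> <-; apply: eq_oint_le => // x /andP[ax xb].
rewrite G; last exact: le_trans bY.
by rewrite /force; ring.
Qed.

(** Along right-going characteristics v^2 grows at the rate 2 N(u) v.  Integrate
    this over the characteristics between s and S, replace the time r by the
    label y = x + 2 r of the left-going characteristic through the point, and
    exchange the integrations: the inner integrals are now increments of P(u) by
    [left_potential].  Their ends on the initial line and at time t account for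
    the change of potential energy, those on the characteristic s are the
    energy lost. *)
Lemma tail_evol s t : 0 <= t -> s <= S -> tail s t = tail s 0 - oint 0 t (pot s).
Proof.
move=> t0 sS.
pose F s y := if (s <= y) && (y <= s + 2 * t) then 2^-1 * (2^-1 * (force s ((y - s) / 2) * W y s)) else 0.
have cfL : continuous (fun z : R * R => force z.1 ((z.2 - z.1) / 2)).
  by apply: (@cont_comp _ _ _ (fun z : R * R => (z.1, (z.2 - z.1) / 2)) _ cont_force); cont.
have mF : measurable_fun setT (fun z : R * R => F z.1 z.2).
  apply: measurable_fun_ifT.
  - apply: measurable_and; apply: measurable_fun_ler => //.
    apply: measurable_funD => //; exact: measurable_cst.
  - apply: measurable_funM; first exact: measurable_cst.
    apply: measurable_funM; first exact: measurable_cst.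
    apply: measurable_funM; first exact: continuous_measurable_fun2.
    apply: measurable_funD; first by apply: measurableT_comp => //; exact: locint_measurable.
    exact: continuous_measurable_fun2.
  - exact: measurable_cst.
have l2F : locint2 F.
  have l1 := locint2_contMl cfL lv0.
  have l2 := locint2_cont (contM cfL cont_Wimp).
  apply: (locint2_le mF (locint2D (locint2_norm l1) (locint2_norm l2))) => x y /=.
  rewrite /F; case: ifP => _; last by rewrite normr0.
  rewrite /W /vel mulrDr !normrM (@ger0_norm _ 2^-1) ?invr_ge0// mulrA.
  rewrite [leRHS]ger0_norm ?addr_ge0 ?mulr_ge0//.
  apply: (@le_trans _ _ (1 * `|force x ((y - x) / 2) * v0 x + force x ((y - x) / 2) * oint 0 ((y - x) / 2) (force x)|)).
    by rewrite ler_wpM2r//; lra.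
  by rewrite mul1r (le_trans (ler_normD _ _))// !normrM (mulrC `|v0 x|).
(* the time integral of the work of the force, in the label y = x + 2 r *)
have kin : oint s S (fun x => 4^-1 * (vel x t ^+ 2 - v0 x ^+ 2)) =
   oint s S (fun x => oint s (S + 2 * t) (F x)).
  apply: eq_oint_le => // x /andP[sx xS].
  rewrite /F oint_if//; [|lra..].
  rewrite -vel_sqr_evol// -ointZ; last first.
    apply: locint_continuous; apply: contM; last exact: (cont2l cont_force).
    apply: contM; first exact: cont_cst.
    by apply: contD; [exact: cont_cst|exact: (cont2l cont_impulse)].
  have lwx : locint (fun r => 4^-1 * (2 * vel x r * force x r)).
    apply: locintZ; apply: locint_continuous; apply: contM; last exact: (cont2l cont_force).
    apply: contM; first exact: cont_cst.
    by apply: contD; [exact: cont_cst|exact: (cont2l cont_impulse)].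
  have h2 : (2^-1 : R) != 0 by rewrite invr_eq0.
  have := @oint_affine R 2^-1 (- x / 2) _ x (x + 2 * t) h2 lwx.
  rewrite (_ : 2^-1 * x + - x / 2 = 0); last by field.
  rewrite (_ : 2^-1 * (x + 2 * t) + - x / 2 = t); last by field.
  move=> <-; rewrite -ointZ; last exact: (locint_affine _ h2 lwx).
  apply: eq_oint => y _; rewrite (_ : 2^-1 * y + - x / 2 = (y - x) / 2); last by field.
  by rewrite /W; field.
(* the left-going characteristic y enters the strip at the initial line or at
   S, and leaves it through the characteristic s or through time t *)
have inner y : s <= y <= S + 2 * t -> oint s S (F^~ y) =
    2^-1 * (potential p (u y 0) -
      (if y <= s + 2 * t then pot s ((y - s) / 2) else pot (y - 2 * t) t)).
  move=> /andP[sy yS].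
  pose a := Num.max s (y - 2 * t); pose b := Num.min S y.
  have sa : s <= a by rewrite le_max lexx.
  have bS : b <= S by rewrite ge_min lexx.
  have bY : b <= y by rewrite ge_min lexx orbT.
  have ab : a <= b.
    rewrite ge_max !le_min sS sy/=; apply/andP; split; first by lra.
    by have := t0; lra.
  transitivity (oint s S (fun x => if (a <= x) && (x <= b) then 2^-1 * (2^-1 * (force x ((y - x) / 2) * W y x)) else 0)).
    apply: eq_oint_le => // x /andP[sx xS]; rewrite /F /a /b ge_max le_min sx xS/=.
    by rewrite lerBlDr andbC.
  rewrite oint_if// ointZ; last first.
    by apply: locintZ; apply: locintMl; [exact: (cont2r cfL)|exact: locint_left].
  rewrite left_potential//; congr (_ * (_ - _)).
    rewrite /b; case: (leP S y) => h.
      rewrite pot_right//; last by rewrite divr_ge0// subr_ge0.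
      by rewrite u_supp ?potential0// addr0 (le_trans h)// ler_norm.
    by rewrite subrr mul0r /pot addr0.
  rewrite /a; case: (leP s (y - 2 * t)) => h; case: ifPn => // h'.
  - have -> : y - 2 * t = s by lra.
    by [].
  - by congr pot; field.
  - by move: h'; rewrite -ltNge => h'; lra.
have tot : oint s S (fun x => 4^-1 * (vel x t ^+ 2 - v0 x ^+ 2)) =
    2^-1 * (oint s S (pot^~ 0)) - oint 0 t (pot s) - 2^-1 * oint s S (pot^~ t).
  have h2 : (2^-1 : R) != 0 by rewrite invr_eq0.
  have sst : s <= s + 2 * t by rewrite lerDl mulr_ge0.
  have sSt : s + 2 * t <= S + 2 * t by rewrite lerD2r.
  have SSt : S <= S + 2 * t by rewrite lerDl mulr_ge0.
  rewrite kin (oint_fubini l2F sS (le_trans sst sSt)).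
  pose h y := oint s S (F^~ y).
  have lh : locint h by exact: (locint_oint' l2F sS).
  rewrite -/h -(oint_chasles s (s + 2 * t) (S + 2 * t) lh).
  pose pot0 y := pot y 0.
  have pot0E y : pot0 y = potential p (u y 0) by rewrite /pot0 /pot addr0.
  have c0 : continuous pot0 by exact: (cont2r cont_pot).
  have l0 : locint pot0 by exact: locint_continuous.
  have cs : continuous (pot s) by exact: (cont2l cont_pot).
  have ls : locint (pot s) by exact: locint_continuous.
  have ct : continuous (pot^~ t) by exact: (cont2r cont_pot).
  have lt : locint (pot^~ t) by exact: locint_continuous.
  have i1 : oint s (s + 2 * t) h = 2^-1 * oint s (s + 2 * t) pot0 - oint 0 t (pot s).
    have := @oint_affine R 2^-1 (- s / 2) (pot s) s (s + 2 * t) h2 ls.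
    rewrite (_ : 2^-1 * s + - s / 2 = 0); last by field.
    rewrite (_ : 2^-1 * (s + 2 * t) + - s / 2 = t); last by field.
    move=> <-; have la := locint_affine (- s / 2) h2 ls.
    rewrite -mulrBr -(ointB _ _ l0 la) -ointZ; last exact: locintB.
    apply: (eq_oint_le sst) => y /andP[y1 y2]; rewrite /h inner; last first.
      by rewrite y1 (le_trans y2).
    by rewrite y2 pot0E; congr (_ * (_ - pot s _)); field.
  have i2 : oint (s + 2 * t) (S + 2 * t) h =
      2^-1 * oint (s + 2 * t) (S + 2 * t) pot0 - 2^-1 * oint s S (pot^~ t).
    have := @oint_affine R 1 (- (2 * t)) (pot^~ t) (s + 2 * t) (S + 2 * t) (oner_neq0 _) lt.
    rewrite !mul1r !addrK => <-; have la := locint_affine (- (2 * t)) (oner_neq0 _) lt.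
    rewrite -mulrBr -(ointB _ _ l0 la) -ointZ; last exact: locintB.
    apply: (eq_oint_le sSt) => y /andP[y1 y2]; rewrite /h inner; last first.
      by rewrite y2 (le_trans sst).
    rewrite pot0E mul1r; congr (_ * (_ - _)).
    case: ifPn => // y3; have -> : y = s + 2 * t by apply/le_anti; rewrite y1 y3.
    by rewrite addrK; congr pot; field.
  have i3 : oint s (s + 2 * t) pot0 + oint (s + 2 * t) (S + 2 * t) pot0 = oint s S pot0.
    rewrite (oint_chasles _ _ _ l0) -(oint_chasles s S (S + 2 * t) l0).
    rewrite (@oint_eq0 _ _ S) ?addr0// => x; rewrite min_l// => /andP[Sx _].
    exact: pot_right.
  have comb (a b c d : R) : 2^-1 * a - b + (2^-1 * c - d) = 2^-1 * (a + c) - b - d by ring.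
  by rewrite i1 i2 -i3 comb.
have lv0t : locint (fun x => vel x t ^+ 2) by exact: locint_vel_sqr.
have lp r : locint (pot^~ r) := @locint_pot r.
have e0 : oint s S (density^~ 0) = 4^-1 * oint s S (fun x => v0 x ^+ 2) + 2^-1 * oint s S (pot^~ 0).
  rewrite -(ointZ 4^-1 s S lv02) -(ointZ 2^-1 s S (lp 0)).
  rewrite -(ointD s S (locintZ 4^-1 lv02) (locintZ 2^-1 (lp 0))).
  by apply: eq_oint => x _; rewrite /density /vel oint_refl addr0.
have e1 : oint s S (density^~ t) = 4^-1 * oint s S (fun x => vel x t ^+ 2) + 2^-1 * oint s S (pot^~ t).
  rewrite -(ointZ 4^-1 s S lv0t) -(ointZ 2^-1 s S (lp t)).
  by rewrite -(ointD s S (locintZ 4^-1 lv0t) (locintZ 2^-1 (lp t))).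
by rewrite /tail e0 e1; apply: energy_algebra; rewrite -tot (ointZ _ _ _ (locintB lv0t lv02)) (ointB _ _ lv0t lv02).
Qed.

End solution.
End characteristics.

(** * The virial inequality *)

Section virial_inequality.
Context {R : realType}.
Notation oint := oriented_integral.

Lemma is_derive_sqr (y : R) : is_derive y (1 : R) (fun y => y ^+ 2) (2 * y).
Proof. by apply: is_derive_eq; rewrite /GRing.scale/=; ring. Qed.

Lemma cont_double : continuous (fun y : R => 2 * y).
Proof. by cont. Qed.

(** Polarization of the chain rule for the square, since the primitives need not
    be differentiable. *)
Lemma oint_product_rule (f g : R -> R) (a b c d : R) : a <= b -> locint f -> locint g ->
  oint a b (fun x => f x * (d + oint a x g) + (c + oint a x f) * g x) =
  (c + oint a b f) * (d + oint a b g) - c * d.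
Proof.
move=> ab lf lg.
have lfg := locintD lf lg.
have sq h k : locint h -> oint a b (fun x => 2 * (k + oint a x h) * h x) = (k + oint a b h) ^+ 2 - k ^+ 2.
  move=> lh.
  exact: (@oint_chain_rule_everywhere R _ _ h a b k ab lh cont_double is_derive_sqr).
have l2 h k : locint h -> locint (fun x => 2 * (k + oint a x h) * h x).
  move=> lh; apply: locintMl => //; apply: contM; first exact: cont_cst.
  by apply: contD; [exact: cont_cst|exact: oint_continuous].
have s1 := sq _ (c + d) lfg; have s2 := sq _ c lf; have s3 := sq _ d lg.
have L1 := l2 _ (c + d) lfg; have L2 := l2 _ c lf; have L3 := l2 _ d lg.
have e1 := ointB a b (locintB L1 L2) L3.
rewrite (ointB a b L1 L2) s1 s2 s3 in e1.
transitivity (2^-1 * oint a b (fun x => 2 * (c + d + oint a x (fun x => f x + g x)) * (f x + g x)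
    - 2 * (c + oint a x f) * f x - 2 * (d + oint a x g) * g x)).
  rewrite -(ointZ _ _ _ (locintB (locintB L1 L2) L3)); apply: eq_oint => x _.
  by rewrite (ointD a x lf lg); field.
by rewrite e1 (ointD a b lf lg); field.
Qed.

Lemma oint_gt0 (f : R -> R) (a b x : R) : continuous f -> (forall y, a <= y <= b -> 0 <= f y) ->
  a < x < b -> 0 < f x -> 0 < oint a b f.
Proof.
move=> cf f0 /andP[ax xb] fx.
have lf := locint_continuous cf.
have fx2 : 0 < f x / 2 by rewrite divr_gt0.
have /cvgr_dist_lt/(_ _ fx2)/nbhs_ballP[r /= r0 rf] := cf x.
pose d := Num.min (r / 2) (Num.min (x - a) (b - x)).
have d0 : 0 < d by rewrite !lt_min divr_gt0//= !subr_gt0 ax xb.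
have da : a <= x - d by rewrite lerBrDr -lerBrDl /d !ge_min lexx !orbT.
have db : x + d <= b by rewrite -lerBrDl /d !ge_min lexx !orbT.
have dr : d < r.
  by rewrite (@le_lt_trans _ _ (r / 2))//; [rewrite ge_min lexx|rewrite ltr_pdivrMr// ltr_pMr// ltr1n].
have xdd : x - d <= x + d by rewrite lerD2l ge0_cp// ltW.
rewrite -(oint_chasles a (x - d) b lf) -(oint_chasles (x - d) (x + d) b lf).
have i1 : 0 <= oint a (x - d) f.
  apply: oint_ge0 => // y /andP[h1 h2]; apply: f0; rewrite h1/= (le_trans h2)//.
  by rewrite (le_trans xdd).
have i3 : 0 <= oint (x + d) b f.
  apply: oint_ge0 => // y /andP[h1 h2]; apply: f0; rewrite h2 andbT (le_trans _ h1)//.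
  by rewrite (le_trans da).
have i2 : f x / 2 * (2 * d) <= oint (x - d) (x + d) f.
  have -> : f x / 2 * (2 * d) = oint (x - d) (x + d) (fun=> f x / 2).
    by rewrite oint_cst; ring.
  apply: le_oint => //; first exact: (locint_continuous (@cont_cst _ _ _)).
  move=> y /andP[h1 h2].
  have yx : `|x - y| < r.
    by apply: le_lt_trans dr; move: h1 h2; clear; rewrite ler_norml; lra.
  have := rf y yx; rewrite /ball/= => /ltW; rewrite ler_norml; clear; lra.
rewrite ltr_wpDl// ltr_pwDl// (lt_le_trans _ i2)// !mulr_gt0//.
Qed.

Lemma oint_support (f : R -> R) (lo hi a b : R) : locint f -> lo <= a -> b <= hi ->
  (forall x, x <= a -> f x = 0) -> (forall x, b <= x -> f x = 0) ->
  oint lo hi f = oint a b f.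
Proof.
move=> lf la bh fa fb.
rewrite -(oint_chasles lo a hi lf) -(oint_chasles a b hi lf).
have -> : oint lo a f = 0 by apply: oint_eq0 => x; rewrite max_r// => /andP[_ /fa].
have -> : oint b hi f = 0 by apply: oint_eq0 => x; rewrite min_l// => /andP[/fb].
by rewrite add0r addr0.
Qed.

Section virial.
Variables (p : R) (u : R -> R -> R) (v0 : R -> R) (S : R).
Hypothesis H : char_solution p u v0 S.

Notation force := (force p u).
Notation vel := (vel p u v0).
Notation pot := (pot p u).
Notation density := (density p u v0).
Notation tail := (tail p u v0 S).

Let S0 := cs_S H.
Let p1 := cs_p1 H.

Definition energy := tail (- S) 0.
Notation E := energy.

Let NSS : - S <= S.
Proof. by rewrite ge0_cp// ltW. Qed.

Lemma tail_right s t : 0 <= t -> S <= s -> tail s t = 0.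
Proof.
move=> t0 Ss; apply: oint_eq0 => x /andP[+ _]; rewrite min_r// => Sx.
exact: (density_right H).
Qed.

Lemma tail_ge0 s t : s <= S -> 0 <= tail s t.
Proof. by move=> sS; apply: oint_ge0 => // x _; exact: (density_ge0 H). Qed.

Lemma tail_mono s s' t : s' <= s -> s <= S -> tail s t <= tail s' t.
Proof.
move=> ss sS; apply: le_oint_sub => //; [exact: locint_density H t|move=> x; exact: (density_ge0 H)].
Qed.

(** Up to time t such a characteristic stays behind the light cone of the data,
    where u = 0, so that nothing has left the tail. *)
Lemma tail_left s t : 0 <= t -> s <= - S - 2 * t -> tail s t = E.
Proof.
move=> t0 st.
have sNS : s <= - S by rewrite (le_trans st)// gerBl mulr_ge0.
rewrite (tail_evol H)//; last exact: le_trans NSS.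
rewrite (@oint_eq0 _ (pot s)) ?subr0.
  rewrite /tail -(oint_chasles s (- S) S (locint_density H 0)) oint_eq0 ?add0r//.
  move=> x; rewrite max_r// => /andP[_ xS]; apply: (density_left H) => //.
  by rewrite mulr0 subr0.
move=> r; rewrite min_l// max_r// => /andP[r0 rt]; apply: (pot_left H) => //.
by rewrite (le_trans st)// lerD2l lerN2 ler_pM2l.
Qed.

Lemma tail_le_energy s t : 0 <= t -> s <= S -> tail s t <= E.
Proof.
move=> t0 sS; have h : Num.min s (- S - 2 * t) <= - S - 2 * t by rewrite ge_min lexx orbT.
by rewrite -(tail_left t0 h); apply: tail_mono => //; rewrite ge_min lexx.
Qed.

Lemma energy_ge0 : 0 <= E.
Proof. exact: tail_ge0. Qed.

(** The energy identity read as a formula for the tail, in which continuity in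
    both variables is visible. *)
Definition ctail (s t : R) := oint s S (density^~ 0) - oint 0 t (pot s).

Lemma ctail_def s t : ctail s t = oint s S (density^~ 0) - oint 0 t (pot s).
Proof. by []. Qed.

Lemma ctailE s t : 0 <= t -> s <= S -> ctail s t = tail s t.
Proof. by move=> t0 sS; rewrite (tail_evol H). Qed.

Lemma cont_ctail : continuous (fun z : R * R => ctail z.1 z.2).
Proof.
apply: contD.
  have c1 : continuous (fun s => oint s S (density^~ 0)).
    under eq_fun do rewrite oint_swap.
    by apply: contN; apply: oint_continuous; exact: locint_density H 0.
  by apply: (cont_comp c1); cont.
apply: contN.
have cf : continuous (fun z : R * R => pot z.2 z.1).
  by apply: (@cont_comp _ _ _ (fun z : R * R => (z.2, z.1)) _ (cont_pot H)); cont.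
by apply: (@cont_oint _ _ _ _ _ _ (fun z : R * R => pot z.2 z.1)) => //; cont.
Qed.

Section horizon.
Variables (T L : R).
Hypotheses (T0 : 0 <= T) (LT : S + 2 * T <= L).

Let SL : S <= L.
Proof. by rewrite (le_trans _ LT)// lerDl mulr_ge0. Qed.
Let NLS : - L <= S.
Proof. by rewrite (le_trans _ NSS)// lerN2. Qed.
Let Lt t : t <= T -> - L <= - S - 2 * t.
Proof.
by move=> tT; rewrite lerNl opprD !opprK (le_trans _ LT)// lerD2l ler_pM2l.
Qed.

Definition potI (t : R) := oint (- L) S (pot^~ t).

Lemma cont_potI : continuous potI.
Proof.
by apply: (@cont_oint _ _ _ _ _ _ (fun z : R * R => pot z.1 z.2)); [cont..|exact: (cont_pot H)].
Qed.

Lemma kinetic_energy t : 0 <= t -> t <= T ->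
  oint (- L) S (fun s => vel s t ^+ 2) = 4 * E - 2 * potI t.
Proof.
move=> t0 tT; rewrite -(tail_left t0 (Lt tT)).
have l1 := locint_vel_sqr H t; have l2 : locint (pot^~ t) := locint_pot H t.
rewrite /tail /density (ointD _ _ (locintZ 4^-1 l1) (locintZ 2^-1 l2)).
by rewrite (ointZ _ _ _ l1) (ointZ _ _ _ l2) /potI; field.
Qed.

Lemma potI_le t : 0 <= t -> t <= T -> potI t <= 2 * E.
Proof.
move=> t0 tT; have := kinetic_energy t0 tT.
have : 0 <= oint (- L) S (fun s => vel s t ^+ 2) by apply: oint_ge0 => // x _; exact: sqr_ge0.
by move=> + e; rewrite e subr_ge0 => h; rewrite -(@ler_pM2l _ 2)// mulrA (le_trans h)// -natrM.
Qed.

(** By evenness u(s + t, t) = u(- s - t, t), and the left-going characteristic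
    through the latter point starts at - s: as t varies with s fixed the
    mirror image stays on that one line. *)
Lemma left_field s t : 0 <= t ->
  u (s + t) t = u (- s) 0 + oint 0 t (fun r => - vel (- 2 * r - s) r).
Proof.
move=> t0.
have -> : u (s + t) t = u (- s - t) t by rewrite -(cs_even H) // opprD.
rewrite (cs_left H)// subrK; congr (_ + _).
have ll := locint_left H (- s).
have n2 : (- 2 : R) != 0 by rewrite oppr_eq0.
have := @oint_affine R (- 2) (- s) _ 0 t n2 ll.
rewrite mulr0 add0r [in RHS]oint_swap => h.
have -> : - s - t - t = - 2 * t - s by ring.
have e r : (- s - (- 2 * r - s)) / 2 = r by field.
have h1 : oint (- 2 * t - s) (- s) (fun s0 => vel s0 ((- s - s0) / 2)) =
   2 * oint 0 t (fun r => vel (- 2 * r - s) ((- s - (- 2 * r - s)) / 2)).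
  by rewrite -[LHS]opprK -h mulNr opprK.
rewrite h1 mulrA mulVf// mul1r -ointN; last exact: (locint_affine (- s) n2 ll).
by apply: eq_oint => r _; rewrite e.
Qed.

Definition moment t := oint (- L) S (fun s => u (s + t) t * vel s t).

Lemma potential_mulE y : y * nonlinearity p y = (p + 1) * potential p y.
Proof.
rewrite nonlinearity_mulE// /potential mulrA mulfV ?mul1r// gt_eqF//.
by rewrite addr_gt0// (lt_trans _ p1).
Qed.

Lemma cont_field : continuous (fun z : R * R => u (z.1 + z.2) z.2).
Proof.
by apply: (@cont_comp _ _ _ (fun z : R * R => (z.1 + z.2, z.2)) _ (cs_cont H)); cont.
Qed.

Lemma cont_impulse_refl : continuous (fun z : R * R => oint 0 z.2 (force (- 2 * z.2 - z.1))).
Proof.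
by apply: (@cont_comp _ _ _ (fun z : R * R => (- 2 * z.2 - z.1, z.2)) _ (cont_impulse H)); cont.
Qed.

Lemma locint2_v0_sqr_refl : locint2 (fun s r => v0 (- 2 * r - s) ^+ 2).
Proof.
have n1 : (- 1 : R) != 0 by rewrite oppr_eq0.
have := locint2_affine 0 (cs_v02 H) n1; congr locint2.
by apply/funext => s; apply/funext => r; rewrite addr0 mulN1r.
Qed.

Lemma locint2_vel_sqr : locint2 (fun s r => vel s r ^+ 2).
Proof.
have cV := cont_impulse H.
have l1 := locint2_contMl (@cont_cst (R * R)%type _ (1 : R)) (cs_v02 H).
have l2 := locint2_contMl (contM (@cont_cst (R * R)%type _ (2 : R)) cV) (cs_v0 H).
have l3 := locint2_cont (contM cV cV).
have := locint2D (locint2D l1 l2) l3; congr locint2.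
by apply/funext => s; apply/funext => r /=; rewrite velE; ring.
Qed.

Lemma locint2_vel_sqr_refl : locint2 (fun s r => vel (- 2 * r - s) r ^+ 2).
Proof.
have cV := cont_impulse_refl.
have l1 := locint2Z 2 locint2_v0_sqr_refl.
have l2 := locint2Z 2 (locint2_cont (contM cV cV)).
apply: (locint2_le _ (locint2D l1 l2)).
  apply: measurable_funX; apply: measurable_funD; last exact: continuous_measurable_fun2.
  apply: measurableT_comp; first exact: locint_measurable (cs_v0 H).
  by apply: continuous_measurable_fun2; cont.
move=> s r; rewrite velE /=.
set a := v0 _; set b := oint _ _ _.
have h1 := sqr_ge0 (a - b); have h2 := sqr_ge0 (a + b).
have e : (a - b) ^+ 2 + (a + b) ^+ 2 = 2 * a ^+ 2 + 2 * (b * b) by ring.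
by rewrite !ger0_norm -?e ?addr_ge0// lerDr.
Qed.

Let Phi s r := - 2^-1 * vel (- 2 * r - s) r ^+ 2 - 2^-1 * vel s r ^+ 2 + (p + 1) * pot s r.

Let l2Phi : locint2 Phi.
Proof.
have l1 := locint2Z (- 2^-1) locint2_vel_sqr_refl.
have l2 := locint2Z (- 2^-1) locint2_vel_sqr.
have l3 := locint2Z (p + 1) (locint2_cont (cont_pot H)).
have := locint2D (locint2D l1 l2) l3; congr locint2.
by apply/funext => s; apply/funext => r; rewrite /Phi [- 2^-1 * vel s r ^+ 2]mulNr.
Qed.

(** On a right-going characteristic both factors of u v are primitives: v of
    N(u), and u, by [left_field], of minus the value w of v at the mirror point.
    Hence (u v)' = - w v + u N(u), and - w v >= - (w^2 + v^2) / 2. *)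
Lemma virial_pointwise s t : 0 <= t ->
  oint 0 t (Phi s) <= u (s + t) t * vel s t - u s 0 * v0 s.
Proof.
move=> t0.
have n2 : (- 2 : R) != 0 by rewrite oppr_eq0.
pose g r := - vel (- 2 * r - s) r.
have lg : locint g.
  apply: locintN; apply: locintD; first exact: (locint_affine (- s) n2 (cs_v0 H)).
  by apply: locint_continuous; exact: (cont2l cont_impulse_refl).
have lf : locint (force s) by apply: locint_continuous; exact: (cont2l (cont_force H)).
have fE r : 0 <= r -> u s 0 + oint 0 r g = u (s + r) r.
  by move=> r0; rewrite left_field// (cs_even H).
have := oint_product_rule (u s 0) (v0 s) t0 lg lf.
rewrite (fE t t0) => <-.
have lpr : locint (fun x => g x * (v0 s + oint 0 x (force s)) + (u s 0 + oint 0 x g) * force s x).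
  apply: locintD.
    under eq_fun do rewrite mulrC; apply: locintMl => //.
    by apply: contD; [exact: cont_cst|exact: oint_continuous].
  apply: locintMl => //; apply: contD; [exact: cont_cst|exact: oint_continuous].
apply: (le_oint (locint2_l l2Phi s) lpr t0) => r /andP[r0 rt]; rewrite fE// forceE potential_mulE /Phi lerD2r.
rewrite -/(vel s r) /g; set a := vel _ r; set b := vel s r.
rewrite -subr_ge0 (_ : _ - _ = 2^-1 * (a - b) ^+ 2); last by field.
by rewrite mulr_ge0// sqr_ge0.
Qed.

(** Integrating [virial_pointwise] in s, the mirrored square has the same
    integral as v^2, namely 4 E - 2 \int P, and u N(u) = (p + 1) P. *)
Lemma virial t : 0 <= t -> t <= T ->
  moment 0 - 4 * E * t + (p + 3) * oint 0 t potI <= moment t.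
Proof.
move=> t0 tT.
have lm r : locint (fun s => u (s + r) r * vel s r).
  by apply: locintMl; [exact: (cont2r cont_field)|exact: locint_vel H r].
have m0 : moment 0 = oint (- L) S (fun s => u s 0 * v0 s).
  by apply: eq_oint => s _; rewrite addr0 velE oint_refl addr0.
have lm0 : locint (fun s => u s 0 * v0 s).
  by apply: locintMl; [exact: (cont2r (cs_cont H))|exact: cs_v0 H].
have step1 : oint (- L) S (fun s => oint 0 t (Phi s)) <= moment t - moment 0.
  rewrite m0 /moment -(ointB _ _ (lm t) lm0); apply: le_oint => //.
  - exact: locint_oint.
  - exact: locintB.
  - by move=> s _; exact: virial_pointwise.
rewrite (oint_fubini l2Phi NLS t0) in step1.
have inner r : 0 <= r <= t -> oint (- L) S (Phi^~ r) = - 4 * E + (p + 3) * potI r.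
  move=> /andP[r0 rt].
  have rT := le_trans rt tT.
  have kin := kinetic_energy r0 rT.
  have la := locint_vel_sqr H r.
  have lb : locint (fun s => vel (- 2 * r - s) r ^+ 2) := locint2_r locint2_vel_sqr_refl r.
  have lp : locint (pot^~ r) := locint_pot H r.
  have refl : oint (- L) S (fun s => vel (- 2 * r - s) r ^+ 2) = oint (- L) S (fun s => vel s r ^+ 2).
    have n1 : (- 1 : R) != 0 by rewrite oppr_eq0.
    have := @oint_affine R (- 1) (- 2 * r) _ (- L) S n1 la.
    rewrite [in RHS]oint_swap !mulN1r opprK => /eqP.
    rewrite eqr_opp => /eqP h.
    transitivity (oint (- S + - 2 * r) (L + - 2 * r) (fun s => vel s r ^+ 2)).
      by rewrite -h; apply: eq_oint => s _; rewrite mulN1r addrC.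
    have e2 : - 2 * r = - (2 * r) by exact: mulNr.
    have left0 x : x <= - S + - 2 * r -> vel x r ^+ 2 = 0.
      by rewrite e2 => h'; rewrite (vel_left H r0 h') expr0n.
    have right0 x : S <= x -> vel x r ^+ 2 = 0.
      by move=> h'; rewrite (vel_right H r0 h') expr0n.
    have h1 : - L <= - S + - 2 * r by rewrite e2; exact: Lt.
    have h2 : S <= L + - 2 * r.
      have h3 : S + 2 * r <= L.
        by apply: le_trans LT; rewrite lerD2l (ler_pM2l (ltr0n _ 2)); exact: rT.
      by rewrite e2 -(lerD2r (2 * r)) subrK.
    rewrite (oint_support la (lexx _) h2 left0 right0).
    by rewrite (oint_support la h1 (lexx _) left0 right0).
  have lA := locintZ (- 2^-1) lb; have lB := locintZ 2^-1 la; have lC := locintZ (p + 1) lp.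
  rewrite /Phi (ointD _ _ (locintB lA lB) lC) (ointB _ _ lA lB) (ointZ _ _ _ lb) (ointZ _ _ _ la) (ointZ _ _ _ lp).
  by rewrite refl kin -/(potI r); field.
have lP : locint potI := locint_continuous cont_potI.
have step2 : oint 0 t (fun r => oint (- L) S (Phi^~ r)) = - 4 * E * t + (p + 3) * oint 0 t potI.
  have lc : locint (fun _ : R => - 4 * E) := locint_continuous (@cont_cst _ _ _).
  rewrite (eq_oint_le t0 inner) (ointD _ _ lc (locintZ (p + 3) lP)) (ointZ _ _ _ lP).
  by rewrite oint_cst subr0.
by rewrite step2 lerBrDr in step1; apply: le_trans step1; rewrite -subr_ge0 (_ : _ - _ = 0)//; ring.
Qed.

End horizon.
End virial.
End virial_inequality.

(** * Linear growth of the tail mass *)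

Section tail_growth.
Context {R : realType}.
Notation oint := oriented_integral.

(** Where |y| > d the factor (|y| / d)^(p - 1) exceeds 1. *)
Lemma sqr_le_potential (p d y : R) : 1 < p -> 0 < d ->
  y ^+ 2 <= d ^+ 2 + (p + 1) / d `^ (p - 1) * potential p y.
Proof.
move=> p1 d0.
have dp : 0 < d `^ (p - 1) by exact: powR_gt0.
have pp : 0 < p + 1 by lra.
have C0 : 0 <= (p + 1) / d `^ (p - 1) * potential p y.
  apply: mulr_ge0; first by rewrite divr_ge0 ?powR_ge0// ltW.
  by rewrite mulr_ge0 ?powR_ge0// invr_ge0 ltW.
have [yd|dy] := leP `|y| d.
  rewrite -(ger0_norm (sqr_ge0 y)) normrX (@le_trans _ _ (d ^+ 2)) ?lerDl//.
  by rewrite ler_sqr ?nnegrE// ltW.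
have yp : d `^ (p - 1) <= `|y| `^ (p - 1).
  by apply: ge0_ler_powR; rewrite ?nnegrE ?subr_ge0 ?ltW// (lt_trans d0).
have e : potential p y = (p + 1)^-1 * (`|y| `^ (p - 1) * y ^+ 2).
  by rewrite /potential -(nonlinearity_mulE p1) /nonlinearity; congr (_ * _); rewrite mulrCA -expr2.
rewrite e.
have -> : (p + 1) / d `^ (p - 1) * ((p + 1)^-1 * (`|y| `^ (p - 1) * y ^+ 2)) =
    (`|y| `^ (p - 1) / d `^ (p - 1)) * y ^+ 2 by field; rewrite !gt_eqF.
rewrite ler_wpDl ?sqr_ge0// ler_peMl ?sqr_ge0// ler_pdivlMr// mul1r//.
Qed.

Lemma cont_max (m : R) : continuous (fun y : R => Num.max m y).
Proof.
rewrite (_ : (fun y => _) = fun y => 2^-1 * (m + y + `|m - y|)); first by cont.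
apply/funext => y; case: (leP m y) => h.
  by rewrite ler0_norm ?subr_le0//; field.
by rewrite ger0_norm ?subr_ge0 ?ltW//; field.
Qed.

Lemma cont_inv_max (m : R) : 0 < m -> continuous (fun y : R => (Num.max m y)^-1).
Proof.
move=> m0 y; apply: cvgV; last exact: cont_max.
by rewrite gt_eqF// lt_max m0.
Qed.

(** The chain rule for y |-> 1 / y.  The maximum with m, which leaves the values
    of the primitive unchanged, makes the integrand a continuous multiple of g
    on the whole line. *)
Lemma oint_inv_chain (g : R -> R) (a b c m : R) : a <= b -> 0 < m -> locint g ->
  (forall x, a <= x <= b -> m <= c + oint a x g) ->
  oint a b (fun x => - (Num.max m (c + oint a x g))^-1 ^+ 2 * g x) =
  (c + oint a b g)^-1 - c^-1.
Proof.
move=> ab m0 lg mG.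
have cG : continuous (fun x => c + oint a x g).
  by apply: contD; [exact: cont_cst|exact: oint_continuous].
have [M M0 GM] := @bounded_continuous_itv R _ a b (fun x _ => cG x).
have cF : continuous (fun y : R => - (Num.max m y)^-1 ^+ 2).
  by apply: contN; apply: contX; exact: cont_inv_max.
apply: (@oint_chain_rule R (fun y => y^-1) (fun y => - (Num.max m y)^-1 ^+ 2) g a b c m M) => //.
  move=> x xab; rewrite mG//= (le_trans (ler_norm _))// GM// in_itv.
move=> y /andP[my yM]; rewrite max_r//.
have y0 : y != 0 by rewrite gt_eqF// (lt_le_trans m0).
have h := @is_deriveV R (fun y => y) y 1 1 y0 (is_derive_id y 1).
by move: h; rewrite /GRing.scale/= mulr1 exprVn.
Qed.

Lemma tail_mass_algebra (E L S t a b i : R) :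
  E * (L - S) + a - i - (b + (a - S * E + E * t - i)) = E * (L - t) - b.
Proof. ring. Qed.

Lemma growth_algebra (k t c d : R) :
  c <= d -> 4 * (d + 1) <= t * k -> k * t / 4 <= k * t / 2 - c.
Proof. rewrite (mulrC t); lra. Qed.

Section morawetz.
Variables (p : R) (u : R -> R -> R) (v0 : R -> R) (S : R).
Hypothesis H : char_solution p u v0 S.

Notation vel := (vel p u v0).
Notation pot := (pot p u).
Notation density := (density p u v0).
Notation tail := (tail p u v0 S).
Notation ctail := (ctail p u v0 S).
Notation E := (energy p u v0 S).
Notation potI := (potI p u S).

Let S0 := cs_S H.
Let p1 := cs_p1 H.

(** The first moment, relative to the origin, of the right-going energy on the
    half-line x >= 0. *)
Definition tail_mass t := oint (- t) S (tail^~ t).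
Let q0 := oint (- S) S (tail^~ 0) - S * E.

Let cct t : continuous (ctail^~ t).
Proof. exact: (cont2r (cont_ctail H)). Qed.

Let lct t : locint (ctail^~ t).
Proof. by apply: locint_continuous; exact: cct. Qed.

(** The integral of the tail over [-L, S] decreases at the rate \int P, and its
    part behind s = -t is at most E (L - t). *)
Lemma tail_mass_lower t : 0 <= t ->
  q0 + E * t - oint 0 t (potI (S + 2 * t)) <= tail_mass t.
Proof.
move=> t0; pose L := S + 2 * t.
have NtS : - t <= S by rewrite (le_trans _ (ltW S0))// oppr_le0.
have SL : S <= L by rewrite lerDl mulr_ge0.
have NLt : - L <= - t by rewrite lerN2 /L mulr_natl mulr2n addrA ler_wpDl// addr_ge0// ltW.
have NSS : - S <= S by rewrite ge0_cp// ltW.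
have NLS : - L <= - S by rewrite lerN2.
have l2 := locint2_cont (cont_pot H).
have lp := locint_oint l2 t0.
have lt0 : locint (tail^~ 0) := locint_tail H 0.
have m1 : oint (- L) S (ctail^~ t) = oint (- L) S (tail^~ 0) - oint 0 t (potI L).
  by rewrite (ointB _ _ lt0 lp) (oint_fubini l2 (le_trans NLS NSS) t0).
have m0 : oint (- L) S (tail^~ 0) = E * (L - S) + oint (- S) S (tail^~ 0).
  rewrite -(oint_chasles (- L) (- S) S lt0); congr (_ + _).
  have -> : E * (L - S) = E * (- S - - L) by rewrite opprK addrC.
  rewrite -oint_cst; apply: eq_oint_le => // x /andP[_ xS].
  by apply: (tail_left H) => //; rewrite mulr0 subr0.
have le1 : oint (- L) (- t) (ctail^~ t) <= E * (L - t).
  have -> : E * (L - t) = E * (- t - - L) by rewrite opprK addrC.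
  rewrite -oint_cst; apply: le_oint => //; first exact: (locint_continuous (@cont_cst _ _ _)).
  move=> x /andP[_ xt]; have xS := le_trans xt NtS.
  by rewrite (ctailE H t0 xS); exact: (tail_le_energy H t0 xS).
have e2 : oint (- t) S (ctail^~ t) = tail_mass t.
  by apply: eq_oint_le => // x /andP[_ xS]; exact: (ctailE H t0 xS).
have := oint_chasles (- L) (- t) S (lct t); rewrite m1 m0 e2 => e3.
rewrite -(@lerD2l _ (oint (- L) (- t) (ctail^~ t))) e3 -/L.
rewrite -subr_ge0 (_ : _ - _ = E * (L - t) - oint (- L) (- t) (ctail^~ t)) ?subr_ge0//.
exact: tail_mass_algebra.
Qed.

(** Use u v <= (u^2 + v^2) / 2; here u^2 is at most d^2 plus a
    multiple of P(u), on an interval of length O(t). *)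
Lemma moment_upper d t : 0 < d -> 0 <= t ->
  moment p u v0 S (S + 2 * t) t <= d ^+ 2 * (S + t) + (p + 1) / d `^ (p - 1) * E + 2 * E.
Proof.
move=> d0 t0; pose L := S + 2 * t; rewrite -/L.
have NLS : - L <= S by rewrite (@le_trans _ _ 0) ?(ltW S0)// oppr_le0 addr_ge0 ?(ltW S0)// mulr_ge0.
pose C := (p + 1) / d `^ (p - 1); rewrite -/C.
have C0 : 0 <= C by rewrite divr_ge0 ?powR_ge0// addr_ge0// ltW// (lt_trans _ p1).
have kin := kinetic_energy H (lexx (S + 2 * t)) t0 (lexx t).
have pl := potI_le H t0 (lexx (S + 2 * t)) t0 (lexx t).
have pg : 0 <= potI L t by apply: oint_ge0 => // x _; exact: (pot_ge0 H).
have la := locint_vel_sqr H t; have lp : locint (pot^~ t) := locint_pot H t.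
have lc : locint (fun _ : R => 2^-1 * d ^+ 2) := locint_continuous (@cont_cst _ _ _).
have lpC := locintZ (2^-1 * C) lp; have laC := locintZ 2^-1 la.
have lm : locint (fun s => u (s + t) t * vel s t).
  by apply: locintMl; [exact: (cont2r (cont_field H))|exact: locint_vel H t].
have le1 : moment p u v0 S L t <= oint (- L) S (fun s => 2^-1 * d ^+ 2 + 2^-1 * C * pot s t + 2^-1 * vel s t ^+ 2).
  apply: le_oint => //; first exact: (locintD (locintD lc lpC) laC).
  move=> s _; have h := @sqr_le_potential p d (u (s + t) t) p1 d0.
  rewrite -/C -/(pot s t) in h.
  have h2 := sqr_ge0 (u (s + t) t - vel s t).
  move: h h2; set a := u _ _; set b := vel _ _; set c := pot _ _ => h h2.
  rewrite -subr_ge0 (_ : _ - _ = 2^-1 * (d ^+ 2 + C * c - a ^+ 2) + 2^-1 * (a - b) ^+ 2); last by field.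
  by rewrite addr_ge0// mulr_ge0// subr_ge0.
apply: (le_trans le1).
rewrite (ointD _ _ (locintD lc lpC) laC) (ointD _ _ lc lpC) oint_cst (ointZ _ _ _ lp) (ointZ _ _ _ la).
rewrite kin -/(potI L t).
have e : d ^+ 2 * (S + t) + C * E + 2 * E - (2^-1 * d ^+ 2 * (S - - L) + 2^-1 * C * potI L t + 2^-1 * (4 * E - 2 * potI L t))
   = 2^-1 * C * (2 * E - potI L t) + potI L t by rewrite /L; field.
by rewrite -subr_ge0 e addr_ge0// mulr_ge0 ?subr_ge0// mulr_ge0.
Qed.

(** Insert the bound on \int\int P that [virial] and [moment_upper] provide into
    [tail_mass_lower].  The linear terms combine to ((p - 1) E - d^2) t, where d
    is free. *)
Lemma tail_mass_growth : 0 < E ->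
  exists2 c, 0 < c & exists2 T0, 0 < T0 & forall t, T0 <= t -> c * t <= tail_mass t.
Proof.
move=> E0.
have pm : 0 < p - 1 by rewrite subr_gt0.
have pp : 0 < p + 3 by rewrite addr_gt0// (lt_trans _ p1).
pose k := (p - 1) * E.
have k0 : 0 < k by rewrite mulr_gt0.
(* half of the gain (p - 1) E t is spent on the d^2 t of the moment bound *)
pose d := Num.sqrt (k / 2).
have d0 : 0 < d by rewrite sqrtr_gt0 divr_gt0.
have d2 : d ^+ 2 = k / 2 by rewrite sqr_sqrtr// divr_ge0// ltW.
pose C := (p + 1) / d `^ (p - 1).
pose C1 := d ^+ 2 * S + C * E + 2 * E - moment p u v0 S S 0 - (p + 3) * q0.
have C10 := normr_ge0 C1.
exists (k / (4 * (p + 3))); first by rewrite divr_gt0// mulr_gt0.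
exists (4 * (`|C1| + 1) / k); first by rewrite divr_gt0// mulr_gt0// ltr_wpDl.
move=> t; rewrite ler_pdivrMr// => tT.
have t0 : 0 <= t.
  by rewrite -(pmulr_lge0 _ k0) (le_trans _ tT)// mulr_ge0// addr_ge0.
have lo := tail_mass_lower t0.
have up := moment_upper d0 t0.
have vi := virial H t0 (lexx (S + 2 * t)) t0 (lexx t).
have m0 : moment p u v0 S (S + 2 * t) 0 = moment p u v0 S S 0.
  apply: oint_support => //.
  - by apply: locintMl; [exact: (cont2r (cont_field H))|exact: locint_vel H 0].
  - by rewrite lerN2 lerDl mulr_ge0.
  - by move=> x xS; rewrite (u_left_cone H) ?mul0r// mulr0 subr0.
  - by move=> x xS; rewrite (u_right_cone H) ?mul0r.
rewrite m0 in vi.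
move: lo up vi tT; rewrite -/C.
set I := oint 0 t _; set q := tail_mass t; set m := moment _ _ _ _ _ t; set n := moment _ _ _ _ _ 0.
move=> lo up vi tT.
have C1E : C1 = d ^+ 2 * S + C * E + 2 * E - n - (p + 3) * q0 by [].
have C1l : C1 <= `|C1| by exact: ler_norm.
have key : k * t / 2 - C1 <= (p + 3) * q.
  have a1 : (p + 3) * (q0 + E * t - I) <= (p + 3) * q by rewrite ler_pM2l.
  have a2 : n - 4 * E * t + (p + 3) * I <= d ^+ 2 * (S + t) + C * E + 2 * E by exact: le_trans up.
  apply: le_trans a1; rewrite -subr_ge0.
  rewrite (_ : _ - _ = (d ^+ 2 * (S + t) + C * E + 2 * E) - (n - 4 * E * t + (p + 3) * I)) ?subr_ge0//.
  by rewrite C1E d2 /k; field.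
rewrite -(@ler_pM2l _ (p + 3))//; apply: le_trans key.
rewrite (_ : (p + 3) * (k / (4 * (p + 3)) * t) = k * t / 4); last by field; rewrite gt_eqF.
exact: growth_algebra C1l tT.
Qed.

End morawetz.
End tail_growth.

(** * The interaction functional *)

Section interaction_functional.
Context {R : realType}.
Notation oint := oriented_integral.

Lemma cone_algebra (a b c : R) : a <= - b - 2 * c -> a <= - (b + c) - c.
Proof. lra. Qed.

Lemma half_le (a b : R) : 0 <= a -> b <= 2 * (4^-1 * a + 2^-1 * b).
Proof. lra. Qed.

Lemma sqr_double (a : R) : 4 * a ^+ 2 = 2 * a * (2 * a).
Proof. ring. Qed.

Lemma invr_le_algebra (a b : R) : 0 < a -> 0 < b -> a^-1 <= b -> b^-1 <= a.
Proof. by move=> a0 b0 h; rewrite -[leRHS]invrK lef_pV2 ?posrE ?invr_gt0. Qed.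

Lemma inverse_rate_algebra (Q q d I c r : R) : 0 < c -> 0 < r -> 0 < Q -> c * r <= q ->
  0 <= d -> d * q <= Q -> - (4 * d ^+ 2) <= I ->
  - Q^-1 ^+ 2 * I <= - (4 / c ^+ 2) * (- r^-1 ^+ 2 * 1).
Proof.
move=> c0 r0 Q0 crq d0 dq ld.
have dcr : d * (c * r) <= Q by apply: le_trans dq; rewrite ler_wpM2l.
have cr0 : 0 < c * r by rewrite mulr_gt0.
have h : d ^+ 2 * Q^-1 ^+ 2 <= (c * r)^-1 ^+ 2.
  rewrite -exprMn ler_sqr ?nnegrE ?mulr_ge0 ?invr_ge0 ?(ltW cr0) ?(ltW Q0)//.
  by rewrite ler_pdivrMr// mulrC ler_pdivlMr.
rewrite (_ : - (4 / c ^+ 2) * _ = 4 * (c * r)^-1 ^+ 2); last by field; rewrite !gt_eqF.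
apply: (@le_trans _ _ (4 * (d ^+ 2 * Q^-1 ^+ 2))); last by rewrite ler_pM2l.
rewrite mulNr lerNl (_ : - (4 * _) = Q^-1 ^+ 2 * - (4 * d ^+ 2)); last by ring.
by rewrite ler_wpM2l// sqr_ge0.
Qed.

Lemma fold_algebra (a b c e : R) : 0 <= a -> c <= b ->
  - (2 * (e - c)) <= 2 * a - e + (2 * b - e).
Proof. lra. Qed.

Section interaction.
Variables (p : R) (u : R -> R -> R) (v0 : R -> R) (S : R).
Hypothesis H : char_solution p u v0 S.

Notation pot := (pot p u).
Notation density := (density p u v0).
Notation tail := (tail p u v0 S).
Notation ctail := (ctail p u v0 S).
Notation E := (energy p u v0 S).

Let S0 := cs_S H.
Let p1 := cs_p1 H.

Let cct : continuous (fun z : R * R => ctail z.1 z.2) := cont_ctail H.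

(** The integral of (x1 - x2)^+ against the product of the right-going energy
    densities at x1 and x2, after an exchange of integrations. *)
Definition interaction L t := oint (- L) S (fun s => ctail s t * (E - ctail s t)).

Let flux s r := (2 * ctail s r - E) * pot s r.

Let cont_flux : continuous (fun z : R * R => flux z.1 z.2).
Proof.
apply: contM; last exact: (cont_pot H).
by apply: contB; [apply: contM; [exact: cont_cst|exact: cct]|exact: cont_cst].
Qed.

Let product_cont t : continuous (fun s => ctail s t * (E - ctail s t)).
Proof.
have c := cont2r (y := t) cct.
by apply: contM; [exact: c|apply: contB; [exact: cont_cst|exact: c]].
Qed.

Definition interaction_rate L r := oint (- L) S (flux^~ r).

Lemma cont_interaction_rate L : continuous (interaction_rate L).
Proof.
by apply: (@cont_oint _ _ _ _ _ _ (fun z : R * R => flux z.1 z.2)); [cont..|exact: cont_flux].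
Qed.

(** For fixed s the integrand is A (E - A), and A has derivative - P(u) in
    time. *)
Lemma interaction_evol L t1 t2 : - L <= S -> t1 <= t2 ->
  interaction L t2 = interaction L t1 + oint t1 t2 (interaction_rate L).
Proof.
move=> LS t12.
rewrite /interaction_rate -(oint_fubini (locint2_cont cont_flux) LS t12).
have lF t := locint_continuous (@product_cont t).
have step s : oint t1 t2 (flux s) = ctail s t2 * (E - ctail s t2) - ctail s t1 * (E - ctail s t1).
  have lp : locint (pot s) := locint_continuous (cont2l (x := s) (cont_pot H)).
  have cF : continuous (fun y : R => E - 2 * y) by cont.
  have dF (y : R) : is_derive y (1 : R) (fun y => y * (E - y)) (E - 2 * y).
    by apply: is_derive_eq; rewrite /GRing.scale/=; ring.
  have yE x : ctail s t1 + oint t1 x (fun r => - pot s r) = ctail s x.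
    by rewrite (ointN _ _ lp) !ctail_def -(oint_chasles 0 t1 x lp); ring.
  have := @oint_chain_rule_everywhere R _ _ _ t1 t2 (ctail s t1) t12 (locintN lp) cF dF.
  rewrite yE => <-; apply: eq_oint => r _.
  by rewrite yE /flux; ring.
rewrite (eq_oint (g := fun s => ctail s t2 * (E - ctail s t2) - ctail s t1 * (E - ctail s t1))); last first.
  by move=> s _; exact: step.
by rewrite (ointB _ _ (lF t2) (lF t1)) /interaction addrC subrK.
Qed.

Section horizon.
Variables (T L : R).
Hypotheses (T0 : 0 <= T) (LT : S + 2 * T <= L).

Let NLS : - L <= S.
Proof. by rewrite (@le_trans _ _ 0) ?(ltW S0)// oppr_le0 (le_trans _ LT)// addr_ge0 ?mulr_ge0// ltW. Qed.

Let Lt t : t <= T -> - L <= - S - 2 * t.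
Proof.
by move=> tT; rewrite lerNl opprD !opprK (le_trans _ LT)// lerD2l ler_pM2l.
Qed.

Let NtS t : 0 <= t -> - t <= S.
Proof. by move=> t0; rewrite (le_trans _ (ltW S0))// oppr_le0. Qed.

(** The right-going energy on the half-line x <= 0 at time t. *)
Definition drop t := E - tail (- t) t.

Lemma drop_ge0 t : 0 <= t -> 0 <= drop t.
Proof. by move=> t0; rewrite subr_ge0 (tail_le_energy H t0)//; exact: NtS. Qed.

Lemma interaction_support t : 0 <= t -> t <= T -> interaction L t = interaction (S + 2 * t) t.
Proof.
move=> t0 tT; have l := locint_continuous (@product_cont t).
have SS : - S - 2 * t <= S.
  apply: le_trans (ltW S0); rewrite -opprD oppr_le0; apply: addr_ge0 (ltW S0) _; exact: mulr_ge0.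
rewrite /interaction -(oint_chasles (- L) (- (S + 2 * t)) S l) opprD.
rewrite [X in X + _]oint_eq0 ?add0r// => x; rewrite (max_r (Lt tT)) => /andP[_ xS].
rewrite (ctailE H t0 (le_trans xS SS)).
by rewrite (tail_left H t0 xS) subrr mulr0.
Qed.

(** For s >= -t the tail has lost at least [drop t]. *)
Lemma drop_mass_le t : 0 <= t -> t <= T -> drop t * tail_mass p u v0 S t <= interaction L t.
Proof.
move=> t0 tT; have l := locint_continuous (@product_cont t).
have LNt : - L <= - t.
  rewrite (le_trans (Lt tT))// -subr_ge0.
  by rewrite (_ : _ - _ = S + t) ?addr_ge0// ?ltW//; ring.
have lt : locint (tail^~ t) := locint_tail H t.
rewrite /tail_mass -(ointZ _ _ _ lt) /interaction -(oint_chasles (- L) (- t) S l).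
rewrite ler_wpDl//.
  apply: oint_ge0 => // s /andP[_ st]; have sS := le_trans st (NtS t0).
  rewrite (ctailE H t0 sS); apply: mulr_ge0; first exact: (tail_ge0 H _ sS).
  by rewrite subr_ge0; exact: (tail_le_energy H t0 sS).
apply: (le_oint (locintZ _ lt) l (NtS t0)) => s /andP[ts sS].
rewrite (ctailE H t0 sS) mulrC ler_wpM2l ?(tail_ge0 H)// /drop lerD2l lerN2.
exact: (tail_mono H).
Qed.

(** With B(x) the energy to the right of x, the rate is \int (2 B(x) - E) P dx.
    Folding the line by x |-> -x, for which P is invariant, replaces the weight
    by 2 (B(x) + B(-x) - E) on x >= 0, which is at least -2 D as B(x) >= 0 and
    B(-x) >= E - D.  The remaining \int_0^oo P equals \int_(-oo)^0 P, which is
    at most 2 D because P / 2 is part of the energy density. *)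
Lemma interaction_rate_lower t : 0 <= t -> t <= T ->
  - (4 * drop t ^+ 2) <= interaction_rate L t.
Proof.
move=> t0 tT.
pose M := S + t.
have M0 : 0 <= M by rewrite addr_ge0// ltW.
pose P x := pot (x - t) t; pose B x := ctail (x - t) t.
have PE x : P x = potential p (u x t) by rewrite /P potE subrK.
have Pe x : P (- x) = P x by rewrite !PE (cs_even H).
have P0 x : 0 <= P x by exact: (pot_ge0 H).
have cP : continuous P by apply: (@cont_comp _ _ _ (fun x => x - t) _ (cont2r (y := t) (cont_pot H))); cont.
have cB : continuous B by apply: (@cont_comp _ _ _ (fun x => x - t) _ (cont2r (y := t) cct)); cont.
have lP := locint_continuous cP.
have Psupp x : M <= `|x| -> P x = 0.
  by move=> h; rewrite PE (cs_supp H t0 h) (potential0 H).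
pose f x := (2 * B x - E) * P x.
have cf : continuous f by apply: contM => //; apply: contB; [apply: contM => //; exact: cont_cst|exact: cont_cst].
have lf := locint_continuous cf.
have n1 : (1 : R) != 0 by exact: oner_neq0.
have I1 : interaction_rate L t = oint (- L + t) (S + t) f.
  have := @oint_affine R 1 t f (- L) S n1 lf; rewrite !mul1r => <-.
  by apply: eq_oint => s _; rewrite mul1r /f /P /B addrK.
have LM : - L + t <= - M.
  by rewrite -lerBrDr; exact: cone_algebra (Lt tT).
have I2 : interaction_rate L t = oint 0 M (fun x => f x + f (- x)).
  have z1 x : x <= - M -> f x = 0.
    move=> h; rewrite /f Psupp; first exact: mulr0.
    by rewrite -normrN; apply: le_trans (ler_norm _); rewrite lerNr.
  have z2 x : M <= x -> f x = 0.
    move=> h; rewrite /f Psupp; first exact: mulr0.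
    by apply: le_trans h (ler_norm _).
  rewrite -(oint_fold M lf) I1; exact: (oint_support lf LM (lexx _) z1 z2).
have mS x : x <= M -> x - t <= S by rewrite lerBlDr.
have BE x : x <= M -> B x = tail (x - t) t by move=> xM; exact: (ctailE H t0 (mS x xM)).
have lD : - (2 * drop t) * oint 0 M P <= interaction_rate L t.
  rewrite -(ointZ _ _ _ lP) I2.
  apply: (le_oint (locintZ _ lP) (locintD lf (locint_opp lf)) M0) => x /andP[x0 xM].
  have Nx0 : - x <= 0 by rewrite oppr_le0.
  have NxM := le_trans Nx0 M0.
  rewrite /f Pe -mulrDl; apply: (ler_wpM2r (P0 x)).
  have h1 : 0 <= B x by rewrite (BE x xM); exact: (tail_ge0 H _ (mS x xM)).
  have Nxt : - x - t <= - t by rewrite gerDr.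
  have h2 : tail (- t) t <= B (- x).
    by rewrite (BE (- x) NxM); exact: (tail_mono H _ Nxt (NtS t0)).
  exact: fold_algebra.
have lP2 : oint 0 M P <= 2 * drop t.
  have -> : oint 0 M P = oint (- M) 0 P.
    rewrite -{2}oppr0 -(oint_opp _ _ lP).
    by apply: eq_oint => x _; rewrite Pe.
  have -> : oint (- M) 0 P = oint (- M - t) (- t) (pot^~ t).
    have := @oint_affine R 1 (- t) (pot^~ t) (- M) 0 n1 (locint_pot H t).
    by rewrite !mul1r add0r => <-; apply: eq_oint => x _; rewrite mul1r.
  have ld := locint_density H t.
  have e1 : - M - t = - S - 2 * t by rewrite /M; ring.
  have MtS : - M - t <= - t by rewrite gerDr oppr_le0.
  have tE : tail (- M - t) t = E by apply: (tail_left H t0); rewrite e1.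
  have -> : drop t = oint (- M - t) (- t) (density^~ t).
    rewrite /drop -tE; apply/eqP; rewrite subr_eq; apply/eqP/esym.
    exact: (oint_chasles (- M - t) (- t) S ld).
  rewrite -(ointZ _ _ _ ld); apply: (le_oint (locint_pot H t) (locintZ _ ld) MtS) => s _.
  exact: half_le (sqr_ge0 _).
apply: (le_trans _ lD); rewrite mulNr lerN2.
have -> : 4 * drop t ^+ 2 = 2 * drop t * (2 * drop t) by exact: sqr_double.
by apply: (ler_wpM2l _ lP2); apply: mulr_ge0 (drop_ge0 t0).
Qed.

(** The tail decreases continuously from E to 0, and where it equals E / 2 the
    integrand is positive. *)
Lemma interaction_gt0 t : 0 < E -> 0 <= t -> t <= T -> 0 < interaction L t.
Proof.
move=> E0 t0 tT.
have cc := cont2r (y := t) cct.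
have cL : ctail (- L) t = E by rewrite (ctailE H t0 NLS) (tail_left H t0 (Lt tT)).
have cS : ctail S t = 0 by rewrite (ctailE H t0 (lexx S)) (tail_right H t0 (lexx S)).
have E2 : 0 < E / 2 by rewrite divr_gt0.
have E2E : E / 2 < E by rewrite ltr_pdivrMr// ltr_pMr// ltr1n.
have [s sin sE] : exists2 s, s \in `[- L, S] & ctail s t = E / 2.
  apply: (@IVT _ (ctail^~ t) (- L) S (E / 2) NLS).
    exact: continuous_subspaceT.
  by rewrite cL cS ge_min le_max (ltW E2) (ltW E2E) orbT.
have nL : s != - L by apply/eqP => e; move: E2E; rewrite -sE e cL ltxx.
have nS : s != S by apply/eqP => e; move: E2; rewrite -sE e cS ltxx.
have sin' : - L < s < S.
  by move: sin; rewrite in_itv/= => /andP[h1 h2]; rewrite !lt_neqAle h1 h2 nS eq_sym nL.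
apply: (oint_gt0 (@product_cont t) _ sin').
  move=> y /andP[_ yS]; rewrite (ctailE H t0 yS); apply: mulr_ge0; first exact: (tail_ge0 H _ yS).
  by rewrite subr_ge0; exact: (tail_le_energy H t0 yS).
by rewrite sE; apply: mulr_gt0 => //; rewrite subr_gt0.
Qed.

End horizon.
(** By [drop_mass_le] and the growth of the tail mass D <= Q / (c t), so that
    (1/Q)' <= 4 D^2 / Q^2 <= 4 / (c t)^2 = ((- 4 / c^2) / t)'.  Both sides are
    integrated with [oint_inv_chain], the right one for the function t. *)
Lemma interaction_lower : 0 < E ->
  exists2 k, 0 < k & exists2 T0, 0 <= T0 & forall t, T0 <= t -> k <= interaction (S + 2 * t) t.
Proof.
move=> E0.
have [c c0 [T0 T00 qc]] := tail_mass_growth H E0.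
have T0' := ltW T00.
pose K := (interaction (S + 2 * T0) T0)^-1 + 4 / c ^+ 2 * T0^-1.
have Q0 : 0 < interaction (S + 2 * T0) T0 by exact: (interaction_gt0 T0' (lexx _) E0 T0' (lexx _)).
have K0 : 0 < K by rewrite /K addr_gt0 ?invr_gt0// mulr_gt0 ?invr_gt0// divr_gt0// exprn_gt0.
exists K^-1; first by rewrite invr_gt0.
exists T0; first exact: T0'.
move=> t Tt.
have t0 := le_trans T0' Tt.
pose L := S + 2 * t; pose Q := interaction L; rewrite -/L -/(Q t).
have LT : S + 2 * t <= L by exact: lexx.
have LS : - L <= S.
  by apply: le_trans (ltW S0); rewrite oppr_le0; apply: addr_ge0 (ltW S0) _; apply: mulr_ge0.
have Qpos r : T0 <= r -> r <= t -> 0 < Q r.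
  by move=> Tr rt; exact: (interaction_gt0 t0 LT E0 (le_trans T0' Tr) rt).
have lI : locint (interaction_rate L) := locint_continuous (@cont_interaction_rate L).
have QE r : T0 <= r -> Q T0 + oint T0 r (interaction_rate L) = Q r.
  by move=> Tr; exact: (esym (interaction_evol LS Tr)).
(* the chain rule for the inverse requires some positive lower bound on
   [T0, t], which may depend on t *)
have [m m0 mQ] : exists2 m, 0 < m & forall r, T0 <= r <= t -> m <= Q T0 + oint T0 r (interaction_rate L).
  have cG : continuous (fun r => Q T0 + oint T0 r (interaction_rate L)).
    by apply: contD; [exact: cont_cst|exact: oint_continuous].
  have [r rin rmin] := EVT_min Tt (continuous_subspaceT cG).
  exists (Q T0 + oint T0 r (interaction_rate L)).
    by move: rin; rewrite in_itv/= => /andP[h1 h2]; rewrite (QE r h1); exact: Qpos.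
  by move=> x xin; apply: rmin; rewrite in_itv.
have e1 := oint_inv_chain Tt m0 lI mQ.
rewrite (QE t Tt) in e1.
have l1 : locint (fun _ : R => 1 : R) := locint_continuous (@cont_cst _ _ _).
have o1 r : T0 + oint T0 r (fun=> 1) = r by rewrite oint_cst mul1r addrC subrK.
have m1 r : T0 <= r <= t -> T0 <= T0 + oint T0 r (fun=> 1) by move=> /andP[h _]; rewrite o1.
have e2 := oint_inv_chain Tt T00 l1 m1.
rewrite o1 in e2.
have cI : locint (fun x => - (Num.max m (Q T0 + oint T0 x (interaction_rate L)))^-1 ^+ 2 * interaction_rate L x).
  apply: locintMl => //; apply: contN; apply: contX.
  apply: (@cont_comp _ _ _ (fun r => Q T0 + oint T0 r (interaction_rate L)) _ (cont_inv_max m0)).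
  by apply: contD; [exact: cont_cst|exact: oint_continuous].
have c1 : locint (fun x => - (Num.max T0 (T0 + oint T0 x (fun=> 1)))^-1 ^+ 2 * 1).
  apply: locintMl => //; apply: contN; apply: contX.
  apply: (@cont_comp _ _ _ (fun r => T0 + oint T0 r (fun=> 1)) _ (cont_inv_max T00)).
  by apply: contD; [exact: cont_cst|exact: oint_continuous].
have le1 : (Q t)^-1 - (Q T0)^-1 <= - (4 / c ^+ 2) * (t^-1 - T0^-1).
  rewrite -e1 -e2 -(ointZ _ _ _ c1); apply: (le_oint cI (locintZ _ c1) Tt) => r /andP[Tr rt].
  have mr := mQ r; rewrite Tr rt (QE r Tr) in mr.
  rewrite (QE r Tr) o1 (max_r Tr) (max_r (mr isT)).
  have r0 : 0 < r by exact: lt_le_trans Tr.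
  have := interaction_rate_lower LT (ltW r0) rt.
  have := drop_mass_le LT (ltW r0) rt.
  have := drop_ge0 (ltW r0).
  have := qc r Tr; have := Qpos r Tr rt.
  exact: inverse_rate_algebra.
apply: (invr_le_algebra (Qpos t Tt (lexx t)) K0).
have -> : K = (Q T0)^-1 + 4 / c ^+ 2 * T0^-1 by rewrite /K /Q (interaction_support LT T0' Tt).
rewrite -lerBlDl; apply: (le_trans le1).
rewrite mulNr -mulrN opprB; apply: ler_wpM2l; last by rewrite gerBl invr_ge0.
by apply: divr_ge0 => //; exact: sqr_ge0.
Qed.

End interaction.
End interaction_functional.

(** * From finite-energy solutions to characteristic form *)

Section characteristic_form.
Context {R : realType}.

Lemma left_algebra (a b c d : R) :
  2^-1 * (a + b + c) - 2^-1 * d = b - 2^-1 * (b - a - c + d).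
Proof. lra. Qed.
Lemma sum_eq0 (a b : R) : 0 <= a -> 0 <= b -> 4^-1 * a + 2^-1 * b = 0 -> a = 0 /\ b = 0.
Proof. by move=> a0 b0 h; split; lra. Qed.
Lemma triangle_algebra1 (x t : R) : 0 <= t -> x - t <= x + t.
Proof. lra. Qed.
Lemma triangle_algebra2 (x t s : R) : x - t <= s -> s <= x + t ->
  0 <= (x + t - s) / 2 /\ (x + t - s) / 2 <= t.
Proof. by move=> h1 h2; split; lra. Qed.
Lemma triangle_algebra3 (x t s r : R) : (s + 2 * r <= x + t) = (r <= (x + t - s) / 2).
Proof. by apply/idP/idP; lra. Qed.
Lemma triangle_algebra4 (x t r : R) : r <= t -> x - t <= x + t - 2 * r.
Proof. lra. Qed.
Lemma triangle_algebra5 (x t r : R) : x + t - 2 * r + r = x + t - r.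
Proof. ring. Qed.

Notation mu := (@lebesgue_measure R).
Notation oint := oriented_integral.

Lemma Lfun_measurable (q : \bar R) (f : R -> R) : f \in Lfun mu q -> measurable_fun setT f.
Proof. by move=> /sub_Lfun_mfun; rewrite inE. Qed.

Lemma Lfun2_locint_sqr (f : R -> R) : f \in Lfun mu 2%:E -> locint (fun x => f x ^+ 2).
Proof. by move=> /Lfun2_integrable_sqr h; exact: locint_integrable. Qed.

Lemma norm_le_sqr (e y : R) : 0 < e -> `|y| <= e + e^-1 * y ^+ 2.
Proof.
move=> e0; rewrite -(@ler_pM2l _ e)// mulrDr mulrA mulfV ?gt_eqF// mul1r.
rewrite -(ger0_norm (sqr_ge0 y)) normrX -expr2.
have h : 0 <= (e - `|y|) ^+ 2 by exact: sqr_ge0.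
have h2 : 0 <= e * `|y| by rewrite mulr_ge0// ltW.
have -> : e ^+ 2 + `|y| ^+ 2 = (e - `|y|) ^+ 2 + e * `|y| + e * `|y| by ring.
by rewrite lerDr addr_ge0.
Qed.

Lemma Lfun2_locint (f : R -> R) : f \in Lfun mu 2%:E -> locint f.
Proof.
move=> hf; have l2 := Lfun2_locint_sqr hf.
have l1 : locint (fun x => 1 + f x ^+ 2).
  by apply: locintD => //; apply: locint_continuous; exact: cont_cst.
apply: (locint_le (Lfun_measurable hf) l1).
by move=> x; have := @norm_le_sqr 1 (f x) ltr01; rewrite invr1 mul1r.
Qed.

Lemma oint_ae (f g : R -> R) (a b : R) : locint f -> locint g ->
  {ae mu, forall x, f x = g x} -> oint a b f = oint a b g.
Proof.
move=> lf lg fg.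
wlog ab : a b / a <= b.
  move=> h; have [ab|ba] := leP a b; first exact: h.
  by rewrite oint_swap [RHS]oint_swap h// ltW.
have : (oint a b f)%:E = (oint a b g)%:E.
  rewrite (EFin_oint lf ab) (EFin_oint lg ab); apply: ae_eq_integral => //.
  - apply: measurable_funTS; apply: (iffRL (measurable_EFinP _ _)); exact: locint_measurable.
  - apply: measurable_funTS; apply: (iffRL (measurable_EFinP _ _)); exact: locint_measurable.
  by apply: (@filterS _ (almost_everywhere mu) _ _ _ _ fg) => x /= -> .
by case.
Qed.

Lemma compact_bounded_itv (K : set R) : compact K ->
  exists2 M, 0 < M & forall x, M <= `|x| -> ~ K x.
Proof.
move=> /compact_bounded cK.
have [M M0 hM] := @ex_strict_bound_gt0 _ _ _ _ _ (globally_filter K) cK.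
by exists M => // x Mx Kx; have := hM x Kx; apply/negP; rewrite -leNgt.
Qed.

Lemma dalembert0 (p : R) : dalembert p (fun=> 0) (fun=> 0 : R) (fun _ _ => 0).
Proof.
move=> x t _; rewrite oint0 !addr0 mulr0.
under eq_fun => r do under eq_fun => y do rewrite nonlinearity0.
under eq_fun => r do rewrite oint0.
by rewrite oint0 mulr0 subr0.
Qed.

(** The backward light triangle of (x, t), sliced by times on the left and by
    right-going characteristics on the right. *)
Lemma oint_triangle (k : R * R -> R) (x t : R) : continuous k -> 0 <= t ->
  oint 0 t (fun r => oint (x - t + r) (x + t - r) (fun y => k (y, r))) =
  oint (x - t) (x + t) (fun s => oint 0 ((x + t - s) / 2) (fun r => k (s + r, r))).
Proof.
move=> ck t0.
pose K s r := k (s + r, r).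
have cK : continuous (fun z : R * R => K z.1 z.2).
  by apply: (@cont_comp _ _ _ (fun z : R * R => (z.1 + z.2, z.2)) _ ck); cont.
pose F s r := if s + 2 * r <= x + t then K s r else 0.
have mF : measurable_fun setT (fun z : R * R => F z.1 z.2).
  apply: measurable_fun_ifT; last exact: measurable_cst.
    apply: measurable_fun_ler; last exact: measurable_cst.
    by apply: continuous_measurable_fun2; cont.
  exact: continuous_measurable_fun2.
have l2 : locint2 F.
  apply: (locint2_le mF (locint2_cont cK)) => s r; rewrite /F /=.
  by case: ifP => // _; rewrite normr0.
have xt : x - t <= x + t by exact: triangle_algebra1.
have := oint_fubini l2 xt t0.
have -> : oint (x - t) (x + t) (fun s => oint 0 t (F s)) =
    oint (x - t) (x + t) (fun s => oint 0 ((x + t - s) / 2) (fun r => k (s + r, r))).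
  apply: (eq_oint_le xt) => s /andP[s1 s2].
  have [h0 h1] := triangle_algebra2 s1 s2.
  rewrite -(oint_if (K s) (lexx 0) h0 h1); apply: (eq_oint_le t0) => r /andP[r0 _].
  by rewrite r0 /F triangle_algebra3.
move=> ->; apply: (eq_oint_le t0) => r /andP[r0 rt].
have h : x - t <= x + t - 2 * r by exact: triangle_algebra4.
have h' : x + t - 2 * r <= x + t by rewrite gerBl mulr_ge0.
have -> : oint (x - t) (x + t) (F^~ r) = oint (x - t) (x + t - 2 * r) (K^~ r).
  rewrite -(oint_if (K^~ r) (lexx (x - t)) h h'); apply: (eq_oint_le xt) => s /andP[s1 _].
  by rewrite s1 /F lerBrDr.
have lk : locint (fun y => k (y, r)) by apply: locint_continuous; exact: (cont2r ck).
have := oint_affine r (x - t) (x + t - 2 * r) (oner_neq0 R) lk.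
rewrite !mul1r triangle_algebra5 => <-.
by apply: eq_oint => s _; rewrite mul1r.
Qed.

Section reduction.
Variables (p : R) (u0 u1 : R -> R) (u ux ut : R -> R -> R).
Hypotheses (p1 : 1 < p) (H : finite_energy_solution p u0 u1 u ux ut).
Hypotheses (cu0 : compactly_supported u0) (cu1 : ae_compactly_supported u1).
Hypotheses (eu0 : forall x, u0 (- x) = u0 x)
  (eu1 : {ae mu, forall x, u1 (- x) = u1 x}).

Let cu : continuous (fun z : R * R => u z.1 z.2) := sol_continuous H.

Let lu1 : locint u1. Proof. exact: Lfun2_locint (data_velocity H). Qed.

Let lux : locint (ux^~ 0).
Proof. by have [h _] := sol_ux_L2 H; exact: Lfun2_locint (h 0). Qed.

Lemma solution_dalembert : dalembert p u0 u1 u.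
Proof. by move=> x t _; exact: (sol_dalembert H). Qed.

(** Reversing time changes the sign of the initial velocity. *)
Lemma solution_dalembert_reversed :
  dalembert p u0 (fun x => - u1 x) (fun x t => u x (- t)).
Proof.
move=> x t t0.
pose h r := oint (x - - t + r) (x + - t - r) (fun y => nonlinearity p (u y r)).
have cn : continuous (fun z : R * R => nonlinearity p (u z.1 z.2)).
  by apply: cont_comp cu; exact: continuous_nonlinearity.
have ch : continuous h.
  by apply: (@cont_oint _ _ _ _ _ id (fun z => nonlinearity p (u z.1 z.2))) => //; cont.
have lh := locint_continuous ch.
have e : oint 0 (- t) h = oint 0 t (fun r => - h (- r)).
  rewrite (ointN _ _ (locint_opp lh)) (oint_opp 0 t lh) oppr0.
  exact: oint_swap.
rewrite (sol_dalembert H x (- t)) -/h e (ointN _ _ lu1) (oint_swap u1) !opprK.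
apply: (congr2 (fun a b => 2^-1 * (a + _) - 2^-1 * b)); first exact: addrC.
apply: eq_oint => r _; rewrite /h oint_swap !opprK.
by congr oint.
Qed.

Lemma data_increment (a b : R) : a <= b -> u0 b - u0 a = oint a b (ux^~ 0).
Proof.
move=> ab; rewrite -!(sol_init_position H).
apply: (weak_derivative_oint _ lux (sol_ux H 0) ab).
exact: (cont2r cu).
Qed.

(** Uniqueness forward in time, and again after reversing time. *)
Lemma data_zero : (forall x, u0 x = 0) -> (forall a b, a <= b -> oint a b u1 = 0) ->
  forall x t, u x t = 0.
Proof.
move=> z0 z1.
have uniq w1 w : dalembert p u0 w1 w -> continuous (fun z : R * R => w z.1 z.2) ->
    (forall a b, a <= b -> oint a b w1 = 0) -> forall x t, 0 <= t -> w x t = 0.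
  move=> dw cw zw x t t0.
  apply: (dalembert_unique (x0 := x) (t0 := t) p1 cw (@cont_cst _ _ (0 : R)) dw (@dalembert0 p) t0).
    by move=> y _; exact: z0.
  by move=> c d _ cd _; rewrite oint0 zw.
move=> x t; have [t0|t0] := leP 0 t; first exact: (uniq _ _ solution_dalembert).
rewrite -(opprK t).
have cr : continuous (fun z : R * R => u z.1 (- z.2)).
  by apply: (@cont_comp _ _ _ (fun z : R * R => (z.1, - z.2)) _ cu); cont.
apply: (uniq _ _ solution_dalembert_reversed cr).
  by move=> c d cd; rewrite (ointN _ _ lu1) z1// oppr0.
by rewrite oppr_ge0 ltW.
Qed.

Lemma data_radius : exists2 M, 0 < M &
  (forall x, M <= `|x| -> u0 x = 0) /\ {ae mu, forall x, M <= `|x| -> u1 x = 0}.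
Proof.
have [K0 /compact_bounded_itv[M0 M00 h0] z0] := cu0.
have [K1 /compact_bounded_itv[M1 M10 h1] z1] := cu1.
exists (Num.max M0 M1); first by rewrite lt_max M00.
split.
  by move=> x; rewrite ge_max => /andP[/h0 + _]; exact: z0.
apply: (@filterS _ (almost_everywhere mu) _ _ _ _ z1) => x + hx; apply; apply: h1.
by move: hx; rewrite ge_max => /andP[_].
Qed.

Section radius.
Variables (M : R).
Hypotheses (M0 : 0 < M) (z0 : forall x, M <= `|x| -> u0 x = 0)
  (z1 : {ae mu, forall x, M <= `|x| -> u1 x = 0}).

Let lu : locint (fun x => ux x 0 - u1 x) := locintB lux lu1.

(** Outside of [-M, M] the difference vanishes almost everywhere; the cut-off
    makes it vanish everywhere. *)
Definition initial_vel x := if (- M <= x) && (x <= M) then ux x 0 - u1 x else 0.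

Let outside (a b x : R) : (b <= - M) || (M <= a) -> a <= x <= b -> M <= `|x|.
Proof.
move=> + /andP[ax xb]; case/orP => h.
  by rewrite -normrN (le_trans _ (ler_norm _))// lerNr (le_trans xb).
by rewrite (le_trans _ (ler_norm _))// (le_trans h).
Qed.

Lemma velocity_outside a b : a <= b -> (b <= - M) || (M <= a) -> oint a b u1 = 0.
Proof.
move=> ab out.
pose g x := if (M <= `|x|) then u1 x else 0.
have lg : locint g.
  apply: (locint_le _ (locint_norm lu1)); last by move=> x; rewrite /g; case: ifP => // _; rewrite normr0.
  apply: measurable_fun_ifT; [|exact: locint_measurable|exact: measurable_cst].
  by apply: measurable_fun_ler; [exact: measurable_cst|exact: normr_measurable].
transitivity (oint a b g).
  by apply: (eq_oint_le ab) => x xab; rewrite /g (outside out xab).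
have lz : locint (fun _ : R => 0 : R) by apply: locint_continuous; exact: cont_cst.
transitivity (oint a b (fun=> 0)); last exact: oint0.
apply: (oint_ae _ _ lg lz).
by apply: (@filterS _ (almost_everywhere mu) _ _ _ _ z1) => x; rewrite /g; case: ifP => // _; apply.
Qed.

Lemma increment_outside a b : a <= b -> (b <= - M) || (M <= a) ->
  oint a b (fun x => ux x 0 - u1 x) = 0.
Proof.
move=> ab out; rewrite (ointB _ _ lux lu1) (velocity_outside ab out) -data_increment// subr0.
by rewrite !z0 ?subrr//; apply: (outside out); rewrite lexx ab.
Qed.

Lemma oint_initial_vel a b : a <= b ->
  oint a b initial_vel = u0 b - u0 a - oint a b u1.
Proof.
move=> ab; rewrite data_increment// -(ointB _ _ lux lu1).
pose f x := ux x 0 - u1 x; rewrite -/f.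
have [bM|Mb] := ltP b (- M).
  rewrite (increment_outside ab) ?(ltW bM)//; apply: oint_eq0 => x; rewrite (min_l ab) (max_r ab) => /andP[_ xb].
  by rewrite /initial_vel leNgt (le_lt_trans xb bM).
have [Ma|aM] := ltP M a.
  rewrite (increment_outside ab) ?(ltW Ma) ?orbT//; apply: oint_eq0 => x; rewrite (min_l ab) (max_r ab) => /andP[ax _].
  by rewrite /initial_vel [x <= M]leNgt (lt_le_trans Ma ax) andbF.
pose c := Num.max a (- M); pose d := Num.min b M.
have ac : a <= c by rewrite le_max lexx.
have db : d <= b by rewrite ge_min lexx.
have NM : - M <= M by rewrite ge0_cp// ltW.
have cd : c <= d by rewrite ge_max !le_min ab aM Mb NM.
have -> : oint a b initial_vel = oint c d f.
  rewrite -(oint_if f ac cd db); apply: (eq_oint_le ab) => x /andP[ax xb].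
  by rewrite /initial_vel /c /d ge_max le_min ax xb.
rewrite -(oint_chasles a c b lu) -(oint_chasles c d b lu).
have -> : oint a c f = 0.
  rewrite /c; case: (leP a (- M)) => h; last exact: oint_refl.
  by apply: increment_outside => //; rewrite lexx.
have -> : oint d b f = 0.
  rewrite /d; case: (leP b M) => h; first exact: oint_refl.
  by apply: increment_outside; [exact: ltW|rewrite lexx orbT].
by rewrite add0r addr0.
Qed.

Lemma locint_initial_vel : locint initial_vel.
Proof.
apply: (locint_le _ (locint_norm lu)); last first.
  by move=> x; rewrite /initial_vel; case: ifP => // _; rewrite normr0.
apply: measurable_fun_ifT; [|exact: locint_measurable lu|exact: measurable_cst].
by apply: measurable_and; apply: measurable_fun_ler => //; exact: measurable_cst.
Qed.

Lemma locint_initial_vel_sqr : locint (fun x => initial_vel x ^+ 2).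
Proof.
have [h _] := sol_ux_L2 H.
have l1 := Lfun2_locint_sqr (h 0); have l2 := Lfun2_locint_sqr (data_velocity H).
have lg := locintD (locintZ 2 l1) (locintZ 2 l2).
apply: (locint_le _ lg); first by apply: measurable_funX; exact: locint_measurable locint_initial_vel.
move=> x; rewrite ger0_norm ?sqr_ge0//; apply: (@le_trans _ _ ((ux x 0 - u1 x) ^+ 2)).
  by rewrite /initial_vel; case: ifP => // _; rewrite expr0n sqr_ge0.
rewrite -subr_ge0 (_ : _ - _ = (ux x 0 + u1 x) ^+ 2) ?sqr_ge0//; ring.
Qed.

Let S := M + 1.
Let S0 : 0 < S. Proof. by rewrite addr_gt0. Qed.
Let MS : M < S. Proof. by rewrite ltrDl. Qed.

Lemma solution_even x t : 0 <= t -> u (- x) t = u x t.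
Proof.
move=> t0.
have cr : continuous (fun z : R * R => u (- z.1) z.2).
  by apply: (@cont_comp _ _ _ (fun z : R * R => (- z.1, z.2)) _ cu); cont.
have cn : continuous (fun z : R * R => nonlinearity p (u z.1 z.2)).
  by apply: cont_comp cu; exact: continuous_nonlinearity.
have dr : dalembert p (fun x => u0 (- x)) (fun x => u1 (- x)) (fun x t => u (- x) t).
  move=> y s s0; rewrite (solution_dalembert (- y) s0) (oint_opp _ _ lu1) !opprD opprK.
  apply: (congr2 (fun a b => 2^-1 * (a + _) - 2^-1 * b)); first exact: addrC.
  apply: eq_oint => r _.
  have ln : locint (fun z => nonlinearity p (u z r)) by apply: locint_continuous; exact: (cont2r cn).
  by rewrite (oint_opp _ _ ln); congr oint; ring.
apply: (dalembert_unique p1 cr cu dr solution_dalembert t0) => [y _|a b _ _ _]; first exact: eu0.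
exact: (oint_ae _ _ (locint_opp lu1) lu1 eu1).
Qed.

Lemma solution_cone x t : 0 <= t -> S + t <= `|x| -> u x t = 0.
Proof.
move=> t0 xS.
have cz : continuous (fun z : R * R => (fun _ _ : R => 0 : R) z.1 z.2) by exact: cont_cst.
have side : (x + t <= - M) || (M <= x - t).
  have [x0|x0] := leP 0 x.
    by apply/orP; right; rewrite lerBrDr (le_trans _ (_ : S + t <= _)) ?lerD2r ?(ltW MS)// -(ger0_norm x0).
  apply/orP; left; rewrite -lerBrDr -opprD lerNr -(ltr0_norm x0).
  by rewrite (le_trans _ xS)// lerD2r ltW.
apply: (dalembert_unique p1 cu cz solution_dalembert (@dalembert0 p) t0).
  by move=> y yx; apply: z0; exact: outside yx.
move=> a b xa ab bx; rewrite oint0; apply: velocity_outside => //.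
by case/orP: side => h; [rewrite (le_trans bx h)|rewrite (le_trans h xa) orbT].
Qed.

Lemma solution_char : char_solution p u initial_vel S.
Proof.
split => //.
- exact: solution_even.
- exact: solution_cone.
- exact: locint_initial_vel.
- exact: locint_initial_vel_sqr.
- move=> x Sx; rewrite /initial_vel -ler_norml leNgt.
  by rewrite (lt_le_trans MS Sx).
move=> x t t0.
have xt : x - t <= x + t by exact: triangle_algebra1.
have cn : continuous (fun z : R * R => nonlinearity p (u z.1 z.2)).
  by apply: cont_comp cu; exact: continuous_nonlinearity.
have cforce : continuous (fun z : R * R => force p u z.1 z.2).
  by apply: (@cont_comp _ _ _ (fun z : R * R => (z.1 + z.2, z.2)) _ cn); cont.
have lV : locint (fun s => oint 0 ((x + t - s) / 2) (force p u s)).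
  apply: locint_continuous.
  have cf : continuous (fun z : R * R => force p u z.2 z.1).
    by apply: (@cont_comp _ _ _ (fun z : R * R => (z.2, z.1)) _ cforce); cont.
  by apply: (@cont_oint _ _ _ _ _ _ (fun z : R * R => force p u z.2 z.1)) => //; cont.
rewrite (ointD _ _ locint_initial_vel lV) (oint_initial_vel xt) (sol_init_position H).
have := solution_dalembert x t0; rewrite (oint_triangle x cn t0) => ->.
exact: left_algebra.
Qed.

(** If E = 0, then P(u) and v^2 have zero integral at time 0, so u0 = 0, and
    u_x = 0 gives u1 = - v = 0 almost everywhere; by uniqueness u = 0. *)
Lemma solution_energy_gt0 : (exists x t, u x t != 0) -> 0 < energy p u initial_vel S.
Proof.
move=> [x [t uxt]]; have hc := solution_char.
rewrite lt_neqAle (energy_ge0 hc) andbT eq_sym; apply/eqP => E0.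
move/eqP: uxt; apply.
have NSS : - S <= S by rewrite ge0_cp// ltW.
pose v02 y := initial_vel y ^+ 2.
have lv2 : locint v02 := locint_initial_vel_sqr.
have lp : locint (pot p u ^~ 0) := locint_pot hc 0.
have iv0 : 0 <= oint (- S) S v02 by apply: (oint_ge0 NSS) => y _; exact: sqr_ge0.
have ip0 : 0 <= oint (- S) S (pot p u ^~ 0) by apply: (oint_ge0 NSS) => y _; exact: (pot_ge0 hc).
have eE : 4^-1 * oint (- S) S v02 + 2^-1 * oint (- S) S (pot p u ^~ 0) = 0.
  transitivity (energy p u initial_vel S); last exact: E0.
  rewrite -(ointZ _ _ _ lv2) -(ointZ _ _ _ lp).
  rewrite -(ointD _ _ (locintZ _ lv2) (locintZ _ lp)); apply: eq_oint => y _.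
  by rewrite /density /vel oint_refl addr0.
have [v20 p0] := sum_eq0 iv0 ip0 eE.
have u00 y : u0 y = 0.
  have [yS|yS] := leP S `|y|; first by apply: z0; exact: le_trans (ltW MS) yS.
  apply/eqP; case: eqP => // /eqP uy.
  have c0 : continuous (pot p u ^~ 0) := cont2r (cont_pot hc).
  have : 0 < oint (- S) S (pot p u ^~ 0).
    apply: (oint_gt0 c0 _ (x := y)); first by move=> z _; exact: (pot_ge0 hc).
      by rewrite -ltr_norml.
    rewrite /pot addr0 /potential (sol_init_position H) mulr_gt0 ?invr_gt0//.
      by rewrite addr_gt0// (lt_trans _ p1).
    by rewrite powR_gt0// normr_gt0.
  by rewrite p0 ltxx.
apply: (data_zero u00) => a b ab.
have := oint_initial_vel ab; rewrite !u00 subrr sub0r => e.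
rewrite -[LHS]opprK -e; apply/eqP; rewrite oppr_eq0; apply/eqP.
have ba0 : 0 <= b - a by rewrite subr_ge0.
apply: (le_eps_eq0 ba0) => d d0.
have lv := locint_initial_vel.
have ld : locint (fun _ : R => d) by apply: locint_continuous; exact: cont_cst.
apply: (le_trans (le_norm_oint lv ab)).
have lr := locintD ld (locintZ d^-1 lv2).
apply: (@le_trans _ _ (oint a b (fun y => d + d^-1 * v02 y))).
  by apply: (le_oint (locint_norm lv) lr ab) => y _; exact: norm_le_sqr.
rewrite (ointD _ _ ld (locintZ d^-1 lv2)) (ointZ _ _ _ lv2) oint_cst.
have -> : oint a b v02 = 0.
  have v2 y : 0 <= v02 y by exact: sqr_ge0.
  pose lo := Num.min a (- S); pose hi := Num.max b S.
  have loS : lo <= - S by rewrite ge_min lexx orbT.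
  have Shi : S <= hi by rewrite le_max lexx orbT.
  apply/eqP; rewrite eq_le (oint_ge0 ab) ?andbT; last by move=> y _; exact: v2.
  rewrite -v20 -(oint_support lv2 loS Shi).
  - by apply: (le_oint_sub lv2 v2 ab); rewrite ?ge_min ?le_max lexx.
  - move=> y yS; rewrite /v02 (cs_v0_supp hc) ?expr0n//.
    by rewrite -normrN; apply: le_trans (ler_norm _); rewrite lerNr.
  - by move=> y yS; rewrite /v02 (cs_v0_supp hc) ?expr0n// (le_trans yS)// ler_norm.
by rewrite mulr0 addr0.
Qed.

End radius.
End reduction.
End characteristic_form.

(** * The right-going derivative at later times *)

Section later_times.
Context {R : realType}.

Lemma double_algebra (a b : R) : - 2 * a = - b -> b = 2 * a.
Proof. lra. Qed.

Lemma slide_algebra (a i j f : R) :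
  (a - 2^-1 * (2 * i + j)) * f = (a - 2^-1 * j) * f - f * i.
Proof. by field. Qed.

Lemma increment_algebra (a b c d e : R) : d - c = a + b -> a - d = - c - b.
Proof. lra. Qed.

Lemma cancel_algebra (a b : R) : a - (- b + a) - b = 0.
Proof. ring. Qed.

Lemma split_error (d dM rr kk r0 k0 h e : R) : 0 < h -> `|dM - h * d| <= e * h -> dM = - rr - kk ->
  `|rr - h * r0| <= e * h -> `|kk - h * k0| <= e * h -> `|d - (- r0 - k0)| <= e * 3.
Proof.
move=> h0 h1 h2 h3 h4; rewrite -(ler_pM2l h0) -{1}(gtr0_norm h0) -normrM.
rewrite (_ : h * (d - _) = - ((dM - h * d) + (rr - h * r0) + (kk - h * k0))); last by rewrite h2; ring.
rewrite normrN (le_trans (ler_normD _ _))//.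
rewrite (_ : h * (e * 3) = e * h + e * h + e * h); last by ring.
by rewrite lerD// (le_trans (ler_normD _ _))// lerD.
Qed.

Notation mu := (@lebesgue_measure R).
Notation oint := oriented_integral.

Lemma is_derive_near (M : R -> R) (t d e : R) : is_derive t (1 : R) M d -> 0 < e ->
  exists2 r, 0 < r & forall h, 0 < h < r -> `|M (t + h) - M t - h * d| <= e * h.
Proof.
move=> [dM dE] e0.
have cv : h^-1 *: (M (h *: 1 + t) - M t) @[h --> (0 : R)^'] --> d.
  by rewrite -dE; exact: dM.
have /cvgr_dist_le/(_ _ e0) := cv.
rewrite /dnbhs /= => /nbhs_ballP[r /= r0 hr].
exists r => // h /andP[h0 hrr].
have := hr h; rewrite /ball/= sub0r normrN gtr0_norm// => /(_ hrr).
rewrite gt_eqF// => /(_ isT).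
rewrite /GRing.scale/= mulr1 (addrC h t) => hd.
rewrite (_ : _ - _ = - (h * (d - h^-1 * (M (t + h) - M t)))); last by field; rewrite gt_eqF.
by rewrite normrN normrM gtr0_norm// mulrC ler_pM2r.
Qed.

Lemma oint_near (k : R * R -> R) (e : R) : continuous k -> 0 < e ->
  exists2 r, 0 < r & forall h, 0 < h < r -> `|oint 0 h (fun x => k (h, x)) - h * k (0, 0)| <= e * h.
Proof.
move=> ck e0.
have /cvgr_dist_le/(_ _ e0)/nbhs_ballP[r /= r0 hr] := ck (0, 0).
exists r => // h /andP[h0 hrr].
have l1 : locint (fun x => k (h, x)) by apply: locint_continuous; exact: (cont2l ck).
have l2 : locint (fun _ : R => k (0, 0)) by apply: locint_continuous; exact: cont_cst.
have -> : h * k (0, 0) = oint 0 h (fun=> k (0, 0)) by rewrite oint_cst subr0 mulrC.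
rewrite -(ointB _ _ l1 l2) (_ : e * h = e * (h - 0)); last by rewrite subr0.
apply: (oint_norm_le (locintB l1 l2) (ltW h0)) => x /andP[x0 xh].
rewrite distrC; apply: (hr (h, x)).
by split; rewrite /ball/= sub0r normrN ger0_norm// ?(ltW h0)// (le_lt_trans xh).
Qed.

(** The fundamental theorem of calculus does not apply to the last integral,
    whose integrand depends on h too; continuity of k at (0, 0) is enough to
    identify the derivative. *)
Lemma right_derivative_eq (M rho : R -> R) (k : R * R -> R) (t d : R) :
  is_derive t (1 : R) M d -> continuous rho -> continuous k ->
  (forall h, 0 < h <= 1 -> M (t + h) - M t = - oint 0 h rho - oint 0 h (fun r => k (h, r))) ->
  d = - rho 0 - k (0, 0).
Proof.
move=> dM cr ck hM; apply/eqP; rewrite -subr_eq0; apply/eqP.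
apply: (@le_eps_eq0 R _ 3) => // e e0.
have cr2 : continuous (fun z : R * R => rho z.2) by apply: (cont_comp cr); cont.
have [a a0 ha] := is_derive_near dM e0.
have [b b0 hb] := oint_near cr2 e0.
have [c c0 hc] := oint_near ck e0.
pose m := Num.min (Num.min a b) (Num.min c 1).
have m0 : 0 < m by rewrite !lt_min a0 b0 c0 ltr01.
have h0 : 0 < m / 2 by rewrite divr_gt0.
have hm : m / 2 < m by rewrite ltr_pdivrMr// ltr_pMr// ltr1n.
have := hm.
rewrite {2}/m !lt_min => /andP[/andP[ma mb] /andP[mc m1]].
apply: (split_error h0 (ha _ _) (hM _ _) (hb _ _) (hc _ _)); rewrite h0//= ltW//.
Qed.

Section identification.
Variables (p : R) (u0 u1 : R -> R) (u ux ut : R -> R -> R) (v0 : R -> R) (S : R).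
Hypotheses (H : finite_energy_solution p u0 u1 u ux ut) (hc : char_solution p u v0 S).

Notation vel := (vel p u v0).

Let cu : continuous (fun z : R * R => u z.1 z.2) := sol_continuous H.

Let lv0 := cs_v0 hc.

Section test.
Variables (phi : R -> R) (t B : R).
Hypotheses (t0 : 0 <= t) (B0 : 0 < B) (dphi : forall x, derivable phi x 1)
  (cdphi : continuous (derive1 phi)) (phi0 : forall x, B <= `|x| -> phi x = 0).

Let dphi_is x : is_derive x (1 : R) phi (derive1 phi x).
Proof. by split => //; rewrite derive1E. Qed.

Let cphi : continuous phi.
Proof. by move=> x; apply: differentiable_continuous; apply/derivable1_diffP. Qed.

Let NBB : - B <= B. Proof. by rewrite ge0_cp// ltW. Qed.

Let phi_left x : x <= - B -> phi x = 0.
Proof.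
by move=> h; apply: phi0; rewrite -normrN; apply: le_trans (ler_norm _); rewrite lerNr.
Qed.

Let phi_right x : B <= x -> phi x = 0.
Proof. by move=> h; apply: phi0; exact: le_trans h (ler_norm _). Qed.

Let rho r := oint (- B) B (fun x => phi x * vel (- 2 * r + (x - t)) (t + r)).

(* u at (x - h, t + h), on the left-going characteristic of (x, t) *)
Let slide h := oint (- B) B (fun x => u (x - h) (t + h) * phi x).

Let L := B + 1.

Let k (z : R * R) := oint (- L) L (fun x => u x (t + z.1) * derive1 phi (x + z.2)).

Let cont_imp : continuous (fun z : R * R => oint 0 z.2 (force p u z.1)) := cont_impulse hc.

Let cont_V : continuous (fun z : R * R => phi z.1 * oint 0 (t + z.2) (force p u (- 2 * z.2 + (z.1 - t)))).
Proof.
apply: contM; first by apply: (cont_comp cphi); cont.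
by apply: (@cont_comp _ _ _ (fun z : R * R => (- 2 * z.2 + (z.1 - t), t + z.2)) _ cont_imp); cont.
Qed.

Let locint2_v : locint2 (fun x r => phi x * v0 (- 2 * r + (x - t))).
Proof.
have [M M0 pM] := @bounded_continuous_itv R phi (- B) B (fun x _ => @cphi x).
have pM' x : `|phi x| <= M.
  have [h|h] := leP B `|x|; first by rewrite phi0// normr0 ltW.
  by apply: pM; rewrite in_itv/= -ler_norml ltW.
have := locint2Z M (locint2_affine (- t) lv0 (oner_neq0 R)) => l2.
apply: (locint2_le _ l2) => [|x r].
  apply: measurable_funM.
    by apply: continuous_measurable_fun2; apply: (cont_comp cphi); cont.
  apply: (@measurableT_comp _ _ _ _ _ _ v0); first exact: locint_measurable.
  by apply: continuous_measurable_fun2; cont.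
by rewrite !normrM mul1r (ger0_norm (ltW M0)) ler_wpM2r.
Qed.

Let locint2_F : locint2 (fun x r => phi x * vel (- 2 * r + (x - t)) (t + r)).
Proof.
have := locint2D locint2_v (locint2_cont cont_V); congr locint2.
by apply/funext => x; apply/funext => r; rewrite velE mulrDr.
Qed.

(** Moving backwards in x while time advances stays on a left-going
    characteristic, where u changes by the integral of [vel]. *)
Lemma slide_back h : 0 <= h -> slide h = slide 0 - oint 0 h rho.
Proof.
move=> h0; rewrite /rho -(oint_fubini locint2_F NBB h0).
have ls r : locint (fun x => u (x - r) (t + r) * phi x).
  apply: locint_continuous; apply: contM; last exact: cphi.
  by apply: (@cont_comp _ _ _ (fun x => (x - r, t + r)) _ cu); cont.
rewrite /slide -(ointB _ _ (ls 0) (locint_oint locint2_F h0)).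
apply: eq_oint => x _.
have th : 0 <= t + h by exact: addr_ge0.
have lW := locint_left hc (x + t).
set W := (fun s => vel s ((x + t - s) / 2)) in lW.
have e1 : u (x - h) (t + h) = u (x + t) 0 - 2^-1 * oint (x - t - 2 * h) (x + t) W.
  rewrite (cs_left hc _ th) (_ : x - h + (t + h) = x + t); last by ring.
  by rewrite (_ : x - h - (t + h) = x - t - 2 * h); last by ring.
have e0 : u (x - 0) (t + 0) = u (x + t) 0 - 2^-1 * oint (x - t) (x + t) W.
  by rewrite subr0 addr0 (cs_left hc _ t0).
have n2 : (- 2 : R) != 0 by rewrite oppr_eq0.
have e2 : oint (x - t - 2 * h) (x - t) W = 2 * oint 0 h (fun r => vel (- 2 * r + (x - t)) (t + r)).
  have := oint_affine (x - t) 0 h n2 lW; rewrite [RHS]oint_swap mulr0 add0r => e.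
  rewrite (_ : x - t - 2 * h = - 2 * h + (x - t)); last by ring.
  have eW : oint 0 h (fun r => W (- 2 * r + (x - t))) = oint 0 h (fun r => vel (- 2 * r + (x - t)) (t + r)).
    by apply: eq_oint => r _; rewrite /W; congr vel; field.
  rewrite -eW; exact: (double_algebra e).
have lvr : locint (fun r => vel (- 2 * r + (x - t)) (t + r)).
  have := locint_affine (x - t) n2 lW; congr locint; apply/funext => r.
  by rewrite /W; congr vel; field.
rewrite e1 e0 -(oint_chasles (x - t - 2 * h) (x - t) (x + t) lW) e2 (ointZ _ _ _ lvr).
exact: slide_algebra.
Qed.

(** The same quantity with the displacement put on the test function, which is
    differentiable. *)
Lemma slide_test h : 0 < h <= 1 -> slide h =
  oint (- B) B (fun x => u x (t + h) * phi x) + oint 0 h (fun r => k (h, r)).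
Proof.
move=> /andP[h0 h1].
have cuh : continuous (fun x => u x (t + h)) := cont2r cu.
have lg : locint (fun x => u x (t + h) * phi (x + h)).
  by apply: locint_continuous; apply: contM => //; apply: (cont_comp cphi); cont.
have lf : locint (fun x => u x (t + h) * phi x).
  by apply: locint_continuous; apply: contM.
have LB : - L <= - B by rewrite lerN2 lerDl.
have BL : B <= L by rewrite lerDl.
have -> : slide h = oint (- L) L (fun x => u x (t + h) * phi (x + h)).
  have := oint_affine (- h) (- B) B (oner_neq0 R) lg; rewrite !mul1r => e.
  transitivity (oint (- B - h) (B - h) (fun x => u x (t + h) * phi (x + h))).
    by rewrite -e; apply: eq_oint => x _; rewrite mul1r subrK.
  apply/esym/oint_support => //.
  - by rewrite /L opprD lerD2l lerN2.
  - by rewrite (le_trans _ BL)// gerBl ltW.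
  - by move=> x xB; rewrite phi_left ?mulr0// -lerBrDr.
  - by move=> x xB; rewrite phi_right ?mulr0// -lerBlDr.
have -> : oint (- B) B (fun x => u x (t + h) * phi x) = oint (- L) L (fun x => u x (t + h) * phi x).
  apply/esym/oint_support => // x xB; [by rewrite phi_left ?mulr0|by rewrite phi_right ?mulr0].
have NLL : - L <= L by rewrite (le_trans LB)// (le_trans NBB).
have cK : continuous (fun z : R * R => u z.1 (t + h) * derive1 phi (z.1 + z.2)).
  apply: contM; first by apply: (cont_comp cuh); cont.
  by apply: (cont_comp cdphi); cont.
rewrite /k -(oint_fubini (locint2_cont cK) NLL (ltW h0)).
rewrite -(ointD _ _ lf (locint_oint (locint2_cont cK) (ltW h0))).
apply: eq_oint => x _ /=.
have cs : continuous (fun r => derive1 phi (x + r)) by apply: (cont_comp cdphi); cont.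
rewrite (ointZ _ _ _ (locint_continuous cs)) -mulrDr; congr (_ * _).
have dF r : 0 <= r <= h -> is_derive r (1 : R) (fun r => phi (x + r)) (derive1 phi (x + r)).
  move=> _.
  have d2 : is_derive r (1 : R) (fun r => x + r) 1.
    have := is_deriveD (is_derive_cst (x : R) r (1 : R)) (is_derive_id r (1 : R)).
    by rewrite add0r.
  have := @is_derive1_comp R phi (fun r => x + r) r _ _ (dphi_is (x + r)) d2.
  by rewrite mulr1.
rewrite (oint_derive (ltW h0) cs dF).
by rewrite addr0 [RHS]addrC subrK.
Qed.

Let cont_rho : continuous rho.
Proof.
have e r : rho r =
    oint (- B - t - 2 * r) (B - t - 2 * r) (fun s => phi (s + (t + 2 * r)) * v0 s) +
    oint (- B) B (fun x => phi x * oint 0 (t + r) (force p u (- 2 * r + (x - t)))).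
  have l1 : locint (fun x => phi x * v0 (- 2 * r + (x - t))) := locint2_r locint2_v r.
  have l2 : locint (fun x => phi x * oint 0 (t + r) (force p u (- 2 * r + (x - t)))).
    by apply: locint_continuous; exact: (cont2r cont_V).
  have lg : locint (fun s => phi (s + (t + 2 * r)) * v0 s).
    by apply: locintMl => //; apply: (cont_comp cphi); cont.
  have e1 : oint (- B) B (fun x => phi x * v0 (- 2 * r + (x - t))) =
      oint (- B - t - 2 * r) (B - t - 2 * r) (fun s => phi (s + (t + 2 * r)) * v0 s).
    have := oint_affine (- t - 2 * r) (- B) B (oner_neq0 R) lg; rewrite !mul1r !addrA => <-.
    by apply: eq_oint => x _; rewrite !mul1r; congr (phi _ * v0 _); ring.
  rewrite -e1 -(ointD _ _ l1 l2); apply: eq_oint => x _.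
  by rewrite velE mulrDr.
rewrite (funext e); apply: contD.
  have ca : continuous (fun r : R => - B - t - 2 * r) by cont.
  have cb : continuous (fun r : R => B - t - 2 * r) by cont.
  have cc : continuous (fun r : R => t + 2 * r) by cont.
  have cp : continuous (fun z : R * R => phi (z.1 + z.2)) by apply: (cont_comp cphi); cont.
  exact: (cont_ointM ca cb cc cp lv0).
by apply: (@cont_oint _ _ _ _ _ id (fun z : R * R => phi z.1 * oint 0 (t + z.2) (force p u (- 2 * z.2 + (z.1 - t))))) => //; cont.
Qed.

Let cont_k : continuous k.
Proof.
apply: (@cont_oint _ _ _ _ _ id (fun z : R * (R * R) => u z.1 (t + z.2.1) * derive1 phi (z.1 + z.2.2))); [cont..|].
apply: contM; last by apply: (cont_comp cdphi); cont.
by apply: (@cont_comp _ _ _ (fun z : R * (R * R) => (z.1, t + z.2.1)) _ cu); cont.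
Qed.

(** Comparing the two expressions of [slide] and dividing by h -> 0 computes the
    time derivative of \int u phi as - \int v phi - \int u phi', while by
    definition it is \int u_t phi. *)
Lemma weak_velocity : \int[mu]_x (ut x t * phi x) =
  - oint (- B) B (fun x => phi x * vel (x - t) t) + \int[mu]_x (ux x t * phi x).
Proof.
have out x : (x < - B) || (B < x) -> phi x = 0.
  by case/orP => /ltW; [exact: phi_left|exact: phi_right].
have tphi : test_function phi.
  split => //; exists `[- B, B]%classic; first exact: segment_compact.
  move=> x; rewrite /= in_itv/= => /negP; rewrite negb_and -!ltNge; exact: out.
have dM := sol_ut H tphi t.
have ME : (fun s => \int[mu]_x (u x s * phi x)) = fun s => oint (- B) B (fun x => u x s * phi x).
  by apply/funext => s; apply: Rintegral_oint => // x /out ->; rewrite mulr0.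
rewrite ME in dM.
have s0 : slide 0 = oint (- B) B (fun x => u x t * phi x).
  by rewrite /slide addr0; apply: eq_oint => x _; rewrite subr0.
have incr h : 0 < h <= 1 -> oint (- B) B (fun x => u x (t + h) * phi x) - oint (- B) B (fun x => u x t * phi x) =
    - oint 0 h rho - oint 0 h (fun r => k (h, r)).
  move=> h01; have := slide_test h01; case/andP: (h01) => /ltW h0 _.
  by rewrite (slide_back h0) s0; exact: increment_algebra.
have rE : rho 0 = oint (- B) B (fun x => phi x * vel (x - t) t).
  by rewrite /rho addr0; apply: eq_oint => x _; rewrite mulr0 add0r.
have dz x : B < `|x| -> derive1 phi x = 0.
  move=> xB; rewrite derive1E; have : is_derive x (1 : R) phi 0; last by case.
  have h0 : is_derive (x : R) (1 : R) (fun _ : R => 0 : R) 0 by exact: is_derive_cst.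
  apply: near_eq_is_derive h0.
  near=> y; apply/esym/phi0/ltW; near: y; apply: cvgr_gt xB.
  exact: norm_continuous.
have BL : B < L by rewrite ltrDl.
have dout x : (x < - L) || (L < x) -> u x t * derive1 phi x = 0.
  move=> xL; have Lx : L < `|x| by rewrite ltr_normr orbC ltrNr.
  by rewrite (dz x (lt_trans BL Lx)) mulr0.
have NLL : - L <= L by rewrite (ge0_cp (ltW (lt_trans B0 BL))).
have kE : k (0, 0) = - \int[mu]_x (ux x t * phi x).
  rewrite -(sol_ux H t tphi) (Rintegral_oint NLL dout) /k addr0.
  by apply: eq_oint => x _; rewrite addr0.
apply: (eq_trans (right_derivative_eq dM cont_rho cont_k incr)).
by rewrite rE kE opprK.
Unshelve. all: by end_near. Qed.

End test.

Theorem right_derivative_ae t : 0 <= t -> {ae mu, forall x, ux x t - ut x t = vel (x - t) t}.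
Proof.
move=> t0.
have [hx _] := sol_ux_L2 H; have [ht _] := sol_ut_L2 H.
have lx := Lfun2_locint (hx t); have lt := Lfun2_locint (ht t).
have lv : locint (fun x => vel (x - t) t).
  have := locint_affine (- t) (oner_neq0 R) (locint_vel hc t).
  by under eq_fun do rewrite mul1r.
have lxt := locintB lx lt; have lg := locintB lxt lv.
suff : {ae mu, forall x, ux x t - ut x t - vel (x - t) t = 0}.
  by apply: (@filterS _ (almost_everywhere mu)) => x /eqP; rewrite subr_eq0 => /eqP.
apply: (test_orthogonal_ae0 lg) => phi [dphi cdphi [K /compact_bounded_itv[B B0 hB] phi0]].
have phiB x : B <= `|x| -> phi x = 0 by move=> /hB; exact: phi0.
have NBB : - B <= B by rewrite ge0_cp// ltW.
have cphi : continuous phi.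
  by move=> x; apply: differentiable_continuous; apply/derivable1_diffP.
have zero x : (x < - B) || (B < x) -> phi x = 0.
  by move=> xB; apply/phiB/ltW; rewrite ltr_normr orbC ltrNr.
have toint (f : R -> R) : \int[mu]_x (f x * phi x) = oint (- B) B (fun x => phi x * f x).
  rewrite (Rintegral_oint NBB) => [|x /zero ->]; last by rewrite mulr0.
  by apply: eq_oint => x _; rewrite mulrC.
have := weak_velocity t0 B0 dphi cdphi phiB; rewrite !toint => e.
have mx := locintMl cphi lx; have mt := locintMl cphi lt; have mv := locintMl cphi lv.
transitivity (oint (- B) B (fun x => phi x * ux x t - phi x * ut x t - phi x * vel (x - t) t)).
  by apply: eq_oint => x _; rewrite !mulrBr.
rewrite (ointB _ _ (locintB mx mt) mv) (ointB _ _ mx mt) e.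
exact: cancel_algebra.
Qed.

End identification.

End later_times.

(** * From the interaction functional to the double integral *)

Section double_integral.
Context {R : realType}.
Notation mu := (@lebesgue_measure R).
Notation oint := oriented_integral.

Section pair_energy.
Variables (d : R -> R) (a b : R).
Hypotheses (ab : a <= b) (ld : locint d) (d0 : forall x, 0 <= d x).

Let cdist x : continuous (fun y : R => `|x - y|). Proof. by cont. Qed.

Definition mean_distance x := oint a b (fun y => `|x - y| * d y).

Lemma cont_mean_distance : continuous mean_distance.
Proof.
have cd : continuous (fun z : R * R => `|z.2 - z.1|) by cont.
have ca : continuous (fun _ : R => a) by cont.
have cb : continuous (fun _ : R => b) by cont.
exact: (cont_ointM ca cb (@cont_id R) cd ld).
Qed.

(** Integration by parts: \int_a^x (x - y) d(y) dy is the integral over [a, x]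
    of the primitive of d. *)
Lemma mean_distance_ge x : a <= x -> x <= b ->
  oint a x (fun y => oint a y d) <= mean_distance x.
Proof.
move=> ax xb.
have l1 : locint (fun _ : R => - 1 : R) by apply: locint_continuous; exact: cont_cst.
have cB : continuous (fun y => oint a y d) by exact: oint_continuous.
have yE y : x - a + oint a y (fun=> - 1) = x - y by rewrite oint_cst; ring.
have lB := locint_continuous cB.
have lxd : locint (fun y => (x - y) * d y) by apply: locintMl => //; cont.
have ldist : locint (fun y => `|x - y| * d y) by apply: locintMl => //; exact: cdist.
have := oint_product_rule (x - a) 0 ax l1 ld.
rewrite yE subrr mul0r mulr0 subr0 => e.
have -> : oint a x (fun y => oint a y d) = oint a x (fun y => (x - y) * d y).
  apply/eqP; rewrite eq_sym -subr_eq0 -(ointB _ _ lxd lB); apply/eqP.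
  by apply: (eq_trans _ e); apply: eq_oint => y _; rewrite add0r yE; ring.
apply: (@le_trans _ _ (oint a x (fun y => `|x - y| * d y))).
  by apply: (le_oint lxd ldist ax) => y _; rewrite ler_wpM2r// ler_norm.
by apply: (le_oint_sub ldist) => // y; rewrite mulr_ge0.
Qed.

(** A second integration by parts: with B the primitive of d and C that of B,
    \int d C = B(b) C(b) - \int B^2 = \int B (B(b) - B). *)
Lemma pair_energy_ge :
  oint a b (fun x => oint a x d * oint x b d) <= oint a b (fun x => d x * mean_distance x).
Proof.
pose B x := oint a x d.
have cB : continuous B by exact: oint_continuous.
have lB := locint_continuous cB.
pose C x := oint a x B.
have cC : continuous C by exact: oint_continuous.
have e := oint_product_rule 0 0 ab ld lB.
have lBB : locint (fun x => B x * (B b - B x)).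
  apply: locint_continuous; apply: (contM cB); apply: (contB _ cB); exact: cont_cst.
have ldC : locint (fun x => d x * C x) by under eq_fun do rewrite mulrC; exact: locintMl.
have ldm : locint (fun x => d x * mean_distance x).
  by under eq_fun do rewrite mulrC; apply: locintMl => //; exact: cont_mean_distance.
have -> : oint a b (fun x => oint a x d * oint x b d) = oint a b (fun x => B x * (B b - B x)).
  by apply: eq_oint => x _; rewrite /B -(oint_chasles a x b ld) addrAC subrr add0r.
have -> : oint a b (fun x => B x * (B b - B x)) = oint a b (fun x => d x * C x).
  have lBc : locint (fun x => B b * B x) by exact: locintZ.
  apply/eqP; rewrite -subr_eq0 -(ointB _ _ lBB ldC).
  have lq := locintB lBB ldC.
  have -> : oint a b (fun x => B x * (B b - B x) - d x * C x) =
     oint a b (fun x => B b * B x - (d x * (0 + oint a x B) + (0 + oint a x d) * B x)).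
    by apply: eq_oint => x _; rewrite /C /B !add0r; ring.
  have lpr : locint (fun x => d x * (0 + oint a x B) + (0 + oint a x d) * B x).
    apply: locintD; first by under eq_fun do rewrite add0r; exact: ldC.
    by under eq_fun do rewrite add0r; apply: locintMl.
  rewrite (ointB _ _ lBc lpr) e (ointZ _ _ _ lB) !add0r mulr0 subr0.
  by rewrite subrr.
apply: (le_oint ldC ldm ab) => x /andP[ax xb].
by apply: ler_wpM2l => //; exact: mean_distance_ge.
Qed.

(** Tonelli's theorem, restriction of both variables to [a, b], and replacement
    of e by d in each one-dimensional integral. *)
Lemma pair_integral_ge (e : R -> R) : measurable_fun setT e -> (forall x, 0 <= e x) ->
  {ae mu, forall x, e x = d x} ->
  ((oint a b (fun x => oint a x d * oint x b d))%:E <=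
   \int[(mu \x mu)%E]_z (`|z.1 - z.2| * e z.1 * e z.2)%:E)%E.
Proof.
move=> me e0 ed.
pose f (z : R * R) := (`|z.1 - z.2| * e z.1 * e z.2)%:E.
have f0 z : (0 <= f z)%E by rewrite lee_fin !mulr_ge0.
have mf : measurable_fun setT f.
  apply: (iffRL (measurable_EFinP _ _)); apply: measurable_funM; first apply: measurable_funM.
  - by apply: continuous_measurable_fun2; cont.
  - exact: measurableT_comp.
  - exact: measurableT_comp.
have mI : measurable `[a, b]%classic by exact: measurable_itv.
have lm x : locint (fun y => `|x - y| * d y) by apply: locintMl => //; exact: cdist.
have md0 x : 0 <= mean_distance x.
  by apply: (oint_ge0 ab) => y _; rewrite mulr_ge0.
have inner x : ((e x * mean_distance x)%:E <= fubini_F mu f x)%E.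
  rewrite /fubini_F.
  apply: (@le_trans _ _ (\int[mu]_(y in `[a, b]) f (x, y))%E); last first.
    by apply: ge0_subset_integral => //; exact: measurableT_comp mf (measurable_pair1 x).
  rewrite -(ointZ _ _ _ (lm x)) (EFin_oint (locintZ (e x) (lm x)) ab).
  rewrite le_eqVlt; apply/orP; left; apply/eqP; apply: ae_eq_integral => //.
  - apply: measurable_funTS; apply: (iffRL (measurable_EFinP _ _)).
    exact: (locint_measurable (locintZ (e x) (lm x))).
  - by apply: measurable_funTS; exact: measurableT_comp mf (measurable_pair1 x).
  apply: (@filterS _ (almost_everywhere mu) _ _ _ _ ed) => y + _.
  by rewrite /f /= => ->; congr (_%:E); ring.
have cm : continuous mean_distance by exact: cont_mean_distance.
have mm : measurable_fun setT (fun x => (e x * mean_distance x)%:E).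
  apply: (iffRL (measurable_EFinP _ _)); apply: measurable_funM => //.
  exact: continuous_measurable_fun.
have ldm : locint (fun x => d x * mean_distance x).
  by under eq_fun do rewrite mulrC; exact: locintMl.
have mF := @measurable_fun_fubini_tonelli_F _ _ _ _ _ mu f mf f0.
rewrite -/f (@fubini_tonelli1 _ _ _ _ _ mu mu f mf f0).
apply: (@le_trans _ _ (\int[mu]_(x in `[a, b]) (e x * mean_distance x)%:E)%E); last first.
  apply: (@le_trans _ _ (\int[mu]_(x in `[a, b]) fubini_F mu f x)%E).
    apply: ge0_le_integral => //.
    - by move=> x _; rewrite lee_fin mulr_ge0.
    - exact: measurable_funTS.
    - exact: measurable_funTS.
  apply: ge0_subset_integral => //.
  by move=> x _; apply: integral_ge0.
rewrite (_ : (\int[mu]_(x in `[a, b]) (e x * mean_distance x)%:E)%E = (oint a b (fun x => d x * mean_distance x))%:E).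
  by rewrite lee_fin; exact: pair_energy_ge.
rewrite (EFin_oint ldm ab); apply: ae_eq_integral => //.
- exact: measurable_funTS.
- by apply: measurable_funTS; apply: (iffRL (measurable_EFinP _ _)); exact: locint_measurable ldm.
by apply: (@filterS _ (almost_everywhere mu) _ _ _ _ ed) => x /= ->.
Qed.

End pair_energy.

Lemma limf_einf_gt0 (f : R -> \bar R) (k T : R) : 0 < k ->
  (forall t, T <= t -> (k%:E <= f t)%E) -> (0 < limf_einf f (pinfty_nbhs R))%E.
Proof.
move=> k0 kf; rewrite limf_einfE; apply: (@lt_le_trans _ _ k%:E); first by rewrite lte_fin.
apply: (@le_trans _ _ (ereal_inf [set f x | x in [set t | T <= t]])).
  by apply: le_ereal_inf_tmp => _ [t Tt <-]; exact: kf.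
apply: ereal_sup_ubound; exists [set t | T <= t] => //.
by exists T; split; [exact: num_real|move=> x /ltW].
Qed.

Section conclusion.
Variables (p : R) (u0 u1 : R -> R) (u ux ut : R -> R -> R) (v0 : R -> R) (S : R).
Hypotheses (H : finite_energy_solution p u0 u1 u ux ut) (hc : char_solution p u v0 S).

Lemma interaction_le_pair t : 0 <= t ->
  ((interaction p u v0 S (S + 2 * t) t)%:E <=
   \int[(mu \x mu)%E]_z (`|z.1 - z.2| * right_energy_density p u ux ut z.1 t
                            * right_energy_density p u ux ut z.2 t)%:E)%E.
Proof.
move=> t0; have p1 := cs_p1 hc; have S0 := cs_S hc.
have pp0 : 0 < p + 1 by rewrite addr_gt0// (lt_trans _ p1).
pose d x := density p u v0 (x - t) t.
have lD := locint_density hc t.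
have ld : locint d.
  by have := locint_affine (- t) (oner_neq0 R) lD; under eq_fun do rewrite mul1r.
have d0 x : 0 <= d x by exact: (density_ge0 hc).
pose b := S + t.
have b0 : 0 < b by exact: ltr_pwDl.
have bb : - b <= b by rewrite (ge0_cp (ltW b0)).
have [hx _] := sol_ux_L2 H; have [ht _] := sol_ut_L2 H.
have cu := cs_cont hc.
pose e x := right_energy_density p u ux ut x t.
have me : measurable_fun setT e.
  apply: measurable_funD; apply: measurable_funM; [exact: measurable_cst| |exact: measurable_cst|].
    apply: measurable_funX; apply: measurableT_comp; first exact: normr_measurable.
    by apply: measurable_funB; [exact: Lfun_measurable (hx t)|exact: Lfun_measurable (ht t)].
  apply: continuous_measurable_fun.
  by apply: (@cont_comp _ _ _ (u^~ t) _ (continuous_norm_powR pp0)); exact: (cont2r cu).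
have e0 x : 0 <= e x.
  by rewrite addr_ge0// mulr_ge0 ?powR_ge0 ?sqr_ge0// invr_ge0 mulr_ge0// ltW.
have ed : {ae mu, forall x, e x = d x}.
  apply: (@filterS _ (almost_everywhere mu) _ _ _ _ (right_derivative_ae H hc t0)) => x hxt.
  rewrite /e /right_energy_density hxt /d /density /pot subrK /potential mulrA -invfM.
  by rewrite -normrX (ger0_norm (sqr_ge0 _)).
have := pair_integral_ge bb ld d0 me e0 ed; apply: le_trans.
rewrite lee_fin le_eqVlt; apply/orP; left; apply/eqP.
have shift x y : oint x y d = oint (x - t) (y - t) (fun s => density p u v0 s t).
  have := oint_affine (- t) x y (oner_neq0 R) lD; rewrite !mul1r => <-.
  by apply: eq_oint => z _; rewrite mul1r.
have bt : b - t = S by rewrite /b addrK.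
have nbt : - b - t = - (S + 2 * t) by rewrite /b; ring.
pose g s := ctail p u v0 S s t * (energy p u v0 S - ctail p u v0 S s t).
have lg : locint g.
  have c : continuous (fun s => ctail p u v0 S s t) := cont2r (cont_ctail hc).
  by apply: locint_continuous; apply: (contM c); apply: (contB _ c); exact: cont_cst.
have := oint_affine (- t) (- b) b (oner_neq0 R) lg; rewrite !mul1r bt nbt => e1.
rewrite /interaction -e1; apply: (eq_oint_le bb) => x /andP[_ xb].
have xS : x - t <= S by rewrite lerBlDr.
have cE := ctailE hc t0 xS.
have gE : g (x - t) = tail p u v0 S (x - t) t * (energy p u v0 S - tail p u v0 S (x - t) t).
  by rewrite /g cE.
have tx : oint x b d = tail p u v0 S (x - t) t by rewrite shift bt.
rewrite mul1r gE tx; apply: (eq_trans (mulrC _ _)); congr (_ * _).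
have tE : tail p u v0 S (- b - t) t = energy p u v0 S.
  by apply: (tail_left hc t0); rewrite nbt opprD.
have t1 : tail p u v0 S (- b - t) t = oint (- b) x d + tail p u v0 S (x - t) t.
  by rewrite shift; exact: esym (oint_chasles (- b - t) (x - t) S lD).
rewrite -tE t1; exact: addrK.
Qed.

End conclusion.

End double_integral.

Theorem proposition2p8 (R : realType) (p : R) (u0 u1 : R -> R)
    (u ux ut : R -> R -> R) :
  1 < p ->
  finite_energy_solution p u0 u1 u ux ut ->
  compactly_supported u0 ->
  ae_compactly_supported u1 ->
  (forall x, u0 (- x) = u0 x) ->
  {ae lebesgue_measure, forall x, u1 (- x) = u1 x} ->
  (exists x t, u x t != 0) ->
  (0 < limf_einf
         (fun t : R =>
            \int[(@lebesgue_measure R \x @lebesgue_measure R)%E]_z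
              (`|z.1 - z.2| * right_energy_density p u ux ut z.1 t
                            * right_energy_density p u ux ut z.2 t)%:E)
         (pinfty_nbhs R))%E.
Proof.
move=> p1 H c0 c1 e0 e1 nz.
have [M M0 [z0 z1]] := data_radius c0 c1.
have hc := solution_char p1 H e0 e1 M0 z0 z1.
have E0 := solution_energy_gt0 p1 H e0 e1 M0 z0 z1 nz.
have [k k0 [T T0 kQ]] := interaction_lower hc E0.
apply: (limf_einf_gt0 k0 (T := T)) => t Tt.
apply: le_trans (interaction_le_pair H hc (le_trans T0 Tt)).
by rewrite lee_fin; exact: kQ.
Qed.
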